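(* Let $(M^n,g,f,\rho)$, $n\ge 3$, be a compact oriented static perfect fluid space-time with connected boundary $\partial M$ and constant positive scalar curvature $R$. Then $$\mathrm{Vol}(M)\geq\sqrt{\frac{(n-1)(n+2)}{2nR}}\;|\partial M|.$$ Moreover, if equality holds, then $(M^n,g)$ is isometric to the round hemisphere $\mathbb{S}^n_+$.
   Context: A static perfect fluid space-time $(M^n,g,f,\rho)$ with non-empty boundary is a smooth Riemannian manifold $(M^n,g)$, $n\ge 3$, with boundary $\partial M\neq\emptyset$, together with smooth functions $f,\rho$ on $M$ such that $f>0$ in the interior of $M$, $f^{-1}(0)=\partial M$, and $$f\,\mathring{Ric}=\mathring{\nabla}^2 f,\qquad \Delta f=\left(\frac{n-2}{2(n-1)}R+\frac{n}{n-1}\rho\right)f ,$$ where $R$ is the scalar curvature of $g$, $\mathring{Ric}=Ric-\frac{R}{n}g$, $\mathring{\nabla}^2 f=\nabla^2 f-\frac{\Delta f}{n}g$, and $\Delta f=\mathrm{tr}_g\nabla^2 f$. $|\partial M|$ is the $(n-1)$-dimensional volume of $\partial M$. *)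

(* Defs.v *)
From HB Require Import structures.
From mathcomp Require Export all_boot all_order all_algebra.
From mathcomp Require Export all_classical all_reals all_analysis.
Export Order.TTheory GRing.Theory Num.Theory.
Export numFieldNormedType.Exports.

Set Implicit Arguments.
Unset Strict Implicit.
Unset Printing Implicit Defensive.

Local Open Scope classical_set_scope.
Local Open Scope ring_scope.

(* Points of R^(m+1) are row vectors; the manifolds below have dimension m+1
   and are modelled on the closed half-space {x_0 >= 0}.                      *)

Section HalfSpaceCalculus.
Context {R : realType} {m : nat}.
Implicit Types (x : 'rV[R]_m.+1) (F : 'rV[R]_m.+1 -> R) (V : set 'rV[R]_m.+1).

Definition half_space : set 'rV[R]_m.+1 := [set x | 0 <= x 0 ord0].

Definition rel_open V := exists2 W, open W & V = W `&` half_space.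

(* Difference quotient of F at x along the i-th axis, with increments h such
   that x + h e_i stays in the half-space: two-sided inside, one-sided in the
   direction of x_0 on the boundary hyperplane. *)
Definition diff_quot (i : 'I_m.+1) F x : R -> R :=
  fun h => h^-1 * (F (x + h *: delta_mx 0 i) - F x).

Definition steps (i : 'I_m.+1) x : set_system R :=
  within [set h | half_space (x + h *: delta_mx 0 i)] (0 : R)^'.

Definition pderivable i F x := cvg (diff_quot i F x @ steps i x).

Definition pder i F : 'rV[R]_m.+1 -> R := fun x => lim (diff_quot i F x @ steps i x).

(* C^oo up to the boundary on a relatively open V: all iterated partial
   derivatives exist and are continuous on V. *)
Definition smooth_on V F := forall s : seq 'I_m.+1,
  {within V, continuous (foldr pder F s)} /\
  forall i x, V x -> pderivable i (foldr pder F s) x.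

(* Row i holds the i-th partial derivatives of the components of Phi. *)
Definition jacobian_mx (k : nat) (Phi : 'rV[R]_m.+1 -> 'rV[R]_k) x : 'M[R]_(m.+1, k) :=
  \matrix_(i, j) pder i (fun y => Phi y 0 j) x.

End HalfSpaceCalculus.

(* Tensor calculus for a metric given by its component matrix G in local
   coordinates. *)
Section LocalGeometry.
Context {R : realType} {m : nat}.
Variable G : 'rV[R]_m.+1 -> 'M[R]_m.+1.
Implicit Types (i j k l p : 'I_m.+1) (x : 'rV[R]_m.+1).

Definition metric_inv x : 'M[R]_m.+1 := invmx (G x).

(* Gamma^k_{ij} *)
Definition christoffel k i j x : R :=
  2^-1 * \sum_l metric_inv x k l *
    (pder i (fun y => G y j l) x + pder j (fun y => G y i l) x
     - pder l (fun y => G y i j) x).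

(* The d_l-component of R(d_i, d_j) d_k, where
   R(X, Y) Z = nabla_X nabla_Y Z - nabla_Y nabla_X Z - nabla_[X,Y] Z. *)
Definition riemann l i j k x : R :=
  pder i (christoffel l j k) x - pder j (christoffel l i k) x
  + \sum_p (christoffel l i p x * christoffel p j k x
            - christoffel l j p x * christoffel p i k x).

Definition ricci x : 'M[R]_m.+1 := \matrix_(j, k) \sum_i riemann i i j k x.

Definition metric_trace x (T : 'M[R]_m.+1) : R :=
  \sum_i \sum_j metric_inv x i j * T i j.

Definition scalar_curv x : R := metric_trace x (ricci x).

Definition hessian (u : 'rV[R]_m.+1 -> R) x : 'M[R]_m.+1 :=
  \matrix_(i, j) (pder i (pder j u) x - \sum_k christoffel k i j x * pder k u x).

Definition laplacian (u : 'rV[R]_m.+1 -> R) x : R := metric_trace x (hessian u x).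

Definition trace_free x (T : 'M[R]_m.+1) : 'M[R]_m.+1 :=
  T - (metric_trace x T / m.+1%:R) *: G x.

End LocalGeometry.

(* A chart is only relevant on its domain; cinv is the inverse on the image. *)
Record chart (R : realType) (m : nat) (M : Type) := Chart {
  cdom : set M;
  cmap : M -> 'rV[R]_m.+1;
  cinv : 'rV[R]_m.+1 -> M }.

Section Manifold.
Context {R : realType} {m : nat} {M : topologicalType}.
Implicit Types (c : chart R m M) (A O : set (chart R m M)).

Definition cimg c : set 'rV[R]_m.+1 := cmap c @` cdom c.

Record is_chart c : Prop := IsChart {
  chart_open : open (cdom c);
  chart_image : rel_open (cimg c);
  chart_inverse : {in cdom c, cancel (cmap c) (cinv c)};
  chart_continuous : {within cdom c, continuous (cmap c)};
  chart_inv_continuous : {within cimg c, continuous (cinv c)} }.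

Definition transition c c' : 'rV[R]_m.+1 -> 'rV[R]_m.+1 := cmap c' \o cinv c.

Definition smooth_transition c c' := forall j,
  smooth_on (cmap c @` (cdom c `&` cdom c')) (fun x => transition c c' x 0 j).

Record smooth_atlas A : Prop := SmoothAtlas {
  atlas_charts : forall c, A c -> is_chart c;
  atlas_covers : forall p, exists2 c, A c & cdom c p;
  atlas_compatible : forall c c', A c -> A c' -> smooth_transition c c' }.

Record manifold_with_boundary A : Prop := ManifoldWithBoundary {
  manifold_hausdorff : hausdorff_space M;
  manifold_second_countable : @second_countable M;
  manifold_atlas : smooth_atlas A }.

Definition bdry A : set M :=
  [set p | exists c, [/\ A c, cdom c p & cmap c p 0 ord0 = 0]].

(* The orientation is an oriented atlas O for the smooth structure of A. *)
Record oriented_by A O : Prop := OrientedBy {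
  orientation_compatible : smooth_atlas (A `|` O);
  orientation_atlas : smooth_atlas O;
  orientation_positive : forall c c' p, O c -> O c' -> cdom c p -> cdom c' p ->
    0 < \det (jacobian_mx (transition c c') (cmap c p)) }.

Definition smooth_function A (u : M -> R) :=
  forall c, A c -> smooth_on (cimg c) (u \o cinv c).

(* A metric is given by its components g c : cimg c -> matrices in each chart c
   of A, subject to the transformation law of a covariant 2-tensor. *)
Record riemannian_metric A (g : chart R m M -> 'rV[R]_m.+1 -> 'M[R]_m.+1) : Prop :=
  RiemannianMetric {
  metric_smooth : forall c, A c -> forall i j, smooth_on (cimg c) (fun x => g c x i j);
  metric_sym : forall c x, A c -> cimg c x -> (g c x)^T = g c x;
  metric_pos : forall c x, A c -> cimg c x ->
    forall v : 'rV[R]_m.+1, v != 0 -> 0 < (v *m g c x *m v^T) 0 0;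
  metric_change : forall c c' p, A c -> A c' -> cdom c p -> cdom c' p ->
    let J := jacobian_mx (transition c c') (cmap c p) in
    g c (cmap c p) = J *m g c' (cmap c' p) *m J^T }.

(* The round hemisphere of radius r in R^(m+2), of dimension m+1. *)
Definition hemisphere (r : R) : set 'rV[R]_m.+2 :=
  [set y | \sum_i y 0 i ^+ 2 = r ^+ 2 /\ 0 <= y 0 ord0].

(* F is a smooth homeomorphism onto the hemisphere that pulls the Euclidean
   metric back to g. *)
Definition isometric_to_hemisphere A (g : chart R m M -> 'rV[R]_m.+1 -> 'M[R]_m.+1)
    (r : R) :=
  exists (F : M -> 'rV[R]_m.+2) (Finv : 'rV[R]_m.+2 -> M),
  [/\ range F = hemisphere r,
      cancel F Finv,
      {within hemisphere r, continuous Finv},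
      forall k, smooth_function A (fun p => F p 0 k) &
      forall c p, A c -> cdom c p ->
        let J := jacobian_mx (F \o cinv c) (cmap c p) in
        J *m J^T = g c (cmap c p)].

End Manifold.

(* Lebesgue integral over R^n of a nonnegative Borel function, as an iterated
   integral (Tonelli). *)
Fixpoint lebesgue_int (R : realType) (n : nat) : ('rV[R]_n -> \bar R) -> \bar R :=
  match n with
  | 0 => fun F => F 0
  | n'.+1 => fun F =>
      (\int[@lebesgue_measure R]_t
         lebesgue_int (fun v : 'rV[R]_n' => F (row_mx (t%:M : 'rV[R]_1) v)))%E
  end.

(* The library's generated sigma-algebras live on pointed types, so M is a
   non-empty space with an irrelevant distinguished point. *)
Section Volume.
Context {R : realType} {m : nat} {M : ptopologicalType}.
Variables (A : set (chart R m M)) (g : chart R m M -> 'rV[R]_m.+1 -> 'M[R]_m.+1).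

Definition borel : measurableType (@open M).-sigma := g_sigma_algebraType (@open M).

(* These conditions determine mu (resp. sigma), as M is second countable; sigma
   is the Riemannian measure of the boundary, extended by 0 to Borel sets of M.
   Deleting row and column 0 of the metric gives the metric induced on x_0 = 0. *)
Definition is_volume (mu : {measure set borel -> \bar R}) :=
  forall c (B : set borel), A c -> measurable B -> B `<=` cdom c ->
  mu B = lebesgue_int (fun x : 'rV[R]_m.+1 =>
    (\1_(cmap c @` B) x * Num.sqrt (\det (g c x)))%:E).

Definition is_boundary_volume (sigma : {measure set borel -> \bar R}) :=
  forall c (B : set borel), A c -> measurable B -> B `<=` cdom c ->
  sigma B = lebesgue_int (fun y : 'rV[R]_m =>
    let x : 'rV[R]_m.+1 := row_mx (0 : 'rV[R]_1) y in
    (\1_(cmap c @` B) x * Num.sqrt (\det (row' ord0 (col' ord0 (g c x)))))%:E).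

End Volume.

Section StaticPerfectFluid.
Context {R : realType} {m : nat} {M : topologicalType}.

(* Static perfect fluid space-time of dimension n = m+1 with non-empty boundary. *)
Record static_perfect_fluid (A : set (chart R m M))
    (g : chart R m M -> 'rV[R]_m.+1 -> 'M[R]_m.+1) (f rho : M -> R) : Prop :=
  StaticPerfectFluid {
  spf_dim : (3 <= m.+1)%N;
  spf_manifold : manifold_with_boundary A;
  spf_metric : riemannian_metric A g;
  spf_bdry : bdry A !=set0;
  spf_f_smooth : smooth_function A f;
  spf_rho_smooth : smooth_function A rho;
  spf_f_pos : forall p, ~ bdry A p -> 0 < f p;
  spf_f_zero : f @^-1` [set 0] = bdry A;
  spf_ricci : forall c p, A c -> cdom c p ->
    let x := cmap c p in
    f p *: trace_free (g c) x (ricci (g c) x)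
    = trace_free (g c) x (hessian (g c) (f \o cinv c) x);
  spf_laplacian : forall c p, A c -> cdom c p ->
    let x := cmap c p in
    let n : R := m.+1%:R in
    laplacian (g c) (f \o cinv c) x
    = ((n - 2) / (2 * (n - 1)) * scalar_curv (g c) x + n / (n - 1) * rho p) * f p }.

Definition constant_scalar_curv (A : set (chart R m M))
    (g : chart R m M -> 'rV[R]_m.+1 -> 'M[R]_m.+1) (scal : R) :=
  forall c x, A c -> cimg c x -> scalar_curv (g c) x = scal.

End StaticPerfectFluid.

(* Main.v *)
(* Write n = m+1, q = scal/(n-1) and k = |grad f| on the boundary. Taking the
   divergence of the static equation, with the Ricci identity and the contracted
   Bianchi identity, shows that Lap f + q f is locally constant; it vanishes on
   the boundary, where moreover Hess f = 0, so that k is constant. On the union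
   M0 of the components of M where Lap f = - q f, put
     X = f grad(|grad f|^2)/2 - (|grad f|^2 + q f^2/2 - 3 k^2) grad f.
   Since |Hess f|^2 >= (Lap f)^2/n one finds div X >= E f^3 - 3 k^2 q f with
   E = (n+2) q^2/(2n), while the inward flux of X through the boundary is 2 k^3
   per unit area. If E t^2 = k^2 q then E f^3 - 3 k^2 q f = E (f-t)^2 (f+2t) - 2 k^2 q t,
   so the divergence theorem gives
     2 k^3 |bdry M| + int_M0 E (f-t)^2 (f+2t) <= 2 k^2 q t Vol(M0).
   The integral is positive, because f vanishes on the boundary and not
   elsewhere: the inequality of the theorem is always strict, and the rigidity
   statement holds because its hypothesis is never satisfied. *)

From HB Require Import structures.
Require Import Defs.
From mathcomp Require Import ring lra measurable_realfun.

Set Implicit Arguments.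
Unset Strict Implicit.
Unset Printing Implicit Defensive.

Local Open Scope classical_set_scope.
Local Open Scope ring_scope.

(** * Calculus up to the boundary on the half-space *)

(** The constant 3 k^2 is optimal. With C in its place the flux is (C - k^2) k per unit area, and
    the minimum of E f^3 - C q f over f >= 0 is a negative multiple of C^(3/2); maximising (C - k^2)
    / C^(3/2) gives C = 3 k^2. The other coefficients are forced as well: the coefficient of |grad
    f|^2 makes all terms Hess f(grad f, grad f) of div X cancel, and q/2 does the same for the terms
    in |grad f|^2, so that only f |Hess f|^2 and a polynomial in f remain. No positivity of k is
    known beforehand: if k = 0 then t = 0, and the final inequality is itself contradictory. Two
    obstacles shape the development. Smoothness is expressed by iterated partial derivatives,
    one-sided on the boundary hyperplane, so the chain rule, the symmetry of second derivatives and
    the divergence theorem are derived up to the boundary. And tensor identities would drown in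
    differentiability conditions; they are proved in a commutative ring with commuting derivations
    and then evaluated in the ring of smooth functions on a chart image. *)

Section HalfSpaceFilters.
Context {R : realType} {m : nat}.
Implicit Types (x y : 'rV[R]_m.+1) (F G : 'rV[R]_m.+1 -> R)
  (V : set 'rV[R]_m.+1) (i j : 'I_m.+1).
Local Notation e_ i := (delta_mx 0 i : 'rV[R]_m.+1).
Local Notation half := (@half_space R m).

Definition hnbhs x := within half (nbhs x).
Definition hcont F x := F @ hnbhs x --> F x.
(** Since [pder] is a [lim], which has a default value when there is no limit, the rules of calculus
    are stated for this relation and transferred by [is_pder_val]. *)
Definition is_pder i F x (l : R) := diff_quot i F x @ steps i x --> l.

Lemma hnbhs_filter x : Filter (hnbhs x).
Proof. exact: within_filter. Qed.

Lemma steps_filter i x : Filter (steps i x).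
Proof. exact: within_filter. Qed.

End HalfSpaceFilters.

#[global] Hint Extern 0 (Filter (hnbhs _)) => (apply: hnbhs_filter) : typeclass_instances.
#[global] Hint Extern 0 (Filter (steps _ _)) => (apply: steps_filter) : typeclass_instances.
#[global] Hint Extern 0 (Filter (nbhs (hnbhs _))) => (apply: hnbhs_filter) : typeclass_instances.
#[global] Hint Extern 0 (Filter (nbhs (steps _ _))) => (apply: steps_filter) : typeclass_instances.

Section HalfSpaceLimits.
Context {R : realType} {m : nat}.
Implicit Types (x y : 'rV[R]_m.+1) (F G : 'rV[R]_m.+1 -> R)
  (V : set 'rV[R]_m.+1) (i j : 'I_m.+1).
Local Notation e_ i := (delta_mx 0 i : 'rV[R]_m.+1).
Local Notation half := (@half_space R m).

Lemma shiftE x h i j : (x + h *: e_ i) 0 j = x 0 j + h *+ (j == i).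
Proof. by rewrite !mxE eqxx /= mulr_natr. Qed.

Lemma half_shift i x h : half x -> 0 <= h -> half (x + h *: e_ i).
Proof. by rewrite /half_space /= shiftE => x0 h0; rewrite addr_ge0// mulrn_wge0. Qed.

Lemma steps_proper i x : half x -> ProperFilter (steps i x).
Proof.
move=> hx; apply: Build_ProperFilter_ex => P [e /= e0 He].
(* A positive increment never leaves the half-space, so the filter is proper at boundary points
   too. *)
exists (e / 2); apply: He => /=.
- by rewrite sub0r normrN gtr0_norm ?divr_gt0// ltr_pdivrMr// ltr_pMr// ltr1n.
- by rewrite lt0r_neq0// divr_gt0.
- by apply: half_shift => //; rewrite divr_ge0// ltW.
Qed.

Lemma is_pder_cvg i F x l : is_pder i F x l -> pderivable i F x.
Proof. by move=> h; apply/cvg_ex; exists l. Qed.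

Lemma is_pder_val i F x l : half x -> is_pder i F x l -> pder i F x = l.
Proof. by move=> hx h; have ? := steps_proper i hx; apply: (@cvg_lim _ (@Rhausdorff R)). Qed.

Lemma pderP i F x : pderivable i F x -> is_pder i F x (pder i F x).
Proof. by []. Qed.

Lemma steps_neq0 i x : \forall h \near steps i x, h != 0.
Proof. by rewrite /steps; apply: filterS (nbhs_dnbhs_neq (0:R)) => h. Qed.

Lemma steps_to_hnbhs i x : x + h *: e_ i @[h --> steps i x] --> hnbhs x.
Proof.
have h0 : (fun h : R => x + h *: e_ i) @ nbhs (0:R) --> x.
  rewrite -[X in _ --> X]addr0 -(scale0r (e_ i)).
  by apply: cvgD; [exact: cvg_cst|apply: cvgZr_tmp; exact: cvg_id].
move=> P /= hP; have := h0 _ hP.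
by rewrite /steps /within /= /fmap /dnbhs /= /within; apply: (@filterS _ (nbhs (0:R))) => h hh _; exact: hh.
Qed.

Lemma near_steps i x (P : set 'rV[R]_m.+1) :
  (\forall y \near hnbhs x, P y) -> \forall h \near steps i x, P (x + h *: e_ i).
Proof. exact: steps_to_hnbhs. Qed.

Lemma cvg_eq_near (T : Type) (K : set_system T) (f g : T -> R) (l : R) {FK : Filter K} :
  g @ K --> l -> {near K, g =1 f} -> f @ K --> l.
Proof. by move=> gl fg; apply: cvg_trans gl; exact: near_eq_cvg. Qed.

Lemma is_pder_cont i F x l : is_pder i F x l ->
  F (x + h *: e_ i) @[h --> steps i x] --> F x.
Proof.
move=> dF.
have h0 : h @[h --> steps i x] --> (0 : R).
  by apply: cvg_trans; first exact: cvg_within; exact: cvg_within.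
rewrite -[X in _ --> X]add0r -[X in _ --> X + _](mul0r l).
apply: (cvg_eq_near (cvgD (cvgM h0 dF) (cvg_cst (F x)))).
near=> h; rewrite !fctE /diff_quot /=.
have hn0 : h != 0 by near: h; exact: steps_neq0.
by rewrite mulVKf// subrK.
Unshelve. all: by end_near. Qed.

(** The equality at [x] is a separate hypothesis: unless [half x] holds, [hnbhs x] says nothing
    about [x] itself. *)
Lemma is_pder_congr i F G x l : F x = G x -> {near hnbhs x, F =1 G} ->
  is_pder i F x l -> is_pder i G x l.
Proof.
move=> e0 FG; apply: cvg_trans; apply: near_eq_cvg.
have : \forall h \near steps i x, F (x + h *: e_ i) = G (x + h *: e_ i).
  exact: (near_steps i FG).
by apply: filterS => h e; rewrite /diff_quot e e0.
Qed.

Lemma near_hnbhs_self (P : set 'rV[R]_m.+1) x : half x ->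
  (\forall y \near hnbhs x, P y) -> P x.
Proof. by move=> hx nP; exact: (nbhs_singleton nP). Qed.

Lemma pder_congr i F G x : half x -> {near hnbhs x, F =1 G} ->
  pder i F x = pder i G x /\ (pderivable i F x <-> pderivable i G x).
Proof.
move=> hx FG; have e0 : F x = G x by exact: (near_hnbhs_self hx FG).
have q : {near steps i x, diff_quot i F x =1 diff_quot i G x}.
  have : \forall h \near steps i x, F (x + h *: e_ i) = G (x + h *: e_ i).
    exact: (near_steps i FG).
  by apply: filterS => h e; rewrite /diff_quot e e0.
have FGe : diff_quot i F x @ steps i x = diff_quot i G x @ steps i x.
  apply/seteqP; split; apply: near_eq_cvg => //.
  by apply: filterS q => h ->.
by rewrite /pder /pderivable FGe.
Qed.

Lemma hcont_congr F G x : half x -> {near hnbhs x, F =1 G} -> hcont F x -> hcont G x.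
Proof.
move=> hx FG; have e0 : F x = G x by exact: (near_hnbhs_self hx FG).
rewrite /hcont e0; apply: cvg_trans; apply: near_eq_cvg; exact: FG.
Qed.

Lemma near_hnbhs_near (P : set 'rV[R]_m.+1) x :
  (\forall y \near hnbhs x, P y) ->
  \forall y \near hnbhs x, \forall z \near hnbhs y, P z.
Proof.
by rewrite /hnbhs !near_withinE => /nbhs_interior; apply: filterS => y yP _.
Qed.

Lemma hcont_cst (a : R) x : hcont (fun=> a) x.
Proof. exact: cvg_cst. Qed.

Lemma hcontD F G x : hcont F x -> hcont G x -> hcont (fun y => F y + G y) x.
Proof. exact: cvgD. Qed.

Lemma hcontM F G x : hcont F x -> hcont G x -> hcont (fun y => F y * G y) x.
Proof. exact: cvgM. Qed.

Lemma hcont_sum (I : Type) (r : seq I) (P : pred I) (F : I -> 'rV[R]_m.+1 -> R) x :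
  (forall k, hcont (F k) x) -> hcont (fun y => \sum_(k <- r | P k) F k y) x.
Proof.
move=> cF; elim: r => [|k r IH].
  by under eq_fun do rewrite big_nil; exact: hcont_cst.
under eq_fun do rewrite big_cons; case: (P k) => //; exact: hcontD.
Qed.

Lemma hcont_comp F (phi : R -> R) x : hcont F x -> {for F x, continuous phi} ->
  hcont (phi \o F) x.
Proof. by move=> cF cphi; exact: (cvg_comp _ _ cF cphi). Qed.

Lemma hcont_coord x j : hcont (fun y => y 0 j) x.
Proof.
by apply: cvg_trans (@coord_continuous _ _ _ 0 j x); apply: cvg_app; exact: cvg_within.
Qed.

Lemma is_pder_cst i (a : R) x : is_pder i (fun=> a) x 0.
Proof.
rewrite /is_pder /diff_quot; under eq_fun do rewrite subrr mulr0; exact: cvg_cst.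
Qed.

Lemma is_pderD i F G x a b : is_pder i F x a -> is_pder i G x b ->
  is_pder i (fun y => F y + G y) x (a + b).
Proof.
move=> dF dG; apply: (cvg_eq_near (cvgD dF dG)).
by near=> h; rewrite /diff_quot /= /diff_quot opprD addrACA mulrDr.
Unshelve. all: by end_near. Qed.

Lemma is_pderM i F G x a b : is_pder i F x a -> is_pder i G x b ->
  is_pder i (fun y => F y * G y) x (a * G x + F x * b).
Proof.
move=> dF dG.
apply: (cvg_eq_near (cvgD (cvgM dF (is_pder_cont dG)) (cvgM (cvg_cst (F x)) dG))).
by near=> h; rewrite !fctE /diff_quot /=; ring.
Unshelve. all: by end_near. Qed.

Lemma is_pder_sum i (I : Type) (r : seq I) (P : pred I)
    (F : I -> 'rV[R]_m.+1 -> R) (l : I -> R) x :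
  (forall k, is_pder i (F k) x (l k)) ->
  is_pder i (fun y => \sum_(k <- r | P k) F k y) x (\sum_(k <- r | P k) l k).
Proof.
move=> dF; elim: r => [|k r IH].
  rewrite big_nil; under eq_fun do rewrite big_nil; exact: is_pder_cst.
rewrite big_cons; under eq_fun do rewrite big_cons.
by case: (P k) => //; exact: is_pderD.
Qed.

Lemma is_pder_coord i j x : is_pder i (fun y => y 0 j) x (j == i)%:R.
Proof.
apply: (@cvg_trans _ ((fun=> (j == i)%:R : R) @ steps i x)); last exact: cvg_cst.
apply: near_eq_cvg; near=> h.
have hn0 : h != 0 by near: h; exact: steps_neq0.
by rewrite /diff_quot shiftE addrAC subrr add0r -[h *+ _]mulr_natr mulKf.
Unshelve. all: by end_near. Qed.

Lemma is_pder_comp i F (phi : R -> R) x a b : is_pder i F x a ->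
  is_derive (F x) 1 phi b -> is_pder i (phi \o F) x (b * a).
Proof.
move=> dF [dphi phib].
(* Slope of [phi] at [F x], completed continuously by [b], so that the quotient still factors for
   increments at which [F] takes the value [F x] again. *)
pose q (s : R) := if s == 0 then b else s^-1 * (phi (s + F x) - phi (F x)).
have cq : q @ nbhs (0:R) --> b.
  have : q @ (0:R)^' --> b.
    have := dphi; rewrite /derivable => /cvg_ex[l ll].
    have lb : l = b by rewrite -phib; apply/esym/cvg_lim.
    rewrite -lb; apply: (cvg_eq_near ll); near=> s.
    have sn : s != 0 by near: s; exact: nbhs_dnbhs_neq.
    by rewrite /q (negbTE sn) /= [s *: 1]mulr1.
  have q0 : q 0 = b by rewrite /q eqxx.
  by move=> h; rewrite -q0; apply/continuous_withinNx; rewrite q0.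
have cF0 : F (x + h *: e_ i) - F x @[h --> steps i x] --> (0 : R).
  by rewrite -(subrr (F x)); apply: cvgB; [exact: is_pder_cont dF|exact: cvg_cst].
apply: (cvg_eq_near (cvgM (cvg_comp _ _ cF0 cq) dF)); near=> h; rewrite /diff_quot /= /q.
case: eqVneq => [/eqP|n0]; first by rewrite subr_eq0 => /eqP ->; rewrite !subrr !mulr0.
by rewrite subrK mulrCA; congr (_ * _); rewrite mulrAC mulVf// mul1r.
Unshelve. all: by end_near. Qed.

(** A condition at the single point [x]. The rules below assume it at all points near [x], where
    [pder i F] is then a genuine derivative and not a default value. *)
Definition C1at F x := hcont F x /\ forall i, pderivable i F x /\ hcont (pder i F) x.

End HalfSpaceLimits.

(** * Mean value theorems and symmetry of second derivatives up to the boundary *)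

Section MeanValue.
Context {R : realType} {m : nat}.
Implicit Types (x y z : 'rV[R]_m.+1) (F G : 'rV[R]_m.+1 -> R)
  (V : set 'rV[R]_m.+1) (i j k : 'I_m.+1).
Local Notation e_ i := (delta_mx 0 i : 'rV[R]_m.+1).
Local Notation half := (@half_space R m).

Lemma hnbhsP (P : set 'rV[R]_m.+1) x : (\forall y \near hnbhs x, P y) <->
  exists2 e : R, 0 < e & forall y, half y -> (forall k, `|y 0 k - x 0 k| < e) -> P y.
Proof.
rewrite /hnbhs near_withinE -nbhs_ballE; split => -[e e0 H]; exists e => // y.
  move=> hy ye; apply: H => //; split=> // i j; rewrite ord1 /ball /= distrC; exact: ye.
move=> [_ ye] hy; apply: H => // k; rewrite distrC; exact: ye.
Qed.

Lemma is_pder_dnbhs i F y l : (\forall h \near (0:R)^', half (y + h *: e_ i)) ->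
  is_pder i F y l -> diff_quot i F y @ (0:R)^' --> l.
Proof.
move=> hy dF P /dF; rewrite /steps /within /= => H.
by apply: filterS2 hy H => h hh; apply.
Qed.

Lemma is_pder_derive i F x s l : half x -> 0 < s -> is_pder i F (x + s *: e_ i) l ->
  is_derive s 1 (fun t : R => F (x + t *: e_ i)) l.
Proof.
move=> hx s0 dF.
have cl : (fun h : R => h^-1 *: (((fun t : R => F (x + t *: e_ i)) \o shift s) (h *: 1)
    - F (x + s *: e_ i))) @ (0:R)^' --> l.
  have : diff_quot i F (x + s *: e_ i) @ (0:R)^' --> l.
    apply: is_pder_dnbhs dF; near=> h; rewrite -addrA -scalerDl; apply: half_shift => //.
    have : `|h| < s by near: h; exact: dnbhs0_lt.
    by rewrite ltr_norml; lra.
  move=> dl; apply: (cvg_eq_near dl); near=> h; rewrite /diff_quot /=.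
  by rewrite [h *: 1]mulr1 -addrA -scalerDl [s + h]addrC.
by split; [apply/cvg_ex; exists l|exact: cvg_lim cl].
Unshelve. all: by end_near. Qed.

Lemma is_pderN i F x a : is_pder i F x a -> is_pder i (fun y => - F y) x (- a).
Proof.
move=> dF; have := is_pderM (is_pder_cst i (-1) x) dF.
by rewrite mul0r add0r mulN1r; under eq_fun do rewrite mulN1r.
Qed.

Lemma is_pderB i F G x a b : is_pder i F x a -> is_pder i G x b ->
  is_pder i (fun y => F y - G y) x (a - b).
Proof. by move=> dF dG; apply: is_pderD dF (is_pderN dG). Qed.

Lemma hcontN F x : hcont F x -> hcont (fun y => - F y) x.
Proof. exact: cvgN. Qed.

Lemma hcontB F G x : hcont F x -> hcont G x -> hcont (fun y => F y - G y) x.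
Proof. exact: cvgB. Qed.

Lemma hcont_line F x i s h : half x -> 0 <= s <= h -> hcont F (x + s *: e_ i) ->
  F (x + t *: e_ i) @[t --> within `[0, h] (nbhs s)] --> F (x + s *: e_ i).
Proof.
move=> hx sh cF; apply: (cvg_comp _ _ _ cF) => P hP.
have c0 : (fun t : R => x + t *: e_ i) @ nbhs s --> x + s *: e_ i.
  by apply: cvgD; [exact: cvg_cst|apply: cvgZr_tmp; exact: cvg_id].
have := c0 _ hP; rewrite /fmap /= /within /=.
apply: (@filterS _ (nbhs s)) => t H; rewrite in_itv /= => /andP[t0 _].
by apply: H; apply: half_shift.
Qed.

Lemma pder_MVT F x i h : half x -> 0 < h ->
  (forall s : R, 0 <= s <= h -> hcont F (x + s *: e_ i) /\ pderivable i F (x + s *: e_ i)) ->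
  exists2 s : R, 0 <= s <= h & F (x + h *: e_ i) - F x = h * pder i F (x + s *: e_ i).
Proof.
move=> hx h0 H.
have [||s] := @MVT R (fun s => F (x + s *: e_ i)) (fun s => pder i F (x + s *: e_ i)) 0 h h0.
- move=> s; rewrite in_itv /= => /andP[s0 sh]; apply: is_pder_derive => //.
  by have [] := H s _ ; rewrite ?(ltW s0) ?(ltW sh).
- apply/subspace_continuousP => s /=; rewrite in_itv /= => sh.
  by apply: hcont_line => //; have [] := H s sh.
rewrite in_itv /= => /andP[s0 sh]; rewrite scale0r addr0 subr0 mulrC => e.
by exists s => //; rewrite (ltW s0) (ltW sh).
Qed.

Lemma pder_MVT_signed F x i h : half x -> half (x + h *: e_ i) ->
  (forall s : R, 0 <= s <= 1 -> hcont F (x + (s * h) *: e_ i) /\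
     pderivable i F (x + (s * h) *: e_ i)) ->
  exists2 s : R, 0 <= s <= 1 &
    F (x + h *: e_ i) - F x = h * pder i F (x + (s * h) *: e_ i).
Proof.
move=> hx hx' H; case: (ltrgtP h 0) => [h0|h0|->]; last first.
- by exists 0; rewrite ?lexx ?ler01// scale0r addr0 subrr mul0r.
- have [|s sh e] := @pder_MVT F x i h hx h0.
    move=> s sh; have := H (s / h); rewrite divfK ?gt_eqF//; apply.
    by rewrite divr_ge0 ?(ltW h0)//= ?ler_pdivrMr// ?mul1r; case/andP: sh.
  exists (s / h); rewrite ?divfK ?gt_eqF//.
  by rewrite divr_ge0 ?(ltW h0)//= ?ler_pdivrMr// ?mul1r; case/andP: sh.
(* For negative [h] the forward version is applied from the far endpoint; [E] and [B] rewrite its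
   points as points of the original segment. *)
have hn0 : h != 0 by rewrite lt_eqF.
have h0' : 0 < - h by rewrite oppr_gt0.
have E t : x + h *: e_ i + t *: e_ i = x + (((h + t) / h) * h) *: e_ i.
  by rewrite divfK// scalerDl addrA.
have B t : 0 <= t <= - h -> 0 <= (h + t) / h <= 1.
  move=> th; rewrite mulrDl divff//; have -> : t / h = - (t / - h) by rewrite invrN mulrN opprK.
  have : 0 <= t / - h <= 1.
    by rewrite divr_ge0 ?(ltW h0')//= ?ler_pdivrMr// ?mul1r; case/andP: th.
  lra.
have [|s sh] := @pder_MVT F (x + h *: e_ i) i (- h) hx' h0'.
  by move=> t /B tB; rewrite E; exact: H.
rewrite E [in X in X = _]E subrr mul0r mul0r scale0r addr0 => e.
exists ((h + s) / h); first exact: B.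
by rewrite -[LHS]opprB e; rewrite mulNr opprK.
Qed.

(** The coordinate box spanned by [x] and [y]. The mean value theorem is applied one coordinate at a
    time, along a path that leaves the straight segment but not this box, which lies in the
    half-space with its corners. *)
Definition between x y z :=
  forall k, exists2 s : R, 0 <= s <= 1 & z 0 k = x 0 k + s * (y 0 k - x 0 k).

Lemma between_half x y z : half x -> half y -> between x y z -> half z.
Proof.
rewrite /half_space /= => hx hy /(_ ord0)[s /andP[s0 s1] ->].
have -> : x 0 ord0 + s * (y 0 ord0 - x 0 ord0) = (1 - s) * x 0 ord0 + s * y 0 ord0 by ring.
by rewrite addr_ge0// mulr_ge0// subr_ge0.
Qed.

Lemma between_dist x y z k : between x y z -> `|z 0 k - x 0 k| <= `|y 0 k - x 0 k|.
Proof.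
move=> /(_ k)[s /andP[s0 s1] ->].
by rewrite addrC addKr normrM ger0_norm// ler_piMl.
Qed.

Lemma path_MVT F x y : half x -> half y ->
  (forall z, between x y z -> hcont F z /\ forall i, pderivable i F z) ->
  exists2 z : 'I_m.+1 -> 'rV[R]_m.+1, (forall j, between x y (z j)) &
    F y - F x = \sum_j (y 0 j - x 0 j) * pder j F (z j).
Proof.
move=> hx hy H.
(* Staircase from [x] to [y]: the first [n] coordinates have already been changed. *)
pose p (n : nat) : 'rV[R]_m.+1 := \row_j (if (j < n)%N then y 0 j else x 0 j).
have pS (j : 'I_m.+1) s : p j + (s * (y 0 j - x 0 j)) *: e_ j =
    \row_k (if (k < j)%N then y 0 k else if k == j then x 0 k + s * (y 0 k - x 0 k) else x 0 k).
  apply/rowP => k; rewrite shiftE !mxE.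
  by case: eqVneq => [->|kj]; rewrite ?ltnn ?mulr1n ?mulr0n ?addr0.
have pb (j : 'I_m.+1) s : 0 <= s <= 1 -> between x y (p j + (s * (y 0 j - x 0 j)) *: e_ j).
  move=> s01 k; rewrite pS mxE; case: ifP => _.
    by exists 1; rewrite ?lexx ?ler01// mul1r addrC subrK.
  case: eqVneq => [->|_]; first by exists s.
  by exists 0; rewrite ?lexx ?ler01// mul0r addr0.
have pj (j : 'I_m.+1) : exists z, between x y z /\
    F (p j.+1) - F (p j) = (y 0 j - x 0 j) * pder j F z.
  have E1 : p j.+1 = p j + (y 0 j - x 0 j) *: e_ j.
    rewrite -[_ - _]mul1r pS; apply/rowP => k; rewrite !mxE ltnS leq_eqVlt.
    by rewrite val_eqE; case: eqVneq => [->|//]; rewrite ltnn /= mul1r addrC subrK.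
  have b0 : between x y (p j).
    by have := pb j 0; rewrite mul0r scale0r addr0 lexx ler01; exact.
  have b1 : between x y (p j + (y 0 j - x 0 j) *: e_ j).
    by have := pb j 1; rewrite mul1r lexx ler01; exact.
  have [|s s01 e] := @pder_MVT_signed F (p j) j (y 0 j - x 0 j)
      (between_half hx hy b0) (between_half hx hy b1).
    by move=> s s01; have [? ?] := H _ (pb j s s01).
  by exists (p j + (s * (y 0 j - x 0 j)) *: e_ j); rewrite E1; split => //; exact: pb.
have [z zP] := choice pj.
exists z; first by move=> j; have [] := zP j.
have -> : F y = F (p m.+1) by congr F; apply/rowP => k; rewrite mxE ltn_ord.
have -> : F x = F (p 0) by congr F; apply/rowP => k; rewrite mxE.
rewrite -(@telescope_sumr _ 0 m.+1 (fun n => F (p n)))// big_mkord.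
by apply: eq_bigr => j _; have [] := zP j.
Qed.

(** The slopes [q j] are partial derivatives of [F] at points of the staircase from [x] to [y],
    which shrinks to [x]. In this factored form differentiability makes the chain rule a limit of
    products, at boundary points as well. *)
Lemma caratheodory F x : half x ->
  (\forall y \near hnbhs x, hcont F y /\ forall i, pderivable i F y) ->
  (forall i, hcont (pder i F) x) ->
  exists2 q : 'I_m.+1 -> 'rV[R]_m.+1 -> R,
    forall j, q j y @[y --> hnbhs x] --> pder j F x &
    \forall y \near hnbhs x, F y - F x = \sum_j (y 0 j - x 0 j) * q j y.
Proof.
move=> hx /hnbhsP[e e0 He] cF.
have zex y : exists z : 'I_m.+1 -> 'rV[R]_m.+1, half y -> (forall k, `|y 0 k - x 0 k| < e) ->
    (forall j, between x y (z j)) /\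
    F y - F x = \sum_j (y 0 j - x 0 j) * pder j F (z j).
  case: (pselect (half y /\ forall k, `|y 0 k - x 0 k| < e)) => [[hy ye]|n].
    have [|z zb ez] := @path_MVT F x y hx hy.
      move=> z zb; apply: He; first exact: (between_half hx hy).
      by move=> k; apply: le_lt_trans (ye k); exact: between_dist.
    by exists z.
  by exists (fun=> x) => hy ye; exfalso; apply: n.
have [z zP] := choice zex.
exists (fun j y => pder j F (z y j)); last first.
  by apply/hnbhsP; exists e => // y hy ye; have [] := zP y hy ye.
move=> j; apply: (cvg_comp _ _ _ (cF j)) => P /hnbhsP[d d0 Hd].
apply/hnbhsP; exists (Order.min d e); first by rewrite lt_min d0 e0.
move=> y hy yde /=.
have [zb _] : (forall j, between x y (z y j)) /\ F y - F x = \sum_j (y 0 j - x 0 j) * pder j F (z y j).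
  by apply: zP => // k; have := yde k; rewrite lt_min => /andP[].
apply: Hd; first exact: (between_half hx hy (zb j)).
move=> k; apply: (le_lt_trans (between_dist k (zb j))).
by have := yde k; rewrite lt_min => /andP[].
Qed.

Lemma is_pder_shift i j F y h l : 0 <= h -> is_pder i F (y + h *: e_ j) l ->
  is_pder i (fun z => F (z + h *: e_ j)) y l.
Proof.
move=> h0 dF P /dF; rewrite /fmap /steps /within /=.
apply: (@filterS _ (0:R)^') => t; rewrite /diff_quot /= => H ht.
rewrite addrAC; apply: H; rewrite addrAC; exact: half_shift.
Qed.

Lemma hcont_shift j F y h : 0 <= h -> hcont F (y + h *: e_ j) ->
  hcont (fun z => F (z + h *: e_ j)) y.
Proof.
move=> h0 cF; apply: (cvg_comp _ _ _ cF) => P /hnbhsP[d d0 Hd].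
apply/hnbhsP; exists d => // z hz zd; apply: Hd; first exact: half_shift.
by move=> k; rewrite !shiftE opprD addrACA subrr addr0.
Qed.

(** The mean value theorem along axis [i], applied to the increment of [F] along axis [j], and then
    along axis [j]. *)
Lemma double_MVT i j F x h : half x -> 0 < h ->
  (forall s t : R, 0 <= s <= h -> 0 <= t <= h -> let z := x + s *: e_ i + t *: e_ j in
    [/\ hcont F z, pderivable i F z, hcont (pder i F) z & pderivable j (pder i F) z]) ->
  exists s t : R, [/\ 0 <= s <= h, 0 <= t <= h &
    F (x + h *: e_ i + h *: e_ j) - F (x + h *: e_ i) - (F (x + h *: e_ j) - F x) =
    h * (h * pder j (pder i F) (x + s *: e_ i + t *: e_ j))].
Proof.
move=> hx h0 H.
have hh : 0 <= h <= h by rewrite lexx ltW.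
have h00 : 0 <= (0:R) <= h by rewrite lexx ltW.
have dphi s : 0 <= s <= h -> is_pder i (fun y => F (y + h *: e_ j) - F y) (x + s *: e_ i)
    (pder i F (x + s *: e_ i + h *: e_ j) - pder i F (x + s *: e_ i)).
  move=> sh; apply: is_pderB.
    have [_ d _ _] := H s h sh hh.
    exact: (is_pder_shift (ltW h0) (pderP d)).
  have [_ d _ _] := H s 0 sh h00; rewrite scale0r addr0 in d.
  exact: pderP d.
have [|s sh] := @pder_MVT (fun y => F (y + h *: e_ j) - F y) x i h hx h0.
  move=> s sh; split; last exact: is_pder_cvg (dphi s sh).
  refine (hcontB _ _).
    have [c _ _ _] := H s h sh hh.
    exact: (hcont_shift (ltW h0) c).
  have [c _ _ _] := H s 0 sh h00; rewrite scale0r addr0 in c.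
  exact: c.
have hxs : half (x + s *: e_ i) by apply: half_shift => //; case/andP: sh.
rewrite (is_pder_val hxs (dphi s sh)) => ->.
have [|t th ->] := @pder_MVT (pder i F) (x + s *: e_ i) j h hxs h0.
  by move=> t th; have [] := H s t sh th.
by exists s, t.
Qed.

(** The second difference over a small square with corner [x] is h^2 times either mixed derivative
    at some point of the square; continuity of both derivatives concludes. The square extends in the
    positive directions, hence stays in the half-space. *)
Lemma pderC i j F x : half x -> (\forall y \near hnbhs x, C1at F y /\ forall k, C1at (pder k F) y) ->
  pder j (pder i F) x = pder i (pder j F) x.
Proof.
move=> hx /hnbhsP[e e0 He].
have [cij cji] : hcont (pder j (pder i F)) x /\ hcont (pder i (pder j F)) x.
  have [|_ H] := He x hx; first by move=> k; rewrite subrr normr0.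
  by split; [have [_ /(_ j)[]] := H i|have [_ /(_ i)[]] := H j].
apply/eqP; rewrite -subr_eq0 -normr_le0; apply/ler_addgt0Pr => d d0; rewrite add0r.
have d20 : 0 < d / 2 by rewrite divr_gt0.
have /cvgrPdist_lt/(_ _ d20)/hnbhsP[e1 e10 H1] := cij.
have /cvgrPdist_lt/(_ _ d20)/hnbhsP[e2 e20 H2] := cji.
(* Points of the square are at sup-distance at most 2h from [x]; dividing by 3 keeps this strictly
   below the three radii. *)
pose h := Order.min e (Order.min e1 e2) / 3.
have m0 : 0 < Order.min e (Order.min e1 e2) by rewrite !lt_min e0 e10 e20.
have h0 : 0 < h by rewrite divr_gt0.
have [he he1 he2] : [/\ 2 * h < e, 2 * h < e1 & 2 * h < e2].
  have : 2 * h < Order.min e (Order.min e1 e2).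
    by move: m0; rewrite /h; move: (Order.min e _) => M M0; clear -M0; lra.
  by rewrite !lt_min => /and3P[].
have pt a b s t : 0 <= s <= h -> 0 <= t <= h ->
    half (x + s *: e_ a + t *: e_ b) /\
    (forall k, `|(x + s *: e_ a + t *: e_ b) 0 k - x 0 k| <= 2 * h).
  move=> /andP[s0 sh] /andP[t0 th]; split; first by do 2!apply: half_shift => //.
  move=> k; rewrite !shiftE addrAC [x 0 k + _]addrC addrK.
  rewrite ger0_norm ?addr_ge0 ?mulrn_wge0//.
  by clear -s0 sh t0 th h0; case: (k == a); case: (k == b); rewrite ?mulr1n ?mulr0n; lra.
have C a b s t : 0 <= s <= h -> 0 <= t <= h -> let z := x + s *: e_ a + t *: e_ b in
    [/\ hcont F z, pderivable a F z, hcont (pder a F) z & pderivable b (pder a F) z].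
  move=> sh th; have [hz zd] := pt a b s t sh th.
  have [|[cF dF] dd] := He _ hz; first by move=> k; apply: le_lt_trans (zd k) he.
  have [cd /(_ b)[pd _]] := dd a; have [pa _] := dF a.
  exact: And4 cF pa cd pd.
have [s [t [sh th e_1]]] := double_MVT hx h0 (C i j).
have [s' [t' [sh' th' e_2]]] := double_MVT hx h0 (C j i).
have E : pder j (pder i F) (x + s *: e_ i + t *: e_ j) =
    pder i (pder j F) (x + s' *: e_ j + t' *: e_ i).
  have hn : h != 0 by rewrite gt_eqF.
  rewrite [x + h *: e_ j + h *: e_ i]addrAC in e_2.
  have D : forall a1 a2 a3 a4 : R, a1 - a2 - (a3 - a4) = a1 - a3 - (a2 - a4) by move=> *; ring.
  exact: (mulfI hn (mulfI hn (etrans (esym e_1) (etrans (D _ _ _ _) e_2)))).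
have [hz zd] := pt i j s t sh th; have [hz' zd'] := pt j i s' t' sh' th'.
have b1 := H1 _ hz (fun k => le_lt_trans (zd k) he1).
have b2 := H2 _ hz' (fun k => le_lt_trans (zd' k) he2).
rewrite /= in b1 b2; rewrite -E in b2.
move: b1 b2; clear.
move: (pder j (pder i F) x) (pder i (pder j F) x) (pder j (pder i F) (x + s *: e_ i + t *: e_ j)) => A B C b1 b2.
have -> : A - B = (A - C) - (B - C) by ring.
by apply: (le_trans (ler_normB _ _)); rewrite ltW// [d]splitr ltrD.
Qed.

End MeanValue.

(** * Chain rule and closure properties of smooth functions *)

Section Smooth.
Context {R : realType} {m : nat}.
Implicit Types (x y z : 'rV[R]_m.+1) (F G : 'rV[R]_m.+1 -> R)
  (V : set 'rV[R]_m.+1) (i j k : 'I_m.+1).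
Local Notation e_ i := (delta_mx 0 i : 'rV[R]_m.+1).
Local Notation half := (@half_space R m).

Lemma cvg_hnbhs (T : Type) (K : set_system T) {FK : Filter K} (Phi : T -> 'rV[R]_m.+1) y :
  (forall j, Phi t 0 j @[t --> K] --> y 0 j) -> (\forall t \near K, half (Phi t)) ->
  Phi t @[t --> K] --> hnbhs y.
Proof.
move=> cPhi hPhi P /hnbhsP[e e0 He].
have : \forall t \near K, forall j, `|y 0 j - Phi t 0 j| < e.
  by apply: filter_forall => j; have /cvgrPdist_lt/(_ _ e0) := cPhi j.
move=> H; apply: filterS2 hPhi H => t ht tH; apply: He => // k.
by rewrite distrC; exact: tH.
Qed.

Lemma near_half x : \forall y \near hnbhs x, half y.
Proof. exact: withinT. Qed.

Lemma cvg_sumR (T I : Type) (K : set_system T) {FK : Filter K} (r : seq I) (f : I -> T -> R)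
    (l : I -> R) : (forall a, f a t @[t --> K] --> l a) ->
  \sum_(a <- r) f a t @[t --> K] --> \sum_(a <- r) l a.
Proof.
move=> fl; elim: r => [|a r IH].
  by under eq_fun do rewrite big_nil; rewrite big_nil; exact: cvg_cst.
by under eq_fun do rewrite big_cons; rewrite big_cons; exact: cvgD.
Qed.

Lemma is_pder_chain i F (Phi : 'rV[R]_m.+1 -> 'rV[R]_m.+1) x (J : 'I_m.+1 -> R) :
  half (Phi x) -> (\forall y \near hnbhs x, half (Phi y)) ->
  (forall j, is_pder i (fun y => Phi y 0 j) x (J j)) ->
  (\forall y \near hnbhs (Phi x), hcont F y /\ forall i, pderivable i F y) ->
  (forall i, hcont (pder i F) (Phi x)) ->
  is_pder i (F \o Phi) x (\sum_j J j * pder j F (Phi x)).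
Proof.
move=> hx hPhi dPhi nF cF.
have [q cq qF] := caratheodory hx nF cF.
have sPhi : Phi (x + h *: e_ i) @[h --> steps i x] --> hnbhs (Phi x).
  apply: (@cvg_hnbhs _ _ (steps_filter i x)).
    by move=> j; exact: is_pder_cont (dPhi j).
  exact: (near_steps i hPhi).
have cs : \sum_j diff_quot i (fun y => Phi y 0 j) x h * q j (Phi (x + h *: e_ i))
    @[h --> steps i x] --> \sum_j J j * pder j F (Phi x).
  apply: (@cvg_sumR _ _ _ (steps_filter i x)) => j; apply: cvgM; first exact: dPhi.
  exact: (cvg_comp _ _ sPhi (cq j)).
apply: (cvg_eq_near cs).
have : \forall h \near steps i x, F (Phi (x + h *: e_ i)) - F (Phi x) =
    \sum_j (Phi (x + h *: e_ i) 0 j - Phi x 0 j) * q j (Phi (x + h *: e_ i)).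
  exact: (sPhi _ qF).
apply: filterS => h e; rewrite /diff_quot /= e mulr_sumr.
by apply: eq_bigr => j _; rewrite mulrA.
Qed.

Lemma C1at_congr F G x : half x -> {near hnbhs x, F =1 G} -> C1at F x -> C1at G x.
Proof.
move=> hx FG [cF dF]; split; first exact: (hcont_congr hx FG cF).
move=> i; have [pF cp] := dF i; have [_ [pd _]] := pder_congr i hx FG.
split; first exact: pd.
apply: (hcont_congr hx _ cp).
apply: filterS2 (near_half x) (near_hnbhs_near FG) => y hy H; have [e _] := pder_congr i hy H.
exact: e.
Qed.

Lemma C1at_build F x (d : 'I_m.+1 -> 'rV[R]_m.+1 -> R) : half x ->
  (\forall y \near hnbhs x, half y -> forall i, is_pder i F y (d i y)) -> hcont F x ->
  (forall i, hcont (d i) x) -> C1at F x.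
Proof.
move=> hx nd cF cd; split => // i; split.
  exact: is_pder_cvg (near_hnbhs_self hx nd hx i).
apply: (hcont_congr hx _ (cd i)); apply: filterS2 (near_half x) nd => y hy H.
by rewrite (is_pder_val hy (H hy i)).
Qed.

Lemma C1at_is_pder F x i : C1at F x -> is_pder i F x (pder i F x).
Proof. by case=> _ /(_ i)[d _]; exact: pderP d. Qed.

Lemma C1atM F G x : half x -> (\forall y \near hnbhs x, C1at F y) ->
  (\forall y \near hnbhs x, C1at G y) -> C1at (fun y => F y * G y) x.
Proof.
move=> hx nF nG.
have [cF dF] := near_hnbhs_self hx nF; have [cG dG] := near_hnbhs_self hx nG.
apply: (@C1at_build _ _ (fun i y => pder i F y * G y + F y * pder i G y)) => //.
- apply: filterS2 nF nG => y aF aG _ i.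
  apply: is_pderM; exact: C1at_is_pder.
- exact: hcontM.
- move=> i; have [_ c1] := dF i; have [_ c2] := dG i.
  exact: (hcontD (hcontM c1 cG) (hcontM cF c2)).
Qed.

Lemma C1atD F G x : half x -> (\forall y \near hnbhs x, C1at F y) ->
  (\forall y \near hnbhs x, C1at G y) -> C1at (fun y => F y + G y) x.
Proof.
move=> hx nF nG.
have [cF dF] := near_hnbhs_self hx nF; have [cG dG] := near_hnbhs_self hx nG.
apply: (@C1at_build _ _ (fun i y => pder i F y + pder i G y)) => //.
- apply: filterS2 nF nG => y aF aG _ i.
  apply: is_pderD; exact: C1at_is_pder.
- exact: hcontD.
- by move=> i; have [_ c1] := dF i; have [_ c2] := dG i; exact: (hcontD c1 c2).
Qed.

Lemma C1at_cst (a : R) x : half x -> C1at (fun=> a) x.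
Proof.
move=> hx; apply: (@C1at_build _ _ (fun _ _ => 0)) => //.
- by apply: nearW => y _ i; exact: is_pder_cst.
- exact: hcont_cst.
- by move=> i; exact: hcont_cst.
Qed.

Lemma C1at_sum (I : Type) (r : seq I) (F : I -> 'rV[R]_m.+1 -> R) x : half x ->
  (forall a, \forall y \near hnbhs x, C1at (F a) y) -> C1at (fun y => \sum_(a <- r) F a y) x.
Proof.
move=> hx nF.
suff: \forall y \near hnbhs x, half y -> C1at (fun y => \sum_(a <- r) F a y) y.
  by move=> H; exact: (near_hnbhs_self hx H hx).
elim: r => [|a r IH].
  apply: nearW => y hy; under eq_fun do rewrite big_nil; exact: C1at_cst.
apply: filterS2 (near_hnbhs_near (nF a)) (near_hnbhs_near IH) => y n1 n2 hy.
under eq_fun do rewrite big_cons; apply: C1atD => //.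
by apply: filterS2 (near_half y) n2 => z hz H; exact: H.
Qed.

Lemma C1at_comp F (phi dphi : R -> R) x : half x -> (\forall y \near hnbhs x, C1at F y) ->
  (forall a : R, is_derive a 1 phi (dphi a)) -> continuous dphi -> C1at (phi \o F) x.
Proof.
move=> hx nF dp cd.
have [cF dF] := near_hnbhs_self hx nF.
have cphi : continuous phi.
  by move=> a; apply: differentiable_continuous; apply/derivable1_diffP; have [] := dp a.
apply: (@C1at_build _ _ (fun i y => dphi (F y) * pder i F y)) => //.
- by apply: filterS nF => y aF _ i; exact: (is_pder_comp (C1at_is_pder aF) (dp _)).
- exact: (hcont_comp cF (cphi _)).
- by move=> i; have [_ c1] := dF i; exact: (hcontM (hcont_comp cF (cd _)) c1).
Qed.

Lemma is_derive_inv (a : R) : a != 0 -> is_derive a 1 (fun b : R => b^-1) (- a ^- 2).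
Proof.
move=> a0; have d : is_derive a (1:R) (@id R) 1 by exact: is_derive_id.
have := @is_deriveV R id a 1 1 a0 d.
by rewrite /= [_ *: _]mulr1.
Qed.

Lemma C1at_inv F x : half x -> (\forall y \near hnbhs x, C1at F y) -> F x != 0 ->
  C1at (fun y => (F y)^-1) x.
Proof.
move=> hx nF F0; have [cF dF] := near_hnbhs_self hx nF.
have nF0 : \forall y \near hnbhs x, F y != 0.
  exact: (@cvgr_neq0 _ _ _ (hnbhs x) (hnbhs_filter x) F (F x) cF F0).
apply: (@C1at_build _ _ (fun i y => - (F y) ^- 2 * pder i F y)) => //.
- apply: filterS2 nF nF0 => y aF y0 _ i.
  exact: (is_pder_comp (C1at_is_pder aF) (is_derive_inv y0)).
- exact: cvgV.
- move=> i; have [_ c1] := dF i; apply: hcontM => //; apply: hcontN.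
  apply: cvgV; first by rewrite expf_neq0.
  under eq_fun do rewrite expr2; rewrite expr2; exact: hcontM.
Qed.

Lemma C1at_chain F (Phi : 'rV[R]_m.+1 -> 'rV[R]_m.+1) x :
  half x -> (forall y, half (Phi y)) ->
  (\forall y \near hnbhs x, forall j, C1at (fun z => Phi z 0 j) y) ->
  (\forall y \near hnbhs (Phi x), C1at F y) -> C1at (F \o Phi) x.
Proof.
move=> hx hPhi nPhi nF.
have cPhi y : half y -> (forall j, C1at (fun z => Phi z 0 j) y) ->
    Phi z @[z --> hnbhs y] --> hnbhs (Phi y).
  move=> hy C; apply: (@cvg_hnbhs _ _ (hnbhs_filter y)).
    by move=> j; have [c _] := C j; exact: c.
  exact: nearW.
have n1 : \forall y \near hnbhs x, \forall z \near hnbhs (Phi y), C1at F z.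
  exact: (cPhi x hx (near_hnbhs_self hx nPhi) _ (near_hnbhs_near nF)).
have [cF dF] := near_hnbhs_self (hPhi x) nF.
have C1 := near_hnbhs_self hx nPhi.
apply: (@C1at_build _ _ (fun i y => \sum_j pder i (fun z => Phi z 0 j) y * pder j F (Phi y))) => //.
- apply: filterS2 nPhi n1 => y PC nFy hy i.
  have [cFy dFy] := near_hnbhs_self (hPhi y) nFy.
  apply: is_pder_chain => //.
  + exact: nearW.
  + by move=> j; exact: C1at_is_pder (PC j).
  + by apply: filterS nFy => z [cz dz]; split => // k; have [] := dz k.
  + by move=> k; have [_ c] := dFy k.
- exact: (cvg_comp _ _ (cPhi x hx C1) cF).
- move=> i; apply: hcont_sum => j; apply: hcontM.
    by have [_ /(_ i)[_ c]] := C1 j.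
  by have [_ c] := dF j; exact: (cvg_comp _ _ (cPhi x hx C1) c).
Qed.

Lemma near_rel_open V x : rel_open V -> V x -> \forall y \near hnbhs x, V y.
Proof.
case=> W oW -> [Wx _]; rewrite /hnbhs near_withinE.
by apply: filterS (open_nbhs_nbhs (conj oW Wx)) => y Wy hy; split.
Qed.

Lemma rel_open_half V x : rel_open V -> V x -> half x.
Proof. by case=> W oW -> []. Qed.

Lemma within_hcont V F : rel_open V ->
  {within V, continuous F} <-> forall x, V x -> hcont F x.
Proof.
move=> oV; split.
  move=> /subspace_continuousP c x Vx; apply: cvg_trans (c x Vx).
  apply: cvg_app => P; rewrite /nbhs /= /hnbhs /within /= => H.
  have := near_rel_open oV Vx; rewrite /hnbhs near_withinE => H'.
  by apply: filterS2 H H' => y h1 h2 hy; exact: h1 (h2 hy).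
move=> H; apply/subspace_continuousP => x Vx; apply: cvg_trans (H x Vx).
apply: cvg_app; apply: within_subset => y; exact: (rel_open_half oV).
Qed.

Lemma smooth_onP V F : rel_open V -> smooth_on V F <->
  forall s x, V x -> hcont (foldr pder F s) x /\ forall i, pderivable i (foldr pder F s) x.
Proof.
move=> oV; split.
  move=> H s x Vx; have [c d] := H s; split; last by move=> i; exact: d.
  by have /(within_hcont _ oV) := c; apply.
move=> H s; split; last by move=> i x Vx; have [_] := H s x Vx; apply.
by apply/(within_hcont _ oV) => x Vx; have [] := H s x Vx.
Qed.

Lemma smooth_pder V F i : smooth_on V F -> smooth_on V (pder i F).
Proof. by move=> H s; have := H (rcons s i); rewrite foldr_rcons. Qed.

Lemma smooth_C1at V F x : rel_open V -> smooth_on V F -> V x -> C1at F x.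
Proof.
move=> oV sF Vx; have /(smooth_onP _ oV) H := sF.
have [c d] := H [::] x Vx; split => // i; split; first exact: d.
by have [] := H [:: i] x Vx.
Qed.

Lemma smooth_pderC V F i j x : rel_open V -> smooth_on V F -> V x ->
  pder j (pder i F) x = pder i (pder j F) x.
Proof.
move=> oV sF Vx; apply: pderC; first exact: (rel_open_half oV Vx).
apply: filterS (near_rel_open oV Vx) => y Vy; split; first exact: (smooth_C1at oV sF Vy).
by move=> k; apply: smooth_C1at oV _ Vy; exact: smooth_pder.
Qed.

Lemma eq_on_near V F G x : rel_open V -> {in V, F =1 G} -> V x -> {near hnbhs x, F =1 G}.
Proof.
by move=> oV FG Vx; apply: filterS (near_rel_open oV Vx) => y Vy; apply: FG; rewrite inE.
Qed.

(** [smooth_on] speaks of all iterated partial derivatives, so closure properties are proved for a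
    class stable under differentiation. Stability is required only up to equality on [V], because
    derivatives outside [V] are arbitrary. *)
Lemma smooth_coinduct V (P : ('rV[R]_m.+1 -> R) -> Prop) : rel_open V ->
  (forall F, P F -> forall x, V x -> hcont F x /\ forall i, pderivable i F x) ->
  (forall F i, P F -> exists2 G, P G & {in V, pder i F =1 G}) ->
  forall F, P F -> smooth_on V F.
Proof.
move=> oV P1 P2 F PF; apply/(smooth_onP _ oV).
have H s : exists2 G, P G & {in V, foldr pder F s =1 G}.
  elim: s => [|i s [G PG FG]]; first by exists F.
  have [G' PG' GG'] := P2 G i PG; exists G' => // x; rewrite inE => Vx /=.
  have [-> _] := pder_congr i (rel_open_half oV Vx) (eq_on_near oV FG Vx).
  by apply: GG'; rewrite inE.
move=> s x Vx; have [G PG FG] := H s; have hx := rel_open_half oV Vx.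
have nGF : {near hnbhs x, G =1 foldr pder F s}.
  by apply: (eq_on_near oV _ Vx) => y /FG.
have [c d] := P1 G PG x Vx; split; first exact: (hcont_congr hx nGF c).
by move=> i; have [_ [H1 _]] := pder_congr i hx nGF; exact: H1.
Qed.

(** The derivative of F^(-1/2) is a constant times (F^(-1/2))^3 times that of F, so the class is
    stable under differentiation. The inverse square root generates both 1 / det G, as its square,
    and sqrt (det G), after multiplication by det G. *)
Inductive smooth_closure V : ('rV[R]_m.+1 -> R) -> Prop :=
| sc_smooth F : smooth_on V F -> smooth_closure V F
| sc_cst (a : R) : smooth_closure V (fun=> a)
| sc_add F G : smooth_closure V F -> smooth_closure V G -> smooth_closure V (fun y => F y + G y)
| sc_mul F G : smooth_closure V F -> smooth_closure V G -> smooth_closure V (fun y => F y * G y)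
| sc_isqrt F : smooth_on V F -> (forall x, V x -> 0 < F x) ->
    smooth_closure V (fun y => (Num.sqrt (F y))^-1).

Lemma smooth_closureP V : rel_open V -> forall F, smooth_closure V F -> smooth_on V F.
Proof.
move=> oV.
have key F : smooth_closure V F -> (forall x, V x -> hcont F x) /\
    forall i, exists2 G, smooth_closure V G & forall x, V x -> is_pder i F x (G x).
  elim => {F} [F sF|a|F G _ [cF dF] _ [cG dG]|F G sF [cF dF] sG [cG dG]|F sF F0].
  - split=> [x Vx|i]; first by have [] := smooth_C1at oV sF Vx.
    exists (pder i F); first by apply: sc_smooth; exact: smooth_pder.
    by move=> x Vx; exact: (C1at_is_pder (smooth_C1at oV sF Vx)).
  - split=> [x Vx|i]; first exact: hcont_cst.
    by exists (fun=> 0); [exact: sc_cst|move=> x Vx; exact: is_pder_cst].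
  - split=> [x Vx|i]; first by apply: hcontD; [exact: cF|exact: cG].
    have [F' cF' dF'] := dF i; have [G' cG' dG'] := dG i.
    exists (fun y => F' y + G' y); first exact: sc_add.
    by move=> x Vx; apply: is_pderD; [exact: dF'|exact: dG'].
  - split=> [x Vx|i]; first by apply: hcontM; [exact: cF|exact: cG].
    have [F' cF' dF'] := dF i; have [G' cG' dG'] := dG i.
    exists (fun y => F' y * G y + F y * G' y).
      by apply: sc_add; apply: sc_mul.
    by move=> x Vx; apply: is_pderM; [exact: dF'|exact: dG'].
  - have sq0 x : V x -> Num.sqrt (F x) != 0 by move=> Vx; rewrite gt_eqF// sqrtr_gt0 F0.
    split=> [x Vx|i].
      have [cF _] := smooth_C1at oV sF Vx.
      apply: (cvgV (sq0 x Vx)); exact: (hcont_comp cF (@sqrt_continuous R _)).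
    pose s y := (Num.sqrt (F y))^-1.
    exists (fun y => (-1 / 2) * (s y * s y * s y * pder i F y)).
      apply: sc_mul; first exact: sc_cst.
      apply: sc_mul; last by apply: sc_smooth; exact: smooth_pder.
      by do 2?apply: sc_mul; exact: sc_isqrt.
    move=> x Vx; have dF : is_pder i F x _ := C1at_is_pder (smooth_C1at oV sF Vx).
    have ds := is_pder_comp dF (is_derive1_sqrt (F0 x Vx)).
    have -> : -1 / 2 * (s x * s x * s x * pder i F x) =
        - (Num.sqrt (F x)) ^- 2 * ((2 * Num.sqrt (F x))^-1 * pder i F x).
      by rewrite /s; field; exact: sq0.
    exact: (is_pder_comp ds (is_derive_inv (sq0 x Vx))).
move=> F; apply: (smooth_coinduct oV) => {F} F.
  move=> sF x Vx; have [c d] := key F sF; split; first exact: c.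
  by move=> i; have [G _ dG] := d i; exact: is_pder_cvg (dG x Vx).
move=> i sF; have [_ /(_ i)[G sG dG]] := key F sF; exists G => // x; rewrite inE => Vx.
exact: is_pder_val (rel_open_half oV Vx) (dG x Vx).
Qed.

Lemma smooth_congr V F G : rel_open V -> {in V, F =1 G} -> smooth_on V F -> smooth_on V G.
Proof.
move=> oV FG sF.
apply: (@smooth_coinduct V (fun G => exists2 F, smooth_on V F & {in V, F =1 G})) => //.
- move=> {}G [{FG sF}F sF FG] x Vx; have hx := rel_open_half oV Vx.
  have n := eq_on_near oV FG Vx; have [c d] := smooth_C1at oV sF Vx.
  split; first exact: (hcont_congr hx n c).
  by move=> i; have [_ [+ _]] := pder_congr i hx n; apply; have [] := d i.
- move=> {}G i [{FG sF}F sF FG]; exists (pder i F).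
    by exists (pder i F) => //; exact: smooth_pder.
  move=> x; rewrite inE => Vx; have [-> //] := pder_congr i (rel_open_half oV Vx) (eq_on_near oV FG Vx).
- by exists F.
Qed.

End Smooth.

(** * Tensor calculus over a commutative ring with commuting derivations *)

Section MatrixEntries.
Variables (S : comNzRingType) (p q : nat).
Implicit Types A B : 'M[S]_(p, q).

Lemma addmxE A B i j : (A + B) i j = A i j + B i j. Proof. by rewrite mxE. Qed.
Lemma zeromxE i j : (0 : 'M[S]_(p, q)) i j = 0. Proof. by rewrite mxE. Qed.
Lemma oppmxE A i j : (- A) i j = - A i j. Proof. by rewrite mxE. Qed.
Lemma scalemxE c A i j : (c *: A) i j = c * A i j. Proof. by rewrite mxE. Qed.
Lemma trmxE A i j : A^T i j = A j i. Proof. by rewrite mxE. Qed.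
Lemma entry4 A B C E i j : (A - B - (C - E)) i j = A i j - B i j - (C i j - E i j).
Proof. by rewrite !(addmxE, oppmxE). Qed.
Lemma entry5 A B C E F i j : (A + B - C - E - F) i j = A i j + B i j - C i j - E i j - F i j.
Proof. by rewrite !(addmxE, oppmxE). Qed.
Lemma mulmx_entry r (A : 'M[S]_(p, r)) (B : 'M[S]_(r, q)) i j :
  (A *m B) i j = \sum_k A i k * B k j.
Proof. by rewrite mxE. Qed.
End MatrixEntries.

Ltac mxring := let p := fresh "p" in let q := fresh "q" in
  apply/matrixP => p q; rewrite ?(addmxE, oppmxE, scalemxE, trmxE, zeromxE); ring.

Section DifferentialRing.
Variables (S : comNzRingType) (m : nat) (D : 'I_m.+1 -> S -> S).
Hypothesis DD : forall i a b, D i (a + b) = D i a + D i b.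
Hypothesis DM : forall i a b, D i (a * b) = D i a * b + a * D i b.
Hypothesis DC : forall i j a, D i (D j a) = D j (D i a).

Lemma der0 i : D i 0 = 0.
Proof. by apply: (addrI (D i 0)); rewrite -DD !addr0. Qed.

Lemma derN i a : D i (- a) = - D i a.
Proof. by apply: (addIr (D i a)); rewrite -DD !addNr der0. Qed.

Lemma derB i a b : D i (a - b) = D i a - D i b.
Proof. by rewrite DD derN. Qed.

Lemma der_sum i (I : Type) (r : seq I) (P : pred I) (F : I -> S) :
  D i (\sum_(k <- r | P k) F k) = \sum_(k <- r | P k) D i (F k).
Proof. exact: (big_morph (D i) (DD i) (der0 i)). Qed.

Lemma der1 i : D i 1 = 0.
Proof. by apply: (addrI (D i 1)); rewrite addr0 -{3}[1]mulr1 DM mul1r mulr1. Qed.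

Definition DX i p q (A : 'M[S]_(p, q)) : 'M[S]_(p, q) := map_mx (D i) A.

Lemma DXD i p q (A B : 'M[S]_(p, q)) : DX i (A + B) = DX i A + DX i B.
Proof. by apply/matrixP => a b; rewrite !mxE DD. Qed.

Lemma DXN i p q (A : 'M[S]_(p, q)) : DX i (- A) = - DX i A.
Proof. by apply/matrixP => a b; rewrite !mxE derN. Qed.

Lemma DXB i p q (A B : 'M[S]_(p, q)) : DX i (A - B) = DX i A - DX i B.
Proof. by rewrite DXD DXN. Qed.

Lemma DXM i p q r (A : 'M[S]_(p, q)) (B : 'M[S]_(q, r)) :
  DX i (A *m B) = DX i A *m B + A *m DX i B.
Proof.
apply/matrixP => a b; rewrite !mxE der_sum -big_split /=.
by apply: eq_bigr => k _; rewrite DM !mxE.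
Qed.

Lemma DXZ i p q (c : S) (A : 'M[S]_(p, q)) : DX i (c *: A) = D i c *: A + c *: DX i A.
Proof. by apply/matrixP => a b; rewrite !mxE DM. Qed.

Lemma DXT i p q (A : 'M[S]_(p, q)) : DX i A^T = (DX i A)^T.
Proof. by apply/matrixP => a b; rewrite !mxE. Qed.

Lemma DXC i j p q (A : 'M[S]_(p, q)) : DX i (DX j A) = DX j (DX i A).
Proof. by apply/matrixP => a b; rewrite !mxE DC. Qed.

Lemma DX1 i : DX i (1%:M : 'M[S]_m.+1) = 0.
Proof. by apply/matrixP => a b; rewrite !mxE; case: eqP => _; rewrite ?der1 ?der0. Qed.

(* G is the metric, H its inverse, and hf stands for 1/2. *)
Variables (G H : 'M[S]_m.+1) (hf : S).
Hypothesis hf2 : hf + hf = 1.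
Hypothesis Gsym : G^T = G.
Hypothesis GH : G *m H = 1%:M.

Lemma HG : H *m G = 1%:M.
Proof. exact: mulmx1C. Qed.

Lemma Hsym : H^T = H.
Proof.
have: (G *m H)^T = 1%:M by rewrite GH trmx1.
by rewrite trmx_mul Gsym => e; rewrite -[LHS]mulmx1 -GH mulmxA e mul1mx.
Qed.

Lemma Gsy i j : G i j = G j i.
Proof. by rewrite -{1}Gsym mxE. Qed.

Lemma Hsy i j : H i j = H j i.
Proof. by rewrite -{1}Hsym mxE. Qed.

Lemma halfK (a : S) : hf * (a + a) = a.
Proof. by rewrite -mulr2n -mulr_natl mulrCA mulrA mulr_natl mulr2n hf2 mul1r. Qed.

(* (Gam i) j k is the Christoffel symbol Gamma^k_{ij}. *)
Definition Gam i : 'M[S]_m.+1 := \matrix_(j, k)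
  (hf * \sum_l H k l * (D i (G j l) + D j (G i l) - D l (G i j))).

Lemma Gam_sym i j k : Gam i j k = Gam j i k.
Proof.
rewrite !mxE; congr (_ * _); apply: eq_bigr => l _.
by rewrite [D j _ + _]addrC (Gsy i j).
Qed.

Lemma Gam_lower i j l : (Gam i *m G) j l = hf * (D i (G j l) + D j (G i l) - D l (G i j)).
Proof.
rewrite mxE; under eq_bigr do rewrite mxE -mulrA mulr_suml.
rewrite -mulr_sumr exchange_big /=; congr (_ * _).
rewrite (bigD1 l) //= [X in _ + X]big1 ?addr0.
  under eq_bigr do rewrite mulrAC Hsy; rewrite -mulr_suml.
  have /matrixP/(_ l l) := HG; rewrite !mxE eqxx => ->; exact: mul1r.
move=> p pl; under eq_bigr do rewrite mulrAC Hsy; rewrite -mulr_suml.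
by have /matrixP/(_ p l) := HG; rewrite !mxE (negbTE pl) => ->; exact: mul0r.
Qed.

(** Metric compatibility: in the sum of [Gam_lower] and its transpose four of the six derivatives of
    [G] cancel and the other two coincide. *)
Lemma DXG i : DX i G = Gam i *m G + G *m (Gam i)^T.
Proof.
have -> : G *m (Gam i)^T = (Gam i *m G)^T by rewrite trmx_mul Gsym.
apply/matrixP => j l; rewrite mxE [RHS]mxE [X in _ + X]mxE !Gam_lower -mulrDr.
rewrite (Gsy l j) -[LHS]halfK; congr (_ * _); rewrite (Gsy i l) (Gsy i j); ring.
Qed.

Lemma DXH i : DX i H = - (H *m Gam i) - (Gam i)^T *m H.
Proof.
have : DX i (G *m H) = 0 by rewrite GH DX1.
rewrite DXM DXG => /(congr1 (mulmx H)).
rewrite mulmx0 mulmxDr [H *m (G *m _)]mulmxA HG mul1mx mulmxDl mulmxDr -!mulmxA GH mulmx1.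
rewrite [H *m (G *m _)]mulmxA HG mul1mx addrC => /eqP; rewrite addr_eq0 => /eqP ->.
by rewrite opprD.
Qed.

(* Covariant derivative of a covariant 2-tensor along d_a; cOm below is that of
   the curvature operator. *)
Definition cov a (T : 'M[S]_m.+1) := DX a T - Gam a *m T - T *m (Gam a)^T.

Lemma covG a : cov a G = 0.
Proof. by rewrite /cov DXG [X in X - _ - _]addrC addrK subrr. Qed.

Lemma covD a T U : cov a (T + U) = cov a T + cov a U.
Proof. by rewrite /cov DXD mulmxDr mulmxDl; mxring. Qed.

Lemma covZ a c T : cov a (c *: T) = D a c *: T + c *: cov a T.
Proof.
rewrite /cov DXZ -scalemxAr -scalemxAl.
mxring.
Qed.

Lemma covT a T : cov a T^T = (cov a T)^T.
Proof.
rewrite /cov !linearB /= !trmx_mul DXT trmxK; mxring.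
Qed.

Definition trH (T : 'M[S]_m.+1) := \sum_a (H *m T) a a.

Lemma trHE T : trH T = \tr (H *m T). Proof. by []. Qed.

Lemma D_trH a T : D a (trH T) = trH (cov a T).
Proof.
have -> : D a (trH T) = \tr (DX a (H *m T)).
  by rewrite /trH /mxtrace der_sum; apply: eq_bigr => i _; rewrite [RHS]mxE.
have tD (A B : 'M[S]_m.+1) : \tr (A + B) = \tr A + \tr B by exact: mxtraceD.
have tN (A : 'M[S]_m.+1) : \tr (- A) = - \tr A by exact: raddfN.
rewrite trHE DXM DXH /cov !(mulmxBr, mulmxBl) mulNmx !(tD, tN).
rewrite [H *m (T *m _)]mulmxA (mxtrace_mulC (H *m T)) [(Gam a)^T *m (H *m T)]mulmxA mulmxA.
ring.
Qed.

(* (Om i j) k l is the d_l-component of R(d_i, d_j) d_k. *)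
Definition Om i j := DX i (Gam j) - DX j (Gam i) + Gam j *m Gam i - Gam i *m Gam j.

Lemma Om_anti i j : Om j i = - Om i j.
Proof. rewrite /Om; mxring. Qed.

(** Expanding [DX i (DX j G)] by metric compatibility, the symmetry of second derivatives of the
    metric becomes exactly the skew-symmetry of the curvature operator. *)
Lemma Om_lower i j : Om i j *m G + G *m (Om i j)^T = 0.
Proof.
have := DXC i j G; rewrite !DXG !DXD !DXM !DXG !DXT => /eqP; rewrite -subr_eq0 => /eqP <-.
have tE (A B C E : 'M[S]_m.+1) : (A - B + C - E)^T = A^T - B^T + C^T - E^T.
  by apply/matrixP => a b; rewrite !mxE.
rewrite /Om tE !trmx_mul !(mulmxBl, mulmxDl, mulmxBr, mulmxDr) !mulmxA.
mxring.
Qed.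

Lemma HOm_anti i j : (H *m Om i j)^T = - (H *m Om i j).
Proof.
have := Om_lower i j => /(congr1 (fun M => H *m M *m H)).
rewrite mulmx0 mul0mx mulmxDr mulmxDl -!mulmxA GH mulmx1 [H *m (G *m _)]mulmxA HG mul1mx.
by rewrite trmx_mul Hsym addrC => /eqP; rewrite addr_eq0 => /eqP.
Qed.

Definition ricM : 'M[S]_m.+1 := \matrix_(j, k) \sum_i Om i j k i.

Definition cOm a i j := DX a (Om i j) + Om i j *m Gam a - Gam a *m Om i j
  - \sum_p Gam a i p *: Om p j - \sum_p Gam a j p *: Om i p.

Lemma DXOm a i j : DX a (Om i j) = DX a (DX i (Gam j)) - DX a (DX j (Gam i))
  + (DX a (Gam j) *m Gam i + Gam j *m DX a (Gam i))
  - (DX a (Gam i) *m Gam j + Gam i *m DX a (Gam j)).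
Proof. by rewrite /Om !(DXB, DXD, DXN) !DXM. Qed.

(** Symmetry of the Christoffel symbols cancels the six index corrections in pairs. What remains is
    a matrix identity in [Gam] and its derivatives, in which the second derivatives cancel by
    commutation. *)
Lemma bianchi2 a i j : cOm a i j + cOm i j a + cOm j a i = 0.
Proof.
have E1 : \sum_p Gam a i p *: Om p j = - \sum_p Gam i a p *: Om j p.
  by rewrite -sumrN; apply: eq_bigr => p _; rewrite Gam_sym Om_anti scalerN.
have E2 : \sum_p Gam i j p *: Om p a = - \sum_p Gam j i p *: Om a p.
  by rewrite -sumrN; apply: eq_bigr => p _; rewrite Gam_sym Om_anti scalerN.
have E3 : \sum_p Gam j a p *: Om p i = - \sum_p Gam a j p *: Om i p.
  by rewrite -sumrN; apply: eq_bigr => p _; rewrite Gam_sym Om_anti scalerN.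
rewrite /cOm E1 E2 E3; move: (\sum_p _) (\sum_p _) (\sum_p _) => s1 s2 s3.
rewrite !DXOm (DXC i a) (DXC j a) (DXC j i) /Om.
rewrite !(mulmxBl, mulmxDl, mulmxBr, mulmxDr) !mulmxA.
mxring.
Qed.

Lemma cOm_anti a i j : cOm a j i = - cOm a i j.
Proof.
rewrite /cOm Om_anti DXN mulNmx mulmxN.
have E1 : \sum_p Gam a j p *: Om p i = - \sum_p Gam a j p *: Om i p.
  by rewrite -sumrN; apply: eq_bigr => p _; rewrite Om_anti scalerN.
have E2 : \sum_p Gam a i p *: Om j p = - \sum_p Gam a i p *: Om p j.
  by rewrite -sumrN; apply: eq_bigr => p _; rewrite Om_anti scalerN.
rewrite E1 E2; mxring.
Qed.

(** [H] is parallel, so raising an index commutes with the covariant derivative and the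
    skew-symmetry of [H *m Om] is inherited. *)
Lemma HcOm_anti a i j : (H *m cOm a i j)^T = - (H *m cOm a i j).
Proof.
have key : H *m (DX a (Om i j) + Om i j *m Gam a - Gam a *m Om i j) =
    DX a (H *m Om i j) + (Gam a)^T *m (H *m Om i j) + H *m Om i j *m Gam a.
  rewrite DXM DXH !(mulmxBl, mulmxDl, mulmxBr, mulmxDr, mulNmx, mulmxN) !mulmxA.
  mxring.
have Hs (s : 'I_m.+1 -> S) (O : 'I_m.+1 -> 'M[S]_m.+1) :
    (forall p, (H *m O p)^T = - (H *m O p)) ->
    (H *m \sum_p s p *: O p)^T = - (H *m \sum_p s p *: O p).
  move=> HO; rewrite mulmx_sumr linear_sum -sumrN; apply: eq_bigr => p _.
  by rewrite -scalemxAr linearZ /= HO scalerN.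
have antiB (A B : 'M[S]_m.+1) : (H *m A)^T = - (H *m A) -> (H *m B)^T = - (H *m B) ->
    (H *m (A - B))^T = - (H *m (A - B)).
  by move=> HA HB; rewrite mulmxBr linearB /= HA HB; mxring.
rewrite /cOm; apply: (antiB); last by apply: (Hs) => p; exact: HOm_anti.
apply: (antiB); last by apply: (Hs) => p; exact: HOm_anti.
rewrite key; move: (HOm_anti i j); move: (H *m Om i j) => P PA.
rewrite !linearD /= !trmx_mul trmxK -DXT PA DXN mulNmx mulmxN; mxring.
Qed.

(** Contraction commutes with covariant differentiation: the corrections for the lower index [i] and
    for the contracted upper index cancel in the trace. *)
Lemma cov_ric a j k : cov a ricM j k = \sum_i cOm a i j k i.
Proof.
have E (i : 'I_m.+1) : cOm a i j k i = D a (Om i j k i) + (Om i j *m Gam a) k i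
    - (Gam a *m Om i j) k i - \sum_p Gam a i p * Om p j k i - \sum_p Gam a j p * Om i p k i.
  rewrite /cOm entry5 2!summxE [DX a (Om i j) _ _]mxE.
  by congr (_ - _ - _); apply: eq_bigr => p _; rewrite scalemxE.
under [RHS]eq_bigr do rewrite E.
rewrite !sumrB big_split /=.
have -> : \sum_i \sum_p Gam a i p * Om p j k i = \sum_i (Om i j *m Gam a) k i.
  rewrite exchange_big /=; apply: eq_bigr => p _; rewrite mulmx_entry.
  by apply: eq_bigr => i _; rewrite mulrC.
have -> : cov a ricM j k = D a (ricM j k) - (Gam a *m ricM) j k - (ricM *m (Gam a)^T) j k.
  by rewrite /cov 2!addmxE 2!oppmxE mxE.
have -> : (ricM *m (Gam a)^T) j k = \sum_i (Gam a *m Om i j) k i.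
  rewrite mxE; under [RHS]eq_bigr do rewrite mxE.
  rewrite exchange_big /=; apply: eq_bigr => q _; rewrite !mxE mulr_suml.
  by apply: eq_bigr => i _; rewrite mulrC.
have -> : (Gam a *m ricM) j k = \sum_i \sum_p Gam a j p * Om i p k i.
  rewrite mxE exchange_big /=; apply: eq_bigr => q _; rewrite [ricM _ _]mxE mulr_sumr.
  by [].
rewrite [ricM _ _]mxE der_sum; ring.
Qed.

Lemma trH_sum T : trH T = \sum_i \sum_j H i j * T i j.
Proof.
rewrite /trH; under eq_bigr do rewrite mxE; rewrite exchange_big /=.
by apply: eq_bigr => i _; apply: eq_bigr => j _; rewrite Hsy.
Qed.

Definition divR T i := \sum_a (H *m (cov a T)^T) a i.

Lemma divRE T i : divR T i = \sum_a \sum_k H a k * cov a T i k.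
Proof. by apply: eq_bigr => a _; rewrite mxE; apply: eq_bigr => k _; rewrite trmxE. Qed.

(** Double trace of [bianchi2]: one cyclic term gives the derivative of the scalar curvature, each
    of the other two minus the divergence of Ricci. *)
Lemma contracted_bianchi a : D a (trH ricM) = divR ricM a + divR ricM a.
Proof.
have T1 : \sum_j \sum_k \sum_i H j k * cOm a i j k i = D a (trH ricM).
  rewrite D_trH trH_sum; apply: eq_bigr => j _; apply: eq_bigr => k _.
  by rewrite cov_ric mulr_sumr.
have T3 : \sum_j \sum_k \sum_i H j k * cOm j a i k i = - divR ricM a.
  rewrite divRE -sumrN; apply: eq_bigr => j _; rewrite -sumrN; apply: eq_bigr => k _.
  rewrite cov_ric mulr_sumr -sumrN; apply: eq_bigr => i _.
  by rewrite cOm_anti oppmxE mulrN.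
(* Here the wrong pair of indices is contracted; skew-symmetry of [H *m cOm] exchanges them at the
   price of a sign. *)
have T2 : \sum_j \sum_k \sum_i H j k * cOm i j a k i = - divR ricM a.
  transitivity (\sum_i \sum_j (H *m cOm i j a) j i).
    rewrite [RHS]exchange_big /=; apply: eq_bigr => j _; rewrite exchange_big /=.
    by apply: eq_bigr => i _; rewrite mxE.
  transitivity (- \sum_i \sum_j (H *m cOm i j a) i j).
    rewrite -sumrN; apply: eq_bigr => i _; rewrite -sumrN; apply: eq_bigr => j _.
    by rewrite -oppmxE -HcOm_anti trmxE.
  rewrite divRE; congr (- _); apply: eq_bigr => i _.
  under eq_bigr do rewrite mxE; rewrite exchange_big /=; apply: eq_bigr => k _.
  by rewrite cov_ric mulr_sumr.
have : \sum_j \sum_k \sum_i H j k * (cOm a i j + cOm i j a + cOm j a i) k i = 0.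
  by do 3!(apply: big1 => ? _); rewrite bianchi2 zeromxE mulr0.
under eq_bigr do under eq_bigr do under eq_bigr do rewrite 2!addmxE 2!mulrDr.
under eq_bigr do under eq_bigr do rewrite 2!big_split /=.
under eq_bigr do rewrite 2!big_split /=.
rewrite 2!big_split /= T1 T2 T3 => e.
by apply/eqP; rewrite -subr_eq0; apply/eqP; rewrite -e; ring.
Qed.

(* om u is the differential of u, eta u a its covariant derivative along d_a,
   dv xi the divergence of the 1-form xi. *)
Definition om u : 'cV[S]_m.+1 := \col_j D j u.
Definition eta u a : 'cV[S]_m.+1 := DX a (om u) - Gam a *m om u.
Definition hessM u : 'M[S]_m.+1 := \matrix_(i, j) (D i (D j u) - \sum_k Gam i j k * D k u).

Lemma hessM_eta u i j : hessM u i j = eta u i j 0.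
Proof. by rewrite mxE addmxE oppmxE !mxE; congr (_ - _); apply: eq_bigr => k _; rewrite !mxE. Qed.

Lemma hessM_sym u : (hessM u)^T = hessM u.
Proof.
apply/matrixP => i j; rewrite !mxE DC; congr (_ - _).
by apply: eq_bigr => k _; rewrite Gam_sym.
Qed.

(** Ricci identity for du: by symmetry of [Gam] the corrections for the first index of the Hessian
    agree, and the commutator of two covariant derivatives of a 1-form is left. *)
Lemma cov_hessM u a i j :
  cov a (hessM u) i j - cov i (hessM u) a j = - (Om a i *m om u) j 0.
Proof.
have E b k : cov b (hessM u) k j =
    (DX b (eta u k)) j 0 - (Gam b *m hessM u) k j - (Gam b *m eta u k) j 0.
  rewrite /cov 2!addmxE 2!oppmxE; congr (_ - _ - _); first by rewrite mxE hessM_eta [RHS]mxE.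
  rewrite mxE [RHS]mxE; apply: eq_bigr => p _.
  by rewrite hessM_eta trmxE mulrC.
have sw : (Gam i *m hessM u) a j = (Gam a *m hessM u) i j.
  by rewrite mxE [RHS]mxE; apply: eq_bigr => p _; rewrite Gam_sym.
have K : DX a (eta u i) - Gam a *m eta u i - (DX i (eta u a) - Gam i *m eta u a) =
    - (Om a i *m om u).
  rewrite /eta !DXB !DXM /Om !(mulmxBl, mulmxDl, mulmxBr, mulmxDr) !mulmxA (DXC i a).
  mxring.
have := congr1 (fun M : 'cV_m.+1 => M j 0) K; rewrite entry4 oppmxE => <-.
rewrite !E sw; ring.
Qed.

(** Trace of the Ricci identity; skew-symmetry of [H *m Om] turns the contracted curvature into the
    Ricci tensor. *)
Lemma divR_hessM u i : divR (hessM u) i = D i (trH (hessM u)) + (ricM *m (H *m om u)) i 0.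
Proof.
have E a k : cov a (hessM u) i k = cov i (hessM u) a k - (Om a i *m om u) k 0.
  by rewrite -cov_hessM; ring.
rewrite divRE; under eq_bigr do under eq_bigr do rewrite E mulrBr.
under eq_bigr do rewrite sumrB; rewrite sumrB D_trH trH_sum; congr (_ + _).
transitivity (- \sum_a (H *m Om a i *m om u) a 0).
  congr (- _); apply: eq_bigr => a _; rewrite -mulmxA [RHS]mxE.
  by [].
transitivity (\sum_a \sum_l (H *m Om a i) l a * om u l 0).
  rewrite -sumrN; apply: eq_bigr => a _; rewrite mxE -sumrN; apply: eq_bigr => l _.
  by rewrite -mulNr -oppmxE -HOm_anti trmxE.
rewrite exchange_big /= mulmxA mxE; apply: eq_bigr => l _; rewrite -mulr_suml; congr (_ * _).
rewrite mxE; under eq_bigr do rewrite mxE; rewrite exchange_big /=; apply: eq_bigr => k _.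
by rewrite mxE mulr_suml; apply: eq_bigr => a _; rewrite mulrC Hsy.
Qed.

Lemma divRD T U i : divR (T + U) i = divR T i + divR U i.
Proof.
rewrite /divR -big_split; apply: eq_bigr => a _.
by rewrite covD linearD /= mulmxDr addmxE.
Qed.

Lemma divRZ c T i : divR (c *: T) i = (T *m (H *m om c)) i 0 + c * divR T i.
Proof.
rewrite !divRE; under eq_bigr do under eq_bigr do rewrite covZ addmxE !scalemxE mulrDr.
under eq_bigr do rewrite big_split /=; rewrite big_split /=; congr (_ + _).
  rewrite exchange_big mulmxA /= mxE.
  under [RHS]eq_bigr do rewrite mxE mulr_suml.
  rewrite [RHS]exchange_big /=; apply: eq_bigr => k _; apply: eq_bigr => a _.
  by rewrite (Hsy a k) mxE; ring.
rewrite mulr_sumr; apply: eq_bigr => a _; rewrite mulr_sumr; apply: eq_bigr => k _; ring.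
Qed.

Lemma divRG i : divR G i = 0.
Proof. by rewrite /divR big1// => a _; rewrite covG trmx0 mulmx0 mxE. Qed.

(** In the divergence of the hypothesis, Ric(grad f) occurs on both sides, from [divR_hessM] and
    from differentiating the factor [f], and cancels; div Ric vanishes because the scalar curvature
    is constant. *)
Lemma static_der f phi i : hessM f = f *: ricM + phi *: G ->
  (forall a, D a (trH ricM) = 0) -> D i phi = D i (trH (hessM f)).
Proof.
move=> st cs; have R0 : divR ricM i = 0.
  by rewrite -[LHS]halfK -contracted_bianchi cs mulr0.
have := divR_hessM f i; rewrite {1}st divRD !divRZ R0 divRG !mulr0 !addr0.
rewrite [G *m (H *m _)]mulmxA GH mul1mx [om phi _ _]mxE addrC => e; exact: addIr e.
Qed.

(** Pairing of a 1-form with a vector; the metric enters only through [H] applied to one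
    argument. *)
Definition pr (x y : 'cV[S]_m.+1) := (x^T *m y) 0 0.

Lemma prE x y : pr x y = \sum_i x i 0 * y i 0.
Proof. by rewrite /pr mxE; apply: eq_bigr => i _; rewrite trmxE. Qed.

Lemma prC x y : pr x y = pr y x.
Proof. by rewrite !prE; apply: eq_bigr => i _; rewrite mulrC. Qed.

Lemma prDl x y z : pr (x + y) z = pr x z + pr y z.
Proof. by rewrite /pr linearD /= mulmxDl addmxE. Qed.

Lemma prZl c x z : pr (c *: x) z = c * pr x z.
Proof. by rewrite /pr linearZ /= -scalemxAl scalemxE. Qed.

Lemma prNl x z : pr (- x) z = - pr x z.
Proof. by rewrite /pr linearN /= mulNmx oppmxE. Qed.

Lemma pr_mx A x y : pr (A *m x) y = pr x (A^T *m y).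
Proof. by rewrite /pr trmx_mul mulmxA. Qed.

Definition dv (xi : 'cV[S]_m.+1) := \sum_a (H *m (DX a xi - Gam a *m xi)) a 0.

Lemma dvD x y : dv (x + y) = dv x + dv y.
Proof.
rewrite /dv -big_split; apply: eq_bigr => a _ /=.
have -> : DX a (x + y) - Gam a *m (x + y) =
    (DX a x - Gam a *m x) + (DX a y - Gam a *m y) by rewrite DXD mulmxDr; mxring.
by rewrite mulmxDr addmxE.
Qed.

Lemma dvZ c x : dv (c *: x) = pr (H *m om c) x + c * dv x.
Proof.
have E a : (H *m (DX a (c *: x) - Gam a *m (c *: x))) a 0 =
    D a c * (H *m x) a 0 + c * (H *m (DX a x - Gam a *m x)) a 0.
  rewrite DXZ -scalemxAr.
  have -> : D a c *: x + c *: DX a x - c *: (Gam a *m x) =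
    D a c *: x + c *: (DX a x - Gam a *m x) by mxring.
  by rewrite mulmxDr -!scalemxAr addmxE !scalemxE.
rewrite /dv; under eq_bigr do rewrite E; rewrite big_split /= -mulr_sumr; congr (_ + _).
by rewrite pr_mx Hsym prE; apply: eq_bigr => a _; rewrite [om _ _ _]mxE.
Qed.

Lemma dvN x : dv (- x) = - dv x.
Proof.
rewrite -scaleN1r dvZ mulN1r -[RHS]add0r; congr (_ + _).
rewrite /om prC prE big1// => a _; rewrite mxE big1 ?mulr0// => b _.
by rewrite mxE derN der1 oppr0 mulr0.
Qed.

Lemma dv_om u : dv (om u) = trH (hessM u).
Proof.
rewrite trH_sum; apply: eq_bigr => a _; rewrite mxE; apply: eq_bigr => b _.
by rewrite hessM_eta.
Qed.

Lemma cov_grad u a : DX a (H *m om u) + (Gam a)^T *m (H *m om u) = H *m eta u a.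
Proof.
rewrite DXM DXH /eta !(mulmxBl, mulmxBr) mulNmx !mulmxA; mxring.
Qed.

Lemma pr_eta u a x : pr (eta u a) x = (hessM u *m x) a 0.
Proof. by rewrite prE mxE; apply: eq_bigr => i _; rewrite hessM_eta. Qed.

Lemma D_norm u a : D a (pr (om u) (H *m om u)) = (hessM u *m (H *m om u)) a 0 *+ 2.
Proof.
have -> : D a (pr (om u) (H *m om u)) = pr (DX a (om u)) (H *m om u) + pr (om u) (DX a (H *m om u)).
  rewrite /pr -addmxE -DXT -DXM [RHS]mxE; by [].
have -> : DX a (om u) = eta u a + Gam a *m om u by rewrite /eta subrK.
have -> : DX a (H *m om u) = H *m eta u a - (Gam a)^T *m (H *m om u).
  by rewrite -cov_grad addrK.
rewrite prDl pr_eta [pr (om u) _]prC prDl prNl [pr ((Gam a)^T *m _) _]pr_mx trmxK.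
rewrite [pr (Gam a *m _) _]prC [pr (H *m eta u a) _]pr_mx Hsym pr_eta mulr2n; ring.
Qed.

(** Bochner formula in divergence form: by [cov_grad] the product rule is covariant, and the
    divergence of the Hessian is given by [divR_hessM]. *)
Lemma dv_hess u : dv (hessM u *m (H *m om u)) = trH (hessM u *m H *m hessM u) +
  pr (H *m om u) (om (trH (hessM u)) + ricM *m (H *m om u)).
Proof.
set v := H *m om u; set T := hessM u.
have E a : DX a (T *m v) - Gam a *m (T *m v) = cov a T *m v + T *m (H *m eta u a).
  rewrite -cov_grad -/v DXM /cov !(mulmxBl, mulmxDr) !mulmxA; mxring.
rewrite /dv; under eq_bigr do rewrite E mulmxDr addmxE; rewrite big_split /= addrC; congr (_ + _).
  rewrite /trH; apply: eq_bigr => a _.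
  rewrite !mulmxA !mulmx_entry; apply: eq_bigr => k _; rewrite -hessM_eta; congr (_ * _).
  by rewrite -[in LHS]hessM_sym trmxE.
rewrite prE; under eq_bigr do rewrite mulmxA mxE.
rewrite exchange_big /=; apply: eq_bigr => j _; rewrite -mulr_suml mulrC; congr (_ * _).
rewrite addmxE [om _ _ _]mxE -divR_hessM -/T /divR; apply: eq_bigr => a _.
by rewrite -covT hessM_sym.
Qed.

(** Hess f(grad f, grad f) arises once from the factor [f], once from f Ric(grad f, grad f) by the
    static equation, and twice with the opposite sign from the derivative of |grad f|^2, so that it
    disappears. *)
Lemma dv_X f phi c2 c3 :
  (forall a, D a c2 = 0) -> (forall a, D a c3 = 0) ->
  hessM f = f *: ricM + phi *: G ->
  let v := H *m om f in let u := pr (om f) v in let T := hessM f in let L := trH T in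
  dv (f *: (T *m v) - (u + c2 * (f * f) - c3) *: om f) =
  f * trH (T *m H *m T) + f * pr v (om L) - phi * u - 2 * c2 * f * u - u * L
  - c2 * (f * f) * L + c3 * L.
Proof.
move=> Dc2 Dc3 st v u T L.
rewrite dvD dvN !dvZ dv_hess -/v -/T -/L dv_om -/T -/L.
have omD a b : om (a + b) = om a + om b by apply/colP => i; rewrite !mxE DD.
have -> : om (u + c2 * (f * f) - c3) = 2 *: (T *m v) + (2 * c2 * f) *: om f.
  apply/colP => i; rewrite mxE derB DD D_norm -/v -/T !DM Dc2 Dc3 addmxE !scalemxE [om f _ _]mxE.
  by rewrite -mulr_natl; ring.
rewrite mulmxDr -!scalemxAr -/v prDl !prZl.
have -> : pr (H *m (T *m v)) (om f) = pr v (T *m v).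
  by rewrite pr_mx Hsym -/v prC.
have -> : pr v (om f) = u by rewrite prC.
have ric : f * pr v (ricM *m v) = pr v (T *m v) - phi * u.
  have -> : T *m v = f *: (ricM *m v) + phi *: om f.
    by rewrite /T st mulmxDl -!scalemxAl; congr (_ + _ *: _); rewrite mulmxA GH mul1mx.
  by rewrite prC [pr v (_ + _)]prC prDl !prZl -/u; ring.
have -> : pr v (om L + ricM *m v) = pr v (om L) + pr v (ricM *m v).
  by rewrite prC prDl ![pr _ v]prC.
rewrite !mulrDr ric.
ring.
Qed.

Lemma tr_Gam a : \tr (H *m DX a G) = (\tr (Gam a)) *+ 2.
Proof.
rewrite DXG mulmxDr linearD /= mxtrace_mulC -mulmxA GH mulmx1 mulmxA HG mul1mx mxtrace_tr.
by rewrite mulr2n.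
Qed.

(** The coordinate form of the divergence. As tr (Gam a) is the logarithmic derivative of sqrt (det
    G), it leads to the divergence of a vector density. *)
Lemma div_vec xi : \sum_a (D a ((H *m xi) a 0) + \tr (Gam a) * (H *m xi) a 0) = dv xi.
Proof.
have E a : D a ((H *m xi) a 0) =
    (H *m (DX a xi - Gam a *m xi)) a 0 - ((Gam a)^T *m (H *m xi)) a 0.
  rewrite -oppmxE -addmxE; have -> : D a ((H *m xi) a 0) = (DX a (H *m xi)) a 0 by rewrite [RHS]mxE.
  suff -> : DX a (H *m xi) = H *m (DX a xi - Gam a *m xi) - (Gam a)^T *m (H *m xi) by [].
  rewrite DXM DXH mulmxBl mulNmx mulmxBr !mulmxA; mxring.
under eq_bigr do rewrite E; rewrite big_split sumrB /= -/(dv xi).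
suff -> : \sum_a ((Gam a)^T *m (H *m xi)) a 0 = \sum_a \tr (Gam a) * (H *m xi) a 0 by rewrite subrK.
under eq_bigr do rewrite mxE; rewrite exchange_big /=; apply: eq_bigr => k _.
rewrite -mulr_suml /mxtrace; congr (_ * _); apply: eq_bigr => a _.
by rewrite trmxE Gam_sym.
Qed.

End DifferentialRing.

(** * Local computations on a static fluid *)

Section PositiveDefinite.
Context {R : rcfType}.

(** Induction on the size through the Schur complement. The factorisation takes the place of
    diagonalisation in the positivity statements below. *)
Lemma cholesky n (G : 'M[R]_n) : G^T = G ->
  (forall v : 'rV[R]_n, v != 0 -> 0 < (v *m G *m v^T) 0 0) ->
  exists2 B : 'M[R]_n, G = B *m B^T & B \in unitmx.
Proof.
elim: n G => [|n IH] G Gs Gp.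
  by exists 1%:M; rewrite ?unitmx1//; apply/matrixP => -[].
move: G Gs Gp; rewrite -[n.+1]/(1 + n)%N => G Gs Gp.
pose b : 'rV[R]_n := ursubmx G; pose Dd := drsubmx G; pose a := ulsubmx G 0 0.
have ulE : ulsubmx G = a%:M by apply/matrixP => i j; rewrite !ord1 [RHS]mxE eqxx mulr1n.
have dlE : dlsubmx G = b^T by rewrite /b trmx_ursub Gs.
have GE : G = block_mx a%:M b b^T Dd by rewrite -ulE -dlE /b /Dd submxK.
have Ds : Dd^T = Dd by rewrite /Dd trmx_drsub Gs.
have a0 : 0 < a.
  have := Gp (row_mx 1%:M 0); rewrite GE mul_row_block tr_row_mx mul_row_col.
  rewrite !mul1mx !mul0mx !addr0 trmx0 mulmx0 trmx1 mulmx1 addr0 mxE eqxx mulr1n; apply.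
  apply/eqP => /matrixP/(_ 0 (lshift n 0)); rewrite row_mxEl !mxE eqxx => /eqP.
  by rewrite oner_eq0.
have sa : Num.sqrt a * Num.sqrt a = a by rewrite -expr2 sqr_sqrtr// ltW.
have sa0 : Num.sqrt a != 0 by rewrite gt_eqF// sqrtr_gt0.
have a0' : a != 0 by rewrite gt_eqF.
pose G' := Dd - a^-1 *: (b^T *m b).
have [||B' EB uB] := IH G'.
- by rewrite /G' linearB linearZ /= trmx_mul trmxK Ds.
(* This first coordinate minimises the form for given [v], and the minimum is the Schur complement
   evaluated at [v]. *)
- move=> v v0; pose s : 'rV[R]_1 := - (a^-1 *: (v *m b^T)).
  have := Gp (row_mx s v); rewrite GE mul_row_block.
  have -> : s *m a%:M + v *m b^T = 0.
    by rewrite mul_mx_scalar /s scalerN scalerA divff// scale1r addNr.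
  have -> : s *m b + v *m Dd = v *m G'.
    by rewrite /G' mulmxBr /s mulNmx -scalemxAl -scalemxAr mulmxA addrC.
  rewrite tr_row_mx mul_row_col mul0mx add0r; apply.
  apply: contraNneq v0 => /matrixP H; apply/eqP/matrixP => i j.
  by have := H i (rshift 1 j); rewrite row_mxEr !mxE.
exists (block_mx (Num.sqrt a)%:M 0 ((Num.sqrt a)^-1 *: b^T) B'); last first.
  by rewrite unitmxE det_lblock det_scalar1 unitrM unitfE sa0 -unitmxE.
rewrite tr_block_mx mulmx_block trmx0 !mulmx0 !mul0mx !addr0 -EB tr_scalar_mx.
rewrite -scalar_mxM sa linearZ /= trmxK mul_scalar_mx scalerA divff// scale1r.
rewrite mul_mx_scalar scalerA divff// scale1r -scalemxAl -scalemxAr scalerA -invfM sa.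
by rewrite /G' addrC subrK -GE.
Qed.

Lemma posdef_det n (G : 'M[R]_n) : G^T = G ->
  (forall v : 'rV[R]_n, v != 0 -> 0 < (v *m G *m v^T) 0 0) -> 0 < \det G.
Proof.
move=> Gs Gp; have [B -> uB] := cholesky Gs Gp.
by rewrite det_mulmx det_tr -expr2 exprn_even_gt0//= -unitfE -unitmxE.
Qed.

Lemma posdef_diag n (G : 'M[R]_n) i :
  (forall v : 'rV[R]_n, v != 0 -> 0 < (v *m G *m v^T) 0 0) -> 0 < G i i.
Proof.
move=> Gp; have := Gp (delta_mx 0 i); rewrite trmx_delta -rowE.
rewrite -colE !mxE; apply; apply/eqP => /matrixP/(_ 0 i); rewrite !mxE !eqxx => /eqP.
by rewrite oner_eq0.
Qed.

Lemma posdef_inv n (G : 'M[R]_n) : G^T = G ->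
  (forall v : 'rV[R]_n, v != 0 -> 0 < (v *m G *m v^T) 0 0) ->
  forall v : 'rV[R]_n, v != 0 -> 0 < (v *m invmx G *m v^T) 0 0.
Proof.
move=> Gs Gp v v0.
have uG : G \in unitmx by rewrite unitmxE unitfE gt_eqF// posdef_det.
have := Gp (v *m invmx G); rewrite mulmxKV// trmx_mul trmx_inv Gs mulmxA; apply.
by apply: contraNneq v0 => e; rewrite -[v](mulmxKV uG) e mul0mx.
Qed.

(** The squared norm of the trace-free part T - (L/n) G is nonnegative: with H = B^-T B^-1 it is the
    trace of C C^T for a conjugate C of that part. *)
Lemma trace_cauchy n (G T : 'M[R]_n.+1) : G^T = G -> T^T = T ->
  (forall v : 'rV[R]_n.+1, v != 0 -> 0 < (v *m G *m v^T) 0 0) ->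
  (\tr (invmx G *m T)) ^+ 2 / n.+1%:R <= \tr (invmx G *m (T *m invmx G *m T)).
Proof.
move=> Gs Ts Gp; have [B GE uB] := cholesky Gs Gp.
have uG : G \in unitmx by rewrite unitmxE unitfE gt_eqF// posdef_det.
set H := invmx G; set L := \tr (H *m T).
have HG : H *m G = 1%:M by rewrite mulVmx.
have psd (A : 'M[R]_n.+1) : A^T = A -> 0 <= \tr (H *m (A *m H *m A)).
  move=> As; pose C := invmx B *m A *m (invmx B)^T.
  have HE : H = (invmx B)^T *m invmx B.
    apply: (@row_free_inj _ _ _ _ G); rewrite ?row_free_unit//= HG GE -mulmxA.
    by rewrite [invmx B *m _]mulmxA mulVmx// mul1mx -trmx_mul mulmxV// trmx1.
  have -> : \tr (H *m (A *m H *m A)) = \tr (C *m C^T).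
    rewrite HE /C !trmx_mul trmxK As -!mulmxA mxtrace_mulC -!mulmxA.
    by [].
  rewrite /mxtrace sumr_ge0// => i _; rewrite mxE sumr_ge0// => j _.
  by rewrite [C^T _ _]mxE -expr2 sqr_ge0.
have n0 : n.+1%:R != 0 :> R by rewrite pnatr_eq0.
have := psd (T - (L / n.+1%:R) *: G).
rewrite linearB linearZ /= Gs Ts => /(_ erefl).
have -> : (T - (L / n.+1%:R) *: G) *m H *m (T - (L / n.+1%:R) *: G) =
    T *m H *m T - (L / n.+1%:R *+ 2) *: T + (L / n.+1%:R) ^+ 2 *: G.
  have GHc : G *m H = 1%:M by rewrite mulmxV.
  have -> : (T - (L / n.+1%:R) *: G) *m H = T *m H - (L / n.+1%:R)%:M.
    by rewrite mulmxBl -scalemxAl GHc scalemx1.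
  rewrite mulmxBl mulmxBr -scalemxAr -[T *m H *m G]mulmxA HG mulmx1 mul_scalar_mx.
  move: (T *m H *m T) => U; apply/matrixP => i j; rewrite !mxE; ring.
rewrite !(mulmxDr, mulmxBr) !(linearD, linearN) /= -!scalemxAr HG !linearZ /= mxtrace1 -/L.
set Q := \tr _ => le0; rewrite -subr_ge0.
suff -> : Q - L ^+ 2 / n.+1%:R = Q + (L / n.+1%:R *+ 2) *: - L + (L / n.+1%:R) ^+ 2 * n.+1%:R by [].
rewrite [_ *: _]mulrN; by field.
Qed.

End PositiveDefinite.

(** Bundling the set with the proof that it is open lets the ring structure of [sfun] be inferred
    from the set. *)
Record ropen (R : realType) (m : nat) := ROpen {
  rset :> set 'rV[R]_m.+1; ropenP : rel_open rset }.

(** * The differential ring of smooth functions on a relatively open set *)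

Section SmoothRing.
Context {R : realType} {m : nat} (V : ropen R m).

Local Notation fn := ('rV[R]_m.+1 -> R).

Definition smoothp : {pred 'rV[R]_m.+1 -> R} := fun F => `[< smooth_on V F >].

Lemma smoothpP (F : fn) : reflect (smooth_on V F) (F \in smoothp).
Proof. exact: asboolP. Qed.

Lemma smoothp_subring : subring_closed smoothp.
Proof.
have oV := @ropenP _ _ V; split => [|F G|F G].
- by apply/smoothpP; apply: (smooth_closureP oV); exact: sc_cst.
- move=> /smoothpP sF /smoothpP sG; apply/smoothpP.
  have -> : F - G = fun y => F y + (-1) * G y by apply/funext => y; rewrite !fctE mulN1r.
  apply: (smooth_closureP oV); apply: sc_add; first exact: sc_smooth.
  by apply: sc_mul; [exact: sc_cst|exact: sc_smooth].
- move=> /smoothpP sF /smoothpP sG; apply/smoothpP.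
  by apply: (smooth_closureP oV); apply: sc_mul; exact: sc_smooth.
Qed.

HB.instance Definition _ :=
  GRing.isSubringClosed.Build ('rV[R]_m.+1 -> R) smoothp smoothp_subring.

Record sfun := SFun { sfunv : 'rV[R]_m.+1 -> R; _ : sfunv \in smoothp }.

HB.instance Definition _ := [isSub for sfunv].
HB.instance Definition _ := [Choice of sfun by <:].
HB.instance Definition _ := [SubChoice_isSubComNzRing of sfun by <:].

Definition ev (x : 'rV[R]_m.+1) (F : sfun) : R := sfunv F x.

Lemma evD x (F G : sfun) : ev x (F + G) = ev x F + ev x G.
Proof. by []. Qed.

Lemma evM x (F G : sfun) : ev x (F * G) = ev x F * ev x G.
Proof. by []. Qed.

Lemma evN x (F : sfun) : ev x (- F) = - ev x F.
Proof. by []. Qed.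

Lemma evB x (F G : sfun) : ev x (F - G) = ev x F - ev x G.
Proof. by []. Qed.

Lemma ev0 x : ev x 0 = 0.
Proof. by []. Qed.

Lemma ev1 x : ev x 1 = 1.
Proof. by []. Qed.

Lemma ev_sum x (I : Type) (r : seq I) (P : pred I) (F : I -> sfun) :
  ev x (\sum_(k <- r | P k) F k) = \sum_(k <- r | P k) ev x (F k).
Proof. exact: (big_morph (ev x) (evD x) (ev0 x)). Qed.

(** With [ev_monoid] this makes evaluation a ring morphism, so that it commutes with matrix products
    and determinants. *)
Lemma ev_zmod x : zmod_morphism (ev x).
Proof. by []. Qed.

Lemma ev_monoid x : monoid_morphism (ev x).
Proof. by []. Qed.

HB.instance Definition _ x := GRing.isZmodMorphism.Build sfun R (ev x) (ev_zmod x).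
HB.instance Definition _ x := GRing.isMonoidMorphism.Build sfun R (ev x) (ev_monoid x).

Lemma sfunP (F G : sfun) : (forall x, ev x F = ev x G) -> F = G.
Proof. by move=> FG; apply: val_inj; apply/funext. Qed.

Lemma sfun_smooth (F : sfun) : smooth_on V (fun x => ev x F).
Proof. by case: F => F FP; exact/smoothpP. Qed.

Definition mksfun (F : fn) (sF : smooth_on V F) : sfun := SFun (introT (smoothpP F) sF).

Lemma ev_mksfun (F : fn) (sF : smooth_on V F) x : ev x (mksfun sF) = F x.
Proof. by []. Qed.

(** Elements of [sfun] are total functions and equal only if they agree everywhere. Setting the
    derivative to zero outside [V] makes additivity, the Leibniz rule and commutation hold as
    identities of the ring. *)
Definition derV i (F : fn) x := if x \in rset V then pder i F x else 0.

Lemma derV_smooth i (F : fn) : smooth_on V F -> smooth_on V (derV i F).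
Proof.
move=> sF; apply: (smooth_congr (@ropenP _ _ V) _ (smooth_pder i sF)) => x Vx.
by rewrite /derV Vx.
Qed.

Definition derS i (F : sfun) : sfun := mksfun (derV_smooth i (sfun_smooth F)).

Lemma ev_derS i (F : sfun) x : ev x (derS i F) = if x \in rset V then pder i (fun y => ev y F) x else 0.
Proof. by []. Qed.

Lemma ev_derS_in i (F : sfun) x : rset V x -> ev x (derS i F) = pder i (fun y => ev y F) x.
Proof. by move=> /mem_set Vx; rewrite ev_derS Vx. Qed.

Lemma sfun_is_pder i (F : sfun) x : rset V x -> is_pder i (fun y => ev y F) x (ev x (derS i F)).
Proof.
move=> Vx; rewrite ev_derS_in//.
exact: C1at_is_pder (smooth_C1at (@ropenP _ _ V) (sfun_smooth F) Vx).
Qed.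

Lemma derSD i (F G : sfun) : derS i (F + G) = derS i F + derS i G.
Proof.
apply: sfunP => x; rewrite evD; case: (pselect (rset V x)) => Vx; last first.
  by rewrite !ev_derS memNset// addr0.
rewrite ev_derS_in//; apply: is_pder_val; first exact: rel_open_half (@ropenP _ _ V) Vx.
exact: is_pderD (@sfun_is_pder i F x Vx) (@sfun_is_pder i G x Vx).
Qed.

Lemma derSM i (F G : sfun) : derS i (F * G) = derS i F * G + F * derS i G.
Proof.
apply: sfunP => x; rewrite evD !evM; case: (pselect (rset V x)) => Vx; last first.
  by rewrite !ev_derS memNset// mul0r mulr0 addr0.
rewrite ev_derS_in//; apply: is_pder_val; first exact: rel_open_half (@ropenP _ _ V) Vx.
exact: is_pderM (@sfun_is_pder i F x Vx) (@sfun_is_pder i G x Vx).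
Qed.

Lemma pder_eqV i (F G : fn) x : rset V x -> (forall y, rset V y -> F y = G y) -> pder i F x = pder i G x.
Proof.
move=> Vx FG; have oV := @ropenP _ _ V.
have n : {near hnbhs x, F =1 G}.
  by apply: (eq_on_near oV _ Vx) => y; rewrite inE; exact: FG.
by have [] := pder_congr i (rel_open_half oV Vx) n.
Qed.

Lemma derSC i j (F : sfun) : derS i (derS j F) = derS j (derS i F).
Proof.
apply: sfunP => x; case: (pselect (rset V x)) => Vx; last by rewrite !ev_derS memNset.
have E k l : ev x (derS k (derS l F)) = pder k (pder l (fun y => ev y F)) x.
  rewrite ev_derS_in//.
  exact: (pder_eqV k Vx (fun y Vy => ev_derS_in l F Vy)).
rewrite (E i j) (E j i).
exact: (smooth_pderC j i (@ropenP _ _ V) (sfun_smooth F) Vx).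
Qed.

Lemma cst_smooth (a : R) : smooth_on V (fun=> a).
Proof. by apply: (smooth_closureP (@ropenP _ _ V)); exact: sc_cst. Qed.

Definition cstS (a : R) : sfun := mksfun (cst_smooth a).

Lemma derS_cst i a : derS i (cstS a) = 0.
Proof.
apply: sfunP => x; rewrite ev_derS; case: ifP => // /set_mem Vx.
by apply: is_pder_val; [exact: rel_open_half (@ropenP _ _ V) Vx|exact: is_pder_cst].
Qed.

End SmoothRing.

Section DerivativeOfDeterminant.
Variables (S : comNzRingType) (m : nat) (D : 'I_m.+1 -> S -> S).
Hypothesis DD : forall i a b, D i (a + b) = D i a + D i b.
Hypothesis DM : forall i a b, D i (a * b) = D i a * b + a * D i b.

Lemma der_prod a (I : finType) (F : I -> S) :
  D a (\prod_i F i) = \sum_k D a (F k) * \prod_(i | i != k) F i.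
Proof.
have key (r : seq I) : uniq r ->
    D a (\prod_(i <- r) F i) = \sum_(k <- r) D a (F k) * \prod_(i <- r | i != k) F i.
  elim: r => [_|b r IH /= /andP[br ur]]; first by rewrite !big_nil (der1 DM).
  rewrite !big_cons DM eqxx IH//; congr (_ * _ + _).
    rewrite big_seq [RHS]big_seq_cond; apply: eq_bigl => i.
    by case: (boolP (i \in r)) => //= ir; apply/esym; apply: contraNneq br => <-.
  rewrite mulr_sumr big_seq [RHS]big_seq; apply: eq_bigr => k kr.
  rewrite big_cons ifT; last by apply: contraNneq br => ->.
  by rewrite mulrCA.
by have := key _ (index_enum_uniq I).
Qed.

(** Jacobi's formula: expanding along the differentiated row produces the cofactors. *)
Lemma der_det a (B : 'M[S]_m.+1) : D a (\det B) = \tr (\adj B *m DX D a B).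
Proof.
have Dsgn (s : bool) : D a ((-1) ^+ s) = 0.
  by case: s; rewrite ?expr0 ?expr1 ?(derN DD) (der1 DM) ?oppr0.
rewrite {1}/determinant (der_sum DD).
under eq_bigr => s _ do rewrite DM Dsgn mul0r add0r der_prod mulr_sumr.
rewrite exchange_big /=.
rewrite mxtrace_mulC /mxtrace; apply: eq_bigr => k _; rewrite mxE.
pose Bk : 'M[S]_m.+1 := \matrix_(i, j) if i == k then D a (B i j) else B i j.
transitivity (\det Bk).
  apply: eq_bigr => s _; congr (_ * _); rewrite [RHS](bigD1 k)//= mxE eqxx; congr (_ * _).
  by apply: eq_bigr => i ik; rewrite mxE (negbTE ik).
rewrite (expand_det_row _ k); apply: eq_bigr => j _; rewrite !mxE eqxx; congr (_ * _).
rewrite /cofactor; congr (_ * \det _); apply/matrixP => p r; rewrite !mxE.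
by rewrite eq_sym (negbTE (neq_lift _ _)).
Qed.
End DerivativeOfDeterminant.

(** * The static equation and the divergence of X in one chart *)

Section LocalComputation.
Context {R : realType} {m : nat} (V : ropen R m).
Variables (G : 'rV[R]_m.+1 -> 'M[R]_m.+1).
Hypothesis G_smooth : forall i j, smooth_on (rset V) (fun x => G x i j).
Hypothesis G_sym : forall x, rset V x -> (G x)^T = G x.
Hypothesis G_pos : forall x, rset V x -> forall v : 'rV[R]_m.+1, v != 0 ->
  0 < (v *m G x *m v^T) 0 0.
Local Notation S := (sfun V).
Local Notation oV := (@ropenP _ _ V).

(* Outside V the metric is replaced by the identity matrix, so that det G is
   positive everywhere and the ring sfun V contains 1/sqrt (det G). *)
Definition extG x : 'M[R]_m.+1 := if x \in rset V then G x else 1%:M.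

Lemma extG_smooth i j : smooth_on (rset V) (fun x => extG x i j).
Proof.
by apply: (smooth_congr oV _ (G_smooth i j)) => x Vx; rewrite /extG Vx.
Qed.

Definition GS : 'M[S]_m.+1 := \matrix_(i, j) mksfun (extG_smooth i j).

Lemma ev_GS x : map_mx (ev x) GS = extG x.
Proof. by apply/matrixP => i j; rewrite !mxE. Qed.

Lemma extG_sym x : (extG x)^T = extG x.
Proof. by rewrite /extG; case: ifP => [/set_mem Vx|_]; rewrite ?trmx1// G_sym. Qed.

Lemma extG_pos x (v : 'rV[R]_m.+1) : v != 0 -> 0 < (v *m extG x *m v^T) 0 0.
Proof.
rewrite /extG; case: ifP => [/set_mem Vx|_] v0; first exact: G_pos.
rewrite mulmx1 mxE lt_neqAle; apply/andP; split; last first.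
  by apply: sumr_ge0 => i _; rewrite [v^T _ _]mxE -expr2 sqr_ge0.
rewrite eq_sym psumr_eq0; last by move=> i _; rewrite [v^T _ _]mxE -expr2 sqr_ge0.
apply: contraNN v0 => /allP H; apply/eqP/rowP => i; rewrite mxE.
have := H i (mem_index_enum _); rewrite [v^T _ _]mxE -expr2 sqrf_eq0 => /eqP.
by [].
Qed.

Definition dS : S := \det GS.

Lemma ev_dS x : ev x dS = \det (extG x).
Proof. by rewrite -ev_GS det_map_mx. Qed.

Lemma dS_gt0 x : 0 < ev x dS.
Proof. by rewrite ev_dS; apply: posdef_det; [exact: extG_sym|exact: extG_pos]. Qed.

Lemma isq_smooth : smooth_on (rset V) (fun x => (Num.sqrt (ev x dS))^-1).
Proof.
apply: (smooth_closureP oV); apply: sc_isqrt; first exact: sfun_smooth.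
by move=> x _; exact: dS_gt0.
Qed.

Definition iS : S := mksfun isq_smooth.
(** sqrt (det G), obtained from its inverse because [smooth_closure] contains only the latter as a
    generator. *)
Definition wS : S := dS * iS.

Lemma ev_wS x : ev x wS = Num.sqrt (ev x dS).
Proof.
rewrite evM ev_mksfun; have d0 := dS_gt0 x.
rewrite -{1}[ev x dS]sqr_sqrtr ?ltW// expr2 mulfK// gt_eqF// sqrtr_gt0//.
Qed.

Lemma wS2 : wS * wS = dS.
Proof. by apply: sfunP => x; rewrite evM ev_wS -expr2 sqr_sqrtr// ltW// dS_gt0. Qed.

Definition HS : 'M[S]_m.+1 := (iS * iS) *: \adj GS.

Lemma iS2 : iS * iS * dS = 1.
Proof.
apply: sfunP => x; rewrite !evM ev_mksfun ev1; have d0 := dS_gt0 x.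
have s0 : Num.sqrt (ev x dS) != 0 by rewrite gt_eqF// sqrtr_gt0.
rewrite -{3}[ev x dS]sqr_sqrtr ?ltW//.
by field.
Qed.

Lemma GS_sym : GS^T = GS.
Proof.
apply/matrixP => i j; apply: sfunP => x; rewrite !mxE !ev_mksfun.
by have /matrixP/(_ i j) := extG_sym x; rewrite mxE.
Qed.

Lemma GSHS : GS *m HS = 1%:M.
Proof. by rewrite /HS -scalemxAr mul_mx_adj scale_scalar_mx -/dS iS2. Qed.

Lemma ev_HS x : map_mx (ev x) HS = invmx (extG x).
Proof.
have := congr1 (map_mx (ev x)) GSHS; rewrite map_mxM map_mx1 ev_GS => e.
have uG : extG x \in unitmx by rewrite unitmxE unitfE gt_eqF// -ev_dS dS_gt0.
by rewrite -[LHS](mulKmx uG) e mulmx1.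
Qed.

Lemma ev_HSE x i j : rset V x -> ev x (HS i j) = metric_inv G x i j.
Proof.
move=> Vx; have /matrixP/(_ i j) := ev_HS x; rewrite mxE => ->.
by rewrite /extG mem_set.
Qed.

Definition hS : S := cstS V 2^-1.

Lemma hS2 : hS + hS = 1.
Proof. by apply: sfunP => x; rewrite evD ev_mksfun ev1; lra. Qed.

Local Notation D := (@derS R m V).
Local Notation Gm := (Gam D GS HS hS).
Local Notation OmS := (Om D GS HS hS).
Local Notation ricS := (ricM D GS HS hS).

Lemma ev_DG i a b x : rset V x -> ev x (D i (GS a b)) = pder i (fun y => G y a b) x.
Proof.
move=> Vx; rewrite ev_derS_in//; apply: (@pder_eqV _ _ V) => // y Vy.
by rewrite mxE ev_mksfun /extG mem_set.
Qed.

Lemma ev_Gam i j k x : rset V x -> ev x (Gm i j k) = christoffel G k i j x.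
Proof.
move=> Vx; rewrite mxE evM ev_mksfun ev_sum; congr (_ * _).
apply: eq_bigr => l _; rewrite evM evB evD !ev_DG//; congr (_ * _).
exact: ev_HSE.
Qed.

Lemma ev_DGam i a b c x : rset V x -> ev x (D i (Gm a b c)) = pder i (christoffel G c a b) x.
Proof.
by move=> Vx; rewrite ev_derS_in//; apply: (@pder_eqV _ _ V) => // y Vy; exact: ev_Gam.
Qed.

Lemma ev_Om i j k l x : rset V x -> ev x (OmS i j k l) = riemann G l i j k x.
Proof.
move=> Vx.
have -> : OmS i j k l = D i (Gm j k l) - D j (Gm i k l)
    + \sum_p (Gm j k p * Gm i p l) - \sum_p (Gm i k p * Gm j p l).
  have mE (A B C E : 'M[S]_m.+1) : (A - B + C - E) k l = A k l - B k l + C k l - E k l.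
    by rewrite !(addmxE, oppmxE).
  have mD a (B : 'M[S]_m.+1) : DX D a B k l = D a (B k l) by rewrite mxE.
  by rewrite /Om mE !mD; congr (_ - _ + _ - _); exact: mulmx_entry.
have e4 (A B C E : S) : ev x (A - B + C - E) = ev x A - ev x B + (ev x C - ev x E).
  by rewrite evB evD evB addrA.
rewrite e4 (ev_DGam i j k l Vx) (ev_DGam j i k l Vx) !ev_sum -sumrB; congr (_ + _).
have e2 (A B C E : S) : ev x (A * B) - ev x (C * E) = ev x B * ev x A - ev x E * ev x C.
  by rewrite !evM mulrC [ev x C * _]mulrC.
by apply: eq_bigr => p _; rewrite e2 (ev_Gam i p l Vx) (ev_Gam j k p Vx)
  (ev_Gam j p l Vx) (ev_Gam i k p Vx).
Qed.

Lemma ev_ric j k x : rset V x -> ev x (ricS j k) = ricci G x j k.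
Proof.
move=> Vx; rewrite !mxE ev_sum; apply: eq_bigr => i _; exact: ev_Om.
Qed.

Lemma ev_trH (T : 'M[S]_m.+1) (U : 'M[R]_m.+1) x : rset V x ->
  (forall i j, ev x (T i j) = U i j) -> ev x (trH HS T) = metric_trace G x U.
Proof.
move=> Vx TU; rewrite (trH_sum GS_sym GSHS) ev_sum; apply: eq_bigr => i _.
rewrite ev_sum; apply: eq_bigr => j _; rewrite evM TU; congr (_ * _).
exact: ev_HSE.
Qed.

Lemma ev_scal x : rset V x -> ev x (trH HS ricS) = scalar_curv G x.
Proof. by move=> Vx; apply: ev_trH => // i j; exact: ev_ric. Qed.

Variables (u : 'rV[R]_m.+1 -> R).
Hypothesis u_smooth : smooth_on (rset V) u.

(** With the value zero outside [V] both sides of [static_ring] vanish there, and the equation holds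
    in the ring. *)
Definition extu x : R := if x \in rset V then u x else 0.

Lemma extu_smooth : smooth_on (rset V) extu.
Proof. by apply: (smooth_congr oV _ u_smooth) => x Vx; rewrite /extu Vx. Qed.

Definition uS : S := mksfun extu_smooth.

Lemma ev_uS x : rset V x -> ev x uS = u x.
Proof. by move=> Vx; rewrite ev_mksfun /extu mem_set. Qed.

Lemma ev_Du i x : rset V x -> ev x (D i uS) = pder i u x.
Proof.
by move=> Vx; rewrite ev_derS_in//; apply: (@pder_eqV _ _ V) => // y Vy; exact: ev_uS.
Qed.

Lemma ev_DDu i j x : rset V x -> ev x (D i (D j uS)) = pder i (pder j u) x.
Proof.
by move=> Vx; rewrite ev_derS_in//; apply: (@pder_eqV _ _ V) => // y Vy; exact: ev_Du.
Qed.

Local Notation hessS := (hessM D GS HS hS uS).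

Lemma ev_hess i j x : rset V x -> ev x (hessS i j) = hessian G u x i j.
Proof.
move=> Vx; rewrite !mxE evB ev_sum ev_DDu//; congr (_ - _).
by apply: eq_bigr => k _; rewrite evM ev_Gam// ev_Du.
Qed.

Lemma ev_lap x : rset V x -> ev x (trH HS hessS) = laplacian G u x.
Proof. by move=> Vx; apply: ev_trH => // i j; exact: ev_hess. Qed.

Lemma ev_out i (F : S) x : ~ rset V x -> ev x (D i F) = 0.
Proof. by move=> Vx; rewrite ev_derS memNset. Qed.

Lemma ev_hess_out i j x : ~ rset V x -> ev x (hessS i j) = 0.
Proof.
move=> Vx; rewrite mxE evB ev_sum ev_out// big1 ?subr0// => k _.
by rewrite evM ev_out// mulr0.
Qed.

Variables (scal : R).
Hypothesis static : forall x, rset V x ->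
  u x *: trace_free G x (ricci G x) = trace_free G x (hessian G u x).
Hypothesis scalE : forall x, rset V x -> scalar_curv G x = scal.
Hypothesis m_gt0 : (0 < m)%N.

Local Notation n := (m.+1%:R : R).
Local Notation LS := (trH HS hessS).
Let phiS : S := cstS V n^-1 * (LS - cstS V scal * uS).

(** The trace parts of the trace-free equation are collected in [phiS], which brings it into the
    form expected by [static_der]. *)
Lemma static_ring : hessS = uS *: ricS + phiS *: GS.
Proof.
have n0 : n != 0 by rewrite pnatr_eq0.
apply/matrixP => i j; apply: sfunP => x; rewrite addmxE !scalemxE evD !evM.
case: (pselect (rset V x)) => Vx; last first.
  rewrite ev_hess_out// ev_mksfun /extu memNset// mul0r add0r ev_mksfun evB evM.
  rewrite [ev x uS]ev_mksfun /extu memNset// mulr0 subr0 (trH_sum GS_sym GSHS) ev_sum big1 ?mulr0 ?mul0r//.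
  by move=> a _; rewrite ev_sum big1// => b _; rewrite evM ev_hess_out// mulr0.
rewrite ev_hess// ev_uS// ev_ric// !ev_mksfun evB evM ev_lap// ev_uS// ev_mksfun.
rewrite [ev x (GS i j)](_ : _ = G x i j); last by rewrite mxE ev_mksfun /extG mem_set.
have /matrixP/(_ i j) := static Vx; rewrite /trace_free !mxE.
rewrite -[metric_trace G x (ricci G x)]/(scalar_curv G x) scalE//.
rewrite -[metric_trace G x (hessian G u x)]/(laplacian G u x).
have alg (P A L s g nn uu : R) : nn != 0 ->
    uu * (A - s / nn * g) = P - L / nn * g -> P = uu * A + nn^-1 * (L - s * uu) * g.
  move=> h e; apply/eqP; rewrite -subr_eq0; apply/eqP; move/eqP: e; rewrite -subr_eq0 => /eqP e.
  by rewrite -[RHS]oppr0 -e; field.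
exact: alg.
Qed.

Lemma scal_ring a : D a (trH HS ricS) = 0.
Proof.
apply: sfunP => x; case: (pselect (rset V x)) => Vx; last by rewrite ev_out// ev0.
rewrite ev_derS_in// ev0 (@pder_eqV _ _ V _ _ (fun=> scal))//; last first.
  by move=> y Vy; rewrite ev_scal// scalE.
by apply: is_pder_val; [exact: (rel_open_half oV Vx)|exact: is_pder_cst].
Qed.

Let q := scal / m%:R.

(** [static_der] equates the derivatives of (L - scal f)/n and of L; hence (n-1) dL = - scal df, and
    [m] is n-1. *)
Lemma lap_ring a : D a LS = - (cstS V q * D a uS).
Proof.
have m0 : m%:R != 0 :> R by rewrite pnatr_eq0 -lt0n.
have n0 : n != 0 by rewrite pnatr_eq0.
have := static_der (@derSD R m V) (@derSM R m V) (@derSC R m V) hS2 GS_sym GSHS a static_ring scal_ring.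
rewrite derSM derS_cst mul0r add0r (derB (@derSD R m V)) derSM derS_cst mul0r add0r => e.
apply: sfunP => x; have := congr1 (ev x) e.
rewrite evM evB evM evN evM.
have alg (l w s nn mm : R) : mm != 0 -> nn != 0 -> nn = mm + 1 ->
    nn^-1 * (l - s * w) = l -> l = - (s / mm * w).
  move=> h1 h2 e1 /(congr1 (fun z => nn * z)); rewrite mulrA divff// mul1r e1 mulrDl mul1r => e2.
  have : mm * l = - (s * w) by apply: (addIr l); rewrite -e2; ring.
  by move=> /(congr1 (fun z => mm^-1 * z)); rewrite mulrA mulVf// mul1r => ->; ring.
by apply: alg => //; rewrite -natr1.
Qed.

Theorem static_laplacian_const x i : rset V x ->
  is_pder i (fun y => laplacian G u y + q * u y) x 0.
Proof.
move=> Vx.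
have E : D i (LS + cstS V q * uS) = 0.
  by rewrite derSD derSM derS_cst mul0r add0r lap_ring addNr.
have := @sfun_is_pder _ _ V i (LS + cstS V q * uS) x Vx; rewrite E ev0.
apply: is_pder_congr; first by rewrite evD evM ev_lap// ev_uS.
apply: filterS (near_rel_open oV Vx) => y Vy.
by rewrite evD evM ev_lap// ev_uS.
Qed.

Definition grad2 x := \sum_i \sum_j metric_inv G x i j * pder i u x * pder j u x.

Local Notation vS := (HS *m om D uS).
Local Notation nS := (pr (om D uS) vS).

Lemma evMn2 x (F : S) : ev x (F *+ 2) = 2 * ev x F.
Proof. by rewrite mulr2n evD; ring. Qed.

Lemma ev_nS x : rset V x -> ev x nS = grad2 x.
Proof.
move=> Vx; rewrite prE ev_sum; apply: eq_bigr => i _.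
rewrite evM mulmx_entry ev_sum mulr_sumr; apply: eq_bigr => j _.
by rewrite evM ev_HSE// !mxE !ev_Du//; ring.
Qed.

Lemma ev_D_norm x a : rset V x ->
  is_pder a grad2 x (2 * \sum_i \sum_j hessian G u x a i * metric_inv G x i j * pder j u x).
Proof.
move=> Vx; have := @sfun_is_pder _ _ V a nS x Vx.
rewrite (D_norm (@derSD R m V) (@derSM R m V) hS2 GS_sym GSHS).
have -> : ev x ((hessS *m vS) a 0 *+ 2) =
    2 * \sum_i \sum_j hessian G u x a i * metric_inv G x i j * pder j u x.
  rewrite evMn2 mulmx_entry ev_sum; congr (_ * _).
  apply: eq_bigr => i _; rewrite evM mulmx_entry ev_sum mulr_sumr.
  by apply: eq_bigr => j _; rewrite evM ev_hess// ev_HSE// [om _ _ _ _]mxE ev_Du// mulrA.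
apply: is_pder_congr; first by rewrite ev_nS.
by apply: filterS (near_rel_open oV Vx) => y Vy; rewrite ev_nS.
Qed.

Lemma grad2_smooth : smooth_on (rset V) grad2.
Proof. by apply: (smooth_congr oV _ (sfun_smooth nS)) => x /set_mem; exact: ev_nS. Qed.

Lemma metric_inv_smooth i j : smooth_on (rset V) (fun x => metric_inv G x i j).
Proof. by apply: (smooth_congr oV _ (sfun_smooth (HS i j))) => x /set_mem; exact: ev_HSE. Qed.

Variables (c3 : R).
(* flux is the 1-form dual to the vector field X, with c3 = 3 k^2; wflux is the
   vector density sqrt (det G) X, whose coordinate divergence is
   sqrt (det G) div X. *)
Definition flux b x := u x * (2^-1 * pder b grad2 x)
  - (grad2 x + q / 2 * (u x * u x) - c3) * pder b u x.
Definition wflux a x := Num.sqrt (\det (G x)) * \sum_b metric_inv G x a b * flux b x.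

Let xiS : 'cV[S]_m.+1 := uS *: (hessS *m vS)
  - (nS + cstS V (q / 2) * (uS * uS) - cstS V c3) *: om D uS.

Lemma ev_xi b x : rset V x -> ev x (xiS b 0) = flux b x.
Proof.
move=> Vx; rewrite /xiS addmxE oppmxE !scalemxE evB !evM evB evD !evM.
rewrite ev_nS// !ev_mksfun /extu mem_set// [om _ _ _ _]mxE ev_Du// /flux; congr (_ * _ - _).
rewrite (is_pder_val (rel_open_half oV Vx) (@ev_D_norm x b Vx)) mulKf// mulmx_entry ev_sum.
apply: eq_bigr => i _; rewrite evM mulmx_entry ev_sum mulr_sumr.
by apply: eq_bigr => j _; rewrite evM ev_hess// ev_HSE// [om _ _ _ _]mxE ev_Du// mulrA.
Qed.

Lemma ev_wflux a x : rset V x -> ev x (wS * (HS *m xiS) a 0) = wflux a x.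
Proof.
move=> Vx; rewrite evM ev_wS ev_dS /extG mem_set//; congr (_ * _).
rewrite mulmx_entry ev_sum; apply: eq_bigr => b _.
by rewrite evM ev_HSE// ev_xi.
Qed.

Lemma wflux_smooth a : smooth_on (rset V) (wflux a).
Proof.
apply: (smooth_congr oV _ (sfun_smooth (wS * (HS *m xiS) a 0))) => x /set_mem Vx.
exact: ev_wflux.
Qed.

Lemma der_wS a : D a wS = wS * \tr (Gm a).
Proof.
have e : D a wS * wS + wS * D a wS = wS * wS * (\tr (Gm a) *+ 2).
  rewrite -derSM wS2 /dS (der_det (@derSD R m V) (@derSM R m V)) -(tr_Gam D hS2 GS_sym GSHS) /HS -/dS.
  by rewrite -scalemxAl mxtraceZ mulrA [dS * _]mulrC iS2 mul1r.
(* [sfun] need not be a domain, so [wS] is cancelled through its explicit inverse. *)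
have w1 : iS * wS = 1 by rewrite /wS mulrCA -iS2 mulrC.
have e2 : wS * D a wS = wS * (wS * \tr (Gm a)).
  rewrite -[LHS](halfK hS2) -[RHS](halfK hS2); congr (_ * _).
  by rewrite {1}[wS * D a wS]mulrC e mulr2n; ring.
by rewrite -[LHS]mul1r -w1 -mulrA e2 [iS * _]mulrA w1 mul1r.
Qed.

Theorem div_wflux x : rset V x -> laplacian G u x = - q * u x -> 0 <= u x ->
  Num.sqrt (\det (G x)) * ((n + 2) * q ^+ 2 / (2 * n) * u x ^+ 3 - c3 * q * u x)
  <= \sum_a pder a (wflux a) x.
Proof.
move=> Vx Lx u0.
have n0 : n != 0 by rewrite pnatr_eq0.
have m0 : m%:R != 0 :> R by rewrite pnatr_eq0 -lt0n.
have -> : \sum_a pder a (wflux a) x = ev x (\sum_a D a (wS * (HS *m xiS) a 0)).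
  rewrite ev_sum; apply: eq_bigr => a _; rewrite ev_derS_in//.
  by apply: (@pder_eqV _ _ V) => // y Vy; rewrite ev_wflux.
have -> : \sum_a D a (wS * (HS *m xiS) a 0) = wS * dv D GS HS hS xiS.
  rewrite -(div_vec (@derSD R m V) (@derSM R m V) hS2 GS_sym GSHS) mulr_sumr.
  by apply: eq_bigr => a _; rewrite derSM der_wS; ring.
rewrite evM ev_wS ev_dS {1}/extG mem_set// ler_wpM2l ?sqrtr_ge0//.
rewrite (dv_X (@derSD R m V) (@derSM R m V) (@derSC R m V) hS2 GS_sym GSHS
  (fun a => derS_cst V a _) (fun a => derS_cst V a _) static_ring).
have -> : pr vS (om D LS) = - (cstS V q * nS).
  have -> : om D LS = (- cstS V q) *: om D uS.
    by apply/colP => a; rewrite scalemxE !mxE lap_ring mulNr.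
  by rewrite prC prZl mulNr.
set Q := trH HS (hessS *m HS *m hessS).
have QE : (laplacian G u x) ^+ 2 / n <= ev x Q.
  have Hs : (hessian G u x)^T = hessian G u x.
    apply/matrixP => i j; rewrite mxE -!ev_hess//; congr (ev x _).
    by have /matrixP/(_ i j) := hessM_sym (@derSC R m V) HS hS GS_sym uS; rewrite mxE.
  have := trace_cauchy (G_sym Vx) Hs (G_pos Vx).
  have E (A B : 'M[S]_m.+1) : map_mx (ev x) (A *m B) = map_mx (ev x) A *m map_mx (ev x) B.
    exact: map_mxM.
  have hE : map_mx (ev x) hessS = hessian G u x.
    by apply/matrixP => i j; rewrite mxE ev_hess.
  have HE : map_mx (ev x) HS = invmx (G x) by rewrite ev_HS /extG mem_set.
  have TE (A : 'M[S]_m.+1) : ev x (trH HS A) = \tr (map_mx (ev x) (HS *m A)).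
    by rewrite /trH /mxtrace ev_sum; apply: eq_bigr => i _; rewrite [RHS]mxE.
  by rewrite -hE -HE -!E -!TE ev_lap.
have evE (U T P c1 c2 c3' L N s : S) :
    ev x (U * T + U * - (c2 * N) - c1 * (L - s * U) * N - (2 : S) * P * U * N - N * L
      - P * (U * U) * L + c3' * L) =
    ev x U * ev x T + ev x U * - (ev x c2 * ev x N)
      - ev x c1 * (ev x L - ev x s * ev x U) * ev x N - 2 * ev x P * ev x U * ev x N
      - ev x N * ev x L - ev x P * (ev x U * ev x U) * ev x L + ev x c3' * ev x L.
  by [].
rewrite evE ev_lap// ev_uS// ev_nS// ![ev x (cstS _ _)]ev_mksfun Lx.
move: QE; rewrite Lx; set N := grad2 x; set U := u x in u0 *; move: (ev x Q) => Qx QE.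
have sE : scal = q * m%:R by rewrite /q divfK.
(* With scal = q (n-1) and Lap f = - q f all terms in |grad f|^2 cancel, which is the purpose of the
   coefficient [q / 2] in [flux]. *)
have -> : U * Qx + U * - (q * N) - n^-1 * (- q * U - scal * U) * N - 2 * (q / 2) * U * N
    - N * (- q * U) - q / 2 * (U * U) * (- q * U) + c3 * (- q * U) =
    U * Qx + q ^+ 2 / 2 * U ^+ 3 - c3 * q * U.
  by rewrite sE -natr1; field; rewrite natr1 n0.
have : U * ((- q * U) ^+ 2 / n) <= U * Qx by rewrite ler_wpM2l.
have -> : U * ((- q * U) ^+ 2 / n) = q ^+ 2 / n * U ^+ 3 by ring.
move=> le1; rewrite lerD2r; have -> : (n + 2) * q ^+ 2 / (2 * n) * U ^+ 3 =
   q ^+ 2 / n * U ^+ 3 + q ^+ 2 / 2 * U ^+ 3 by field.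
by rewrite lerD2r.
Qed.

End LocalComputation.

(** * Lebesgue measure on row vectors and the divergence theorem *)

Section BorelMeasurability.

Definition borelT (T : ptopologicalType) : measurableType (@open T).-sigma :=
  g_sigma_algebraType (@open T).

Lemma open_borel (T : ptopologicalType) (W : set T) :
  open W -> measurable (W : set (borelT T)).
Proof. exact: sub_sigma_algebra. Qed.

Lemma closed_borel (T : ptopologicalType) (W : set T) :
  closed W -> measurable (W : set (borelT T)).
Proof. by move=> cW; rewrite -[W]setCK; apply: measurableC; apply: open_borel; exact: closed_openC. Qed.

Lemma measurable_to_borel d (X : measurableType d) (T : ptopologicalType) (D : set X)
    (f : X -> T) : (forall W, open W -> measurable (D `&` f @^-1` W)) ->
  measurable_fun D (f : X -> borelT T).
Proof.
move=> H; apply: (@measurability _ _ X (borelT T) D f (@open T)) => //.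
by move=> _ [W oW <-]; exact: H.
Qed.

Lemma measurable_to_R (R : realType) d (X : measurableType d) (D : set X)
    (f : X -> R) : (forall W : set R, open W -> measurable (D `&` f @^-1` W)) ->
  measurable_fun D f.
Proof.
move=> H; apply: (measurability _ (RGenOpens.measurableE R)).
by move=> _ [W [x [y ->]] <-]; apply: H; exact: interval_open.
Qed.

Lemma within_preimage (T : ptopologicalType) (U : topologicalType) (D : set T) (f : T -> U)
    (W : set U) : {within D, continuous f} -> open W ->
  exists2 B : set T, open B & D `&` f @^-1` W = D `&` B.
Proof.
move=> /continuousP cf oW; have /open_subspaceP[B oB e] := cf W oW.
by exists B => //; rewrite setIC -e setIC.
Qed.

Lemma within_measurable (R : realType) (T : ptopologicalType) (D : set T) (f : T -> R) :
  measurable (D : set (borelT T)) -> {within D, continuous f} ->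
  measurable_fun (D : set (borelT T)) f.
Proof.
move=> mD cf; apply: measurable_to_R => W oW.
have [B oB ->] := within_preimage cf oW.
by apply: measurableI => //; exact: open_borel.
Qed.

End BorelMeasurability.

Section LebesgueMeasureRn.
Context {R : realType}.
Local Notation bR n := (borelT 'rV[R]_n).

Definition joinv n (p : measurableTypeR R * bR n) : bR n.+1 :=
  row_mx (p.1%:M : 'rV[R]_1) (p.2 : 'rV[R]_n).

Lemma joinvE n (p : R * 'rV[R]_n) (k : 'I_n.+1) :
  (joinv p : 'rV_n.+1) 0 k = if unlift ord0 k is Some j then p.2 0 j else p.1.
Proof.
rewrite /joinv; case: unliftP => [j ->|->].
  have -> : lift ord0 j = rshift 1 j by apply: val_inj.
  by rewrite (@row_mxEr R 1 1 n).
have -> : ord0 = lshift n (0 : 'I_1) by apply: val_inj.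
by rewrite (@row_mxEl R 1 1 n) mxE eqxx mulr1n.
Qed.

Lemma joinv_cont n : continuous (fun p : R * 'rV[R]_n => joinv p : 'rV[R]_n.+1).
Proof.
move=> p P /nbhs_ballP[e /= e0 He].
exists (ball p.1 e, ball p.2 e) => /=; first by split; exact: nbhsx_ballx.
move=> [t v] [/= bt [_ bv]]; apply: He; split => // i k; rewrite ord1 !joinvE.
by case: unliftP => [j _|_] //=.
Qed.

(** An open set is a countable union of products of balls with rational centres and a common
    rational radius. Hence continuity of [joinv] makes it measurable for the product
    sigma-algebra. *)
Lemma open_prod_measurable n (U : set (R * 'rV[R]_n)) : open U ->
  measurable (U : set (measurableTypeR R * bR n)).
Proof.
move=> oU.
pose bx (q : (rat * rat) * 'rV[rat]_n) : set (measurableTypeR R * bR n) :=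
  (ball (ratr q.1.1 : R) (ratr q.1.2)) `*`
  (ball (map_mx ratr q.2 : 'rV[R]_n) (ratr q.1.2)).
have -> : U = \bigcup_(q in [set q | bx q `<=` U]) bx q.
  apply/seteqP; split => [[t v] Utv|p [q /= qU] /qU//].
  have /nbhs_ballP[e /= e0 He] : nbhs (t, v) U by exact: open_nbhs_nbhs.
  (* Two points within [r] of the same centre are at distance less than 2r, hence less than [e]. *)
  have [r /andP[r0 re]] : exists r : rat, (0 < (ratr r : R) < e / 2) .
    have e2 : 0 < e / 2 by rewrite divr_gt0.
    by have [r] := rat_in_itvoo e2; rewrite in_itv /=; exists r.
  have near_rat (s : R) : exists q : rat, `|(ratr q : R) - s| < ratr r.
    have sr : s - ratr r < s + ratr r by lra.
    by have [q] := rat_in_itvoo sr; rewrite in_itv /= => qs; exists q; rewrite ltr_distl.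
  have [q1 q1t] := near_rat t.
  have [q2 q2v] := choice (fun j : 'I_n => near_rat (v 0 j)).
  pose qq : (rat * rat) * 'rV[rat]_n := ((q1, r), \row_j q2 j).
  exists qq => /=; last first.
    split => /=; first by rewrite /ball /=.
    by split => // i j; rewrite ord1 !mxE /ball /=.
  move=> [t' v'] [/= bt [_ bv]]; apply: He; split => /=.
    move: bt; rewrite /ball /= => bt.
    have -> : t - t' = - (ratr q1 - t) + (ratr q1 - t') by ring.
    by rewrite (le_lt_trans (ler_normD _ _))// normrN; lra.
  split=> // i j; rewrite ord1; have := bv 0 j; rewrite !mxE /ball /= => bj.
  have -> : v 0 j - v' 0 j = - (ratr (q2 j) - v 0 j) + (ratr (q2 j) - v' 0 j) by ring.
  by rewrite (le_lt_trans (ler_normD _ _))// normrN; have := q2v j; lra.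
rewrite bigcup_mkcond; apply: countable_bigcupT_measurable => [|q]; first exact: countableP.
case: ifP => // _; apply: measurableX; first by apply: open_measurable; exact: ball_open.
by apply: open_borel; exact: ball_open.
Qed.

Lemma joinv_measurable n : measurable_fun setT (@joinv n).
Proof.
apply: measurable_to_borel => W oW; rewrite setTI; apply: open_prod_measurable.
have /continuousP := @joinv_cont n; exact.
Qed.

Definition splitv n (x : bR n.+1) : measurableTypeR R * bR n :=
  ((x : 'rV_n.+1) 0 ord0, rsubmx (x : 'rV[R]_(1 + n))).

Lemma joinvK n : cancel (@joinv n) (@splitv n).
Proof.
move=> [t v]; rewrite /joinv /splitv; congr pair; last by rewrite row_mxKr.
have -> : ord0 = lshift n (0 : 'I_1) by apply: val_inj.
by rewrite (@row_mxEl R 1 1 n) mxE eqxx mulr1n.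
Qed.

Lemma cont_to_rV (T : topologicalType) n (f : T -> 'rV[R]_n) :
  (forall j, continuous (fun x => f x 0 j)) -> continuous f.
Proof.
move=> cf x P /nbhs_ballP[e /= e0 He].
have : \forall y \near x, forall j, ball (f x 0 j) e (f y 0 j).
  by apply: filter_forall => j; apply: cf; exact: nbhsx_ballx.
by apply: filterS => y H; apply: He; split => // i j; rewrite ord1.
Qed.

Lemma splitv_measurable n : measurable_fun setT (@splitv n).
Proof.
apply/measurable_fun_pairP; split.
  apply: measurable_to_R => W oW; rewrite setTI; apply: open_borel.
  by have /continuousP := @coord_continuous R 1 n.+1 0 ord0; exact.
apply: measurable_to_borel => W oW; rewrite setTI; apply: open_borel.
have cs : continuous (fun x : 'rV[R]_n.+1 => rsubmx (x : 'rV[R]_(1 + n))).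
  apply: cont_to_rV => j; under eq_fun do rewrite mxE.
  exact: (@coord_continuous R 1 n.+1 0 (rshift 1 j)).
by have /continuousP := cs; exact.
Qed.

Definition leb1 : {sigma_finite_measure set (measurableTypeR R) -> \bar R} := @lebesgue_measure R.

Section OneMoreDimension.
Variables (n : nat) (nu : {sigma_finite_measure set (bR n) -> \bar R}).

(** Push-forward of a product measure, so that the theorems of Tonelli and Fubini apply to row
    vectors. *)
Definition lamS (A : set (bR n.+1)) : \bar R :=
  (leb1 \x nu)%E (@joinv n @^-1` A).

Let lamS0 : lamS set0 = 0%E.
Proof. by rewrite /lamS preimage_set0 measure0. Qed.

Let lamS_ge0 A : (0 <= lamS A)%E.
Proof. exact: measure_ge0. Qed.

Let lamS_sigma : semi_sigma_additive lamS.
Proof.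
have mj (A : set (bR n.+1)) : measurable A -> measurable (@joinv n @^-1` A).
  by move=> mA; rewrite -[X in measurable X]setTI; exact: joinv_measurable.
move=> F mF tF mUF; rewrite /lamS preimage_bigcup.
apply: measure_semi_sigma_additive.
- by move=> k; exact: mj.
- apply/trivIsetP => /= i j _ _ ij; rewrite -preimage_setI.
  by move/trivIsetP : tF => /(_ _ _ _ _ ij) ->//; rewrite preimage_set0.
- by rewrite -preimage_bigcup; exact: mj.
Qed.

HB.instance Definition _ := isMeasure.Build _ _ _ lamS lamS0 lamS_ge0 lamS_sigma.

Let lamS_sigma_finite : sigma_finite setT lamS.
Proof.
have /sigma_finiteP[F [TF ndF Foo]] := sigma_finiteT leb1.
have /sigma_finiteP[K [TK ndK Koo]] := sigma_finiteT nu.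
exists (fun k => @splitv n @^-1` (F k `*` K k)).
  apply/seteqP; split => // x _.
  have [i _ Fi] : (\bigcup_i F i) (splitv x).1 by rewrite -TF.
  have [j _ Kj] : (\bigcup_i K i) (splitv x).2 by rewrite -TK.
  exists (maxn i j) => //; split.
    by move: Fi; exact/subsetPset/ndF/leq_maxl.
  by move: Kj; exact/subsetPset/ndK/leq_maxr.
move=> k; have [mF lF] := Foo k; have [mK lK] := Koo k; split.
  by rewrite -[X in measurable X]setTI; apply: splitv_measurable => //; exact: measurableX.
rewrite /lamS -comp_preimage (_ : @splitv n \o @joinv n = id) ?preimage_id//; last first.
  by apply/funext => p /=; rewrite joinvK.
by rewrite product_measure1E// lte_mul_pinfty// ge0_fin_numE.
Qed.

HB.instance Definition _ := Measure_isSigmaFinite.Build _ _ _ lamS lamS_sigma_finite.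

Definition lamSf : {sigma_finite_measure set (bR n.+1) -> \bar R} := lamS.
End OneMoreDimension.

(** Lebesgue measure, splitting off the first coordinate as [lebesgue_int] does and starting from
    the Dirac mass in dimension 0, the counterpart of evaluation at 0. *)
Fixpoint lam n : {sigma_finite_measure set (bR n) -> \bar R} :=
  match n with
  | 0 => \d_(0 : bR 0)
  | n'.+1 => lamSf (lam n')
  end.

Lemma slice_measurable n (t : R) : measurable_fun setT (fun v : bR n => joinv (t, v)).
Proof.
apply: (measurableT_comp (@joinv_measurable n)).
by apply: measurable_fun_pair.
Qed.

Local Open Scope ereal_scope.

Lemma lam_ge0_integral n (F : bR n.+1 -> \bar R) : measurable_fun setT F ->
  (forall x, 0 <= F x) ->
  \int[lam n.+1]_x F x = \int[leb1 \x lam n]_p F (joinv p).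
Proof.
move=> mF F0.
have := @ge0_integral_pushforward _ _ _ _ R _ (@joinv_measurable n) (leb1 \x lam n) setT F.
by rewrite preimage_setT => <-//.
Qed.

Lemma lebesgue_intE n (F : bR n -> \bar R) : measurable_fun setT F -> (forall x, 0 <= F x) ->
  lebesgue_int (F : 'rV[R]_n -> \bar R) = \int[lam n]_x F x.
Proof.
elim: n F => [|n IH] F mF F0.
  by rewrite /= integral_dirac// diracT mul1e.
rewrite lam_ge0_integral// (fubini_tonelli1 (fun p => F (joinv p)))//; last first.
  exact: (measurableT_comp mF (@joinv_measurable n)).
apply: eq_integral => t _; rewrite /fubini_F -(IH (fun v => F (joinv (t, v))))//.
by apply: (measurableT_comp mF); exact: slice_measurable.
Qed.

Lemma lam_integral n (F : bR n.+1 -> \bar R) : (lam n.+1).-integrable setT F ->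
  (leb1 \x lam n).-integrable setT (fun p => F (joinv p)) /\
  \int[lam n.+1]_x F x = \int[leb1 \x lam n]_p F (joinv p).
Proof.
move=> iF; have mF := measurable_int _ iF.
have mFj : measurable_fun setT (fun p => F (joinv p)).
  exact: (measurableT_comp mF (@joinv_measurable n)).
have iFj : (leb1 \x lam n).-integrable setT (fun p => F (joinv p)).
  apply/integrableP; split => //.
  have /integrableP[_] := iF; rewrite lam_ge0_integral//.
  exact: measurableT_comp.
split => //.
have := @integral_pushforward _ _ _ _ R _ (@joinv_measurable n) (leb1 \x lam n) setT F mF.
by rewrite preimage_setT => <-.
Qed.

Definition cbox n (a b : 'rV[R]_n) : set (bR n) :=
  [set x | forall j, (a 0 j <= (x : 'rV_n) 0 j <= b 0 j)%R].

Lemma cbox_joinv n (a b : 'rV[R]_n.+1) :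
  @joinv n @^-1` cbox a b = `[a 0%R ord0, b 0%R ord0]%classic `*`
    cbox (rsubmx (a : 'rV_(1 + n))) (rsubmx (b : 'rV_(1 + n))).
Proof.
have rs (c : 'rV[R]_n.+1) j : (rsubmx (c : 'rV_(1 + n))) 0%R j = c 0%R (lift ord0 j).
  by rewrite mxE; congr (c _ _); apply: val_inj.
apply/seteqP; split => [[t v] H|[t v] [/= Ht Hv]].
  split => /=; first by have := H ord0; rewrite joinvE unlift_none in_itv.
  by move=> j; rewrite !rs; have := H (lift ord0 j); rewrite joinvE liftK.
move=> k /=; rewrite joinvE; case: unliftP => [j ->|->] /=; first by have := Hv j; rewrite !rs.
by move: Ht; rewrite in_itv.
Qed.

Lemma cbox_measurable n (a b : 'rV[R]_n) : measurable (cbox a b).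
Proof.
apply: closed_borel.
have -> : cbox a b = \bigcap_(j in setT) ((fun x : 'rV[R]_n => x 0%R j) @^-1` `[a 0%R j, b 0%R j]%classic).
  apply/seteqP; split => [x H j _|x H j]; first by rewrite /= in_itv /= H.
  by have := H j I; rewrite /= in_itv.
apply: closed_bigI => j _; have /continuous_closedP := @coord_continuous R 1 n ord0 j.
by apply; exact: itv_closed.
Qed.

Lemma lam_cbox n (a b : 'rV[R]_n) : (forall j, a 0 j <= b 0 j)%R ->
  lam n (cbox a b) = (\prod_j (b 0 j - a 0 j)%R)%:E.
Proof.
elim: n a b => [|n IH] a b ab.
  rewrite big_ord0 /= diracE mem_set//; by move=> [].
have rs (c : 'rV[R]_n.+1) j : (rsubmx (c : 'rV_(1 + n))) 0%R j = c 0%R (lift ord0 j).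
  by rewrite mxE; congr (c _ _); apply: val_inj.
rewrite [LHS]/(lamS _ _) /lamS cbox_joinv product_measure1E//; last exact: cbox_measurable.
rewrite IH; last by move=> j; rewrite !rs.
rewrite big_ord_recl /= lebesgue_measure_itv /= lte_fin EFinM.
under [in RHS]eq_bigr do rewrite -!rs.
case: ltP => //= le; rewrite (_ : a 0%R ord0 = b 0%R ord0) ?subrr//.
by apply/eqP; rewrite eq_le ab le.
Qed.

Definition setc n (x : 'rV[R]_n) (j : 'I_n) (t : R) : 'rV[R]_n :=
  \row_k (if k == j then t else x 0%R k).

Definition bsupp n (D : bR n -> R) (L : R) := forall x : 'rV[R]_n,
  (exists j, (L < `|x 0 j|)%R) -> D x = 0%R.

Lemma bsupp_integrable n (D : bR n -> R) (C L : R) : measurable_fun setT D ->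
  (forall x, `|D x| <= C)%R -> bsupp D L -> (lam n).-integrable setT (EFin \o D).
Proof.
move=> mD DC DL.
(* The bound [L] may be negative, hence the absolute values. *)
pose B := cbox (const_mx (- `|L|) : 'rV[R]_n)%R (const_mx `|L| : 'rV[R]_n)%R.
have mB : measurable B by exact: cbox_measurable.
have iC : (lam n).-integrable setT (fun x => (C * \1_B x)%:E).
  apply/integrableP; split; first by apply/measurable_EFinP; apply: measurable_funM => //.
  have -> : (fun x => `|(C * \1_B x)%:E|) = (fun x => (`|C|%:E * (\1_B x)%:E)).
    by apply/funext => x; rewrite -EFinM /= normrM (ger0_norm (_ : 0 <= \1_B x)%R)// indicE ler0n.
  rewrite ge0_integralZl//; last exact/measurable_EFinP.
  have -> : \int[lam n]_x (\1_B x)%:E =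
      (\prod_j ((const_mx `|L| : 'rV[R]_n) 0 j - (const_mx (- `|L|) : 'rV[R]_n) 0 j)%R)%:E.
    rewrite integral_indic// setIT; apply: lam_cbox => j.
    by rewrite !mxE; have := normr_ge0 L; lra.
  by rewrite -EFinM ltry.
apply: le_integrable iC => //; first exact/measurable_EFinP.
move=> x _; rewrite lee_fin indicE.
have [xB|xB] := boolP (x \in B); first by rewrite mulr1 (le_trans (DC x))// ler_norm.
rewrite mulr0 normr0 DL ?normr0//.
move: xB; rewrite notin_setE => /existsNP[j] /negP; rewrite !mxE -ler_norml -ltNge => h.
by exists j; apply: le_lt_trans h; exact: ler_norm.
Qed.

(* Fubini in the j-th variable. *)
Lemma int_line0 n (j : 'I_n) (D : bR n -> R) (C L : R) : measurable_fun setT D ->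
  (forall x, `|D x| <= C)%R -> bsupp D L ->
  (forall x, \int[leb1]_t (D (setc x j t))%:E = 0) -> \int[lam n]_x (D x)%:E = 0.
Proof.
elim: n j D => [[]//|n IH] j D mD DC DL D0.
have iD := bsupp_integrable mD DC DL.
have [iDj ->] := lam_integral iD.
case: (unliftP ord0 j) => [j' jE|jE].
- rewrite -(integral12_prod_meas1 iDj) /fubini_F; apply: integral0_eq => t _ /=.
  apply: (IH j' (fun v => D (joinv (t, v)))) => //.
  + by apply: (measurableT_comp mD); exact: slice_measurable.
  + move=> v [k vk]; apply: DL; exists (lift ord0 k).
    by rewrite joinvE liftK.
  + move=> v; rewrite -[RHS](D0 (joinv (t, v))); apply: eq_integral => s _.
    congr (D _)%:E; apply/rowP => k; rewrite joinvE [RHS]mxE jE.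
    case: (unliftP ord0 k) => [k' ->|->] /=; last by rewrite joinvE unlift_none.
    by rewrite mxE (inj_eq lift_inj) joinvE liftK.
- rewrite -(integral21_prod_meas1 iDj) /fubini_G; apply: integral0_eq => v _ /=.
  rewrite -[RHS](D0 (joinv (0%R, v))); apply: eq_integral => s _.
  congr (D _)%:E; apply/rowP => k; rewrite joinvE [RHS]mxE joinvE jE.
  by case: (unliftP ord0 k) => [k' ->|->] /=; rewrite ?eqxx// eq_sym (negbTE (neq_lift _ _)).
Qed.

End LebesgueMeasureRn.

(** * The divergence theorem on the half-space for compactly supported fields *)

Section HalfSpaceDivergence.
Context {R : realType} {m : nat}.
Local Notation e_ i := (delta_mx 0 i : 'rV[R]_m.+1).
Local Notation half := (@half_space R m).
Local Notation bR n := (borelT 'rV[R]_n).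
Implicit Types (x : 'rV[R]_m.+1) (F G : 'rV[R]_m.+1 -> R).

Lemma setcE n (x : 'rV[R]_n) j t k : setc x j t 0 k = if k == j then t else x 0 k.
Proof. by rewrite mxE. Qed.

Lemma setc_shift x j t h : setc x j t + h *: e_ j = setc x j (t + h).
Proof. by apply/rowP => k; rewrite shiftE !setcE; case: eqP => _; rewrite ?mulr1n ?mulr0n ?addr0. Qed.

Lemma setc_line x j (a b t : R) : (forall s, a <= s -> half (setc x j s)) ->
  setc x j s @[s --> within `[a, b] (nbhs t)] --> hnbhs (setc x j t).
Proof.
move=> hs; apply: cvg_hnbhs.
  move=> k; rewrite setcE; under eq_fun do rewrite setcE.
  case: (k == j); last exact: cvg_cst.
  by move=> P; exact: cvg_within.
by apply: filterS (withinT _ _) => s /=; rewrite in_itv /= => /andP[as_ _]; exact: hs.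
Qed.

Lemma line_FTC F x j (a b : R) : a < b -> (forall s, a <= s -> half (setc x j s)) ->
  (forall s, a <= s -> C1at F (setc x j s)) ->
  (\int[@leb1 R]_(t in `[a, b]) (pder j F (setc x j t))%:E =
   (F (setc x j b) - F (setc x j a))%:E)%E.
Proof.
move=> ab hs CF; rewrite EFinB.
have wc G : (forall s, a <= s -> hcont G (setc x j s)) ->
    {within `[a, b], continuous (fun t => G (setc x j t))}.
  move=> cG; apply/subspace_continuousP => t /=; rewrite in_itv /= => /andP[at_ _].
  exact: (cvg_comp _ _ (@setc_line x j a b t hs) (cG t at_)).
have dF t : a < t -> is_derive t 1 (fun s : R => F (setc x j s)) (pder j F (setc x j t)).
  move=> at_; have [_ /(_ j)[dj _]] := CF t (ltW at_).
  have nh : \forall h \near (0:R)^', half (setc x j t + h *: e_ j).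
    near=> h; rewrite setc_shift; apply: hs.
    have : `|h| < t - a by near: h; apply: dnbhs0_lt; rewrite subr_gt0.
    by rewrite ltr_norml; lra.
  have cl : (fun h : R => h^-1 *: (((fun s : R => F (setc x j s)) \o shift t) (h *: 1)
      - F (setc x j t))) @ (0:R)^' --> pder j F (setc x j t).
    apply: (cvg_eq_near (is_pder_dnbhs nh (pderP dj))); near=> h.
    by rewrite /diff_quot /= setc_shift [h *: 1]mulr1 [t + h]addrC.
  by split; [apply/cvg_ex; exists (pder j F (setc x j t))|exact: cvg_lim cl].
apply: (@continuous_FTC2 _ _ (fun t => F (setc x j t))) => //.
- by apply: wc => s as_; have [_ /(_ j)[]] := CF s as_.
- have /(continuous_within_itvP _ ab)[_ ca cb] : {within `[a, b], continuous (fun t => F (setc x j t))}.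
    by apply: wc => s as_; have [] := CF s as_.
  split => // t; rewrite in_itv /= => /andP[at_ _]; by have [] := dF t at_.
- move=> t; rewrite in_itv /= => /andP[at_ _].
  by rewrite derive1E; have [_ ->] := dF t at_.
Unshelve. all: by end_near. Qed.

Lemma half_closed : closed (half : set 'rV[R]_m.+1).
Proof.
have -> : half = (fun x : 'rV[R]_m.+1 => x 0 ord0) @^-1` [set t | 0 <= t] by [].
have /continuous_closedP := @coord_continuous R 1 m.+1 0 ord0.
by apply; exact: closed_ge.
Qed.

Lemma hcont_measurable G : (forall x, half x -> hcont G x) ->
  measurable_fun setT ((fun x => if x \in half then G x else 0) : bR m.+1 -> R).
Proof.
move=> cG; have mh : measurable (half : set (bR m.+1)) by apply: closed_borel; exact: half_closed.
have wG : {within half, continuous G}.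
  by apply/subspace_continuousP => x hx; exact: cG.
have H := within_measurable mh wG.
have -> : (fun x => if x \in half then G x else 0) = G \_ half.
  by apply/funext => x; rewrite patchE.
by apply: (measurable_restrict _ _ _).1 => //; rewrite setTI.
Qed.

Lemma hcont_bounded G (L : R) : (forall x, half x -> hcont G x) ->
  (forall x, half x -> (exists j, L < `|x 0 j|) -> G x = 0) ->
  exists2 C : R, 0 <= C & forall x, half x -> `|G x| <= C.
Proof.
move=> cG G0.
pose K : set 'rV[R]_m.+1 := [set x : 'rV[R]_m.+1 | forall j, `[(- `|L|)%R, `|L|%R]%classic (x ord0 j)] `&` half.
have cK : compact K.
  apply: compact_closedI; last exact: half_closed.
  by apply: (@rV_compact _ _ (fun=> `[(- `|L|)%R, `|L|%R]%classic)) => j; exact: segment_compact.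
have wG : {within K, continuous G}.
  apply/subspace_continuousP => x [_ hx]; apply: cvg_trans (cG x hx).
  by apply: cvg_app; apply: within_subset => y [].
have /compact_bounded[C [_ HC]] := continuous_compact wG cK.
exists (`|C| + 1); first by rewrite addr_ge0.
move=> x hx; case: (pselect (K x)) => Kx.
  apply: (HC (`|C| + 1)); last by exists x.
  by rewrite (le_lt_trans (ler_norm C))// ltrDl.
rewrite G0 ?normr0 ?addr_ge0//.
have [j jx] : exists j, ~ (`[(- `|L|)%R, `|L|%R]%classic (x ord0 j)).
  by apply/existsNP => H; apply: Kx.
exists j; move: jx => /=; rewrite in_itv /= => /negP; rewrite -ler_norml -ltNge.
by apply: le_lt_trans; exact: ler_norm.
Qed.

Lemma pder_out F x j (L : R) : (forall y : 'rV[R]_m.+1, (exists k, L < `|y 0 k|) -> F y = 0) ->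
  half x -> (exists k, L < `|x 0 k|) -> pder j F x = 0.
Proof.
move=> F0 hx [k kx].
have n0 : {near hnbhs x, F =1 (fun=> 0)}.
  apply/hnbhsP; exists (`|x 0 k| - L); first by rewrite subr_gt0.
  move=> y hy yx; apply: F0; exists k; have := yx k.
  have : `|x 0 k| <= `|y 0 k - x 0 k| + `|y 0 k|.
    by rewrite -[X in `|X| <= _](_ : - (y 0 k - x 0 k) + y 0 k = _) ?(le_trans (ler_normD _ _)) ?normrN//; ring.
  lra.
have [-> _] := pder_congr j hx n0.
exact: is_pder_val (is_pder_cst _ _ _).
Qed.

Variables (F : 'I_m.+1 -> 'rV[R]_m.+1 -> R) (L : R).
Hypothesis CF : forall j x, half x -> C1at (F j) x.
Hypothesis F0 : forall j x, (exists k, L < `|x 0 k|) -> F j x = 0.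

Let D j : bR m.+1 -> R := fun x => if x \in half then pder j (F j) x else 0.

Let D_meas j : measurable_fun setT (D j).
Proof. by apply: hcont_measurable => x hx; have [_ /(_ j)[]] := CF j hx. Qed.

Let D_supp j : bsupp (D j) L.
Proof.
move=> x xL; rewrite /D; case: ifP => // /set_mem hx.
exact: (pder_out j (@F0 j) hx xL).
Qed.

Let D_bnd j : exists C : R, forall x, `|D j x| <= C.
Proof.
have [||C C0 HC] := @hcont_bounded (pder j (F j)) L.
- by move=> x hx; have [_ /(_ j)[]] := CF j hx.
- by move=> x hx; exact: (pder_out j (@F0 j) hx).
by exists C => x; rewrite /D; case: ifP => [/set_mem/HC//|_]; rewrite normr0.
Qed.

Let D_int j : (lam m.+1).-integrable setT (EFin \o D j).
Proof. by have [C HC] := D_bnd j; exact: bsupp_integrable HC (D_supp j). Qed.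

(** A positive coordinate strictly beyond the support, whatever the sign of [L]. *)
Let L1 : R := `|L| + 1.

Let L1_gt : L < L1.
Proof. by rewrite /L1 (le_lt_trans (ler_norm L))// ltrDl. Qed.

Let L1_gt0 : 0 < L1. Proof. by rewrite /L1 ltr_wpDl. Qed.

(** A line in a tangential direction lies in the half-space or misses it. In the first case both
    ends of the integration are outside the support. *)
Let D_tangential j : j != ord0 -> (\int[lam m.+1]_x (D j x)%:E = 0)%E.
Proof.
move=> j0; have [C HC] := D_bnd j.
apply: (@int_line0 _ _ j _ _ _ (D_meas j) HC (D_supp j)) => x.
have hE t : (setc x j t \in half) = (x \in half).
  by apply/idP/idP; rewrite !inE /half_space /= setcE eq_sym (negbTE j0).
case: (boolP (x \in half)) => hx; last first.
  by apply: integral0_eq => t _; rewrite /D hE (negbTE hx).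
have hs s : half (setc x j s) by apply/set_mem; rewrite hE.
transitivity (\int[@leb1 R]_(t in `[(- L1)%R, L1%R]) (pder j (F j) (setc x j t))%:E)%E.
  rewrite [RHS]integral_mkcond; apply: eq_integral => t _; rewrite patchE /D hE hx.
  case: ifPn => //; rewrite notin_setE /= in_itv /= => /negP; rewrite -ler_norml -ltNge => tL.
  rewrite (pder_out j (@F0 j) (hs t))//; exists j.
  by rewrite setcE eqxx (lt_trans L1_gt).
rewrite line_FTC//; last 2 first.
- by rewrite gtrN.
- by move=> s _; exact: CF.
rewrite !F0 ?subrr//; exists j; rewrite setcE eqxx ?normrN gtr0_norm//.
Qed.

(** A normal line enters the half-space at x_0 = 0 and leaves the support at [L1], so only minus the
    boundary value survives. *)
Let D_normal : (\int[lam m.+1]_x (D ord0 x)%:E =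
  - \int[lam m]_v (F ord0 (joinv (0%R, v)))%:E)%E.
Proof.
have [iDj ->] := lam_integral (D_int ord0).
have i1 : (lam m).-integrable setT (fun v => (F ord0 (joinv (0, v)))%:E).
  have [||C C0 HC] := @hcont_bounded (F ord0) L.
  - by move=> x hx; have [] := CF ord0 hx.
  - by move=> x hx; exact: F0.
  have h0 (v : bR m) : half (joinv (0, v)).
    by rewrite /half_space /= joinvE unlift_none.
  apply: (@bsupp_integrable _ _ (fun v => F ord0 (joinv (0, v))) C L).
  - have := hcont_measurable (fun x hx => (CF ord0 hx).1).
    move=> H; have := measurableT_comp H (@slice_measurable R m 0).
    congr (measurable_fun _ _); apply/funext => v /=.
    by rewrite mem_set//; exact: h0.
  - by move=> v; exact: HC.
  - move=> v [k vk]; apply: F0; exists (lift ord0 k).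
    by rewrite joinvE liftK.
rewrite -(integral21_prod_meas1 iDj) /fubini_G -integralN; last first.
  by apply: integrable_add_def.
apply: eq_integral => v _ /=.
pose x : 'rV[R]_m.+1 := joinv (0, v).
have xE t : joinv (t, v) = setc x ord0 t.
  apply/rowP => k; rewrite joinvE setcE joinvE.
  by case: (unliftP ord0 k) => [k' ->|->] /=; rewrite ?eqxx// eq_sym (negbTE (neq_lift _ _)).
have hs s : 0 <= s -> half (setc x ord0 s).
  by rewrite /half_space /= setcE eqxx.
transitivity (\int[@leb1 R]_(t in `[0%R, L1]) (pder ord0 (F ord0) (setc x ord0 t))%:E)%E.
  rewrite [RHS]integral_mkcond; apply: eq_integral => t _; rewrite patchE xE /D.
  case: (leP 0 t) => t0; last first.
    rewrite memNset; last by rewrite /half_space /= setcE eqxx; apply/negP; rewrite -ltNge.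
    by rewrite memNset// /= in_itv /= leNgt t0.
  rewrite (mem_set (hs t t0)); case: ifPn => //.
  rewrite notin_setE /= in_itv /= t0 /= => /negP; rewrite -ltNge => tL.
  rewrite (pder_out ord0 (@F0 ord0) (hs t t0))//; exists ord0.
  by rewrite setcE eqxx ger0_norm// (lt_trans L1_gt).
rewrite line_FTC//; last by move=> s s0; apply: CF; exact: hs.
rewrite F0; last by exists ord0; rewrite setcE eqxx gtr0_norm.
by rewrite sub0r EFinN -xE.
Qed.

(* The integrand k is only bounded above by the divergence, which is all that the
   Cauchy-Schwarz estimate provides. *)
Theorem half_divergence (k : bR m.+1 -> R) :
  (lam m.+1).-integrable setT (EFin \o k) ->
  (forall x, k x <= if x \in half then \sum_j pder j (F j) x else 0) ->
  (\int[lam m.+1]_x (k x)%:E <= - \int[lam m]_v (F ord0 (joinv (0%R, v)))%:E)%E.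
Proof.
move=> ik kD.
have iS : (lam m.+1).-integrable setT (fun x => \sum_(j < m.+1) (D j x)%:E)%E.
  by apply: integrable_sum => // j _; exact: D_int.
apply: (@le_trans _ _ (\int[lam m.+1]_x (\sum_(j < m.+1) (D j x)%:E))%E).
  apply: le_integral => // x _; rewrite sumEFin lee_fin (le_trans (kD x))// /D.
  by case: ifP => // _; rewrite big1.
rewrite integral_sum//.
by rewrite (bigD1 ord0)//= D_normal big1 ?adde0.
Qed.

End HalfSpaceDivergence.

(** * Charts, brackets and partitions of unity *)

Section Minimum.
Context {R : realType} {m : nat}.
Local Notation e_ i := (delta_mx 0 i : 'rV[R]_m.+1).
Local Notation half := (@half_space R m).
Implicit Types (x y : 'rV[R]_m.+1) (F : 'rV[R]_m.+1 -> R).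

Lemma is_pder_right i F x l : half x -> is_pder i F x l -> diff_quot i F x @ (0:R)^'+ --> l.
Proof.
move=> hx dF P /dF; rewrite /steps /= /within /= => -[e e0 He].
exists e => // h he h0; apply: He => //=; first by rewrite gt_eqF.
by apply: half_shift => //; exact: ltW.
Qed.

Lemma pder_min_ge0 i F x l : half x -> is_pder i F x l ->
  (\forall y \near hnbhs x, F x <= F y) -> 0 <= l.
Proof.
move=> hx dF nF; have c := is_pder_right hx dF.
apply: (cvgr_to_ge c).
have : \forall h \near (0:R)^'+, F x <= F (x + h *: e_ i).
  have := near_steps i nF; rewrite /steps /= /within /= => -[e e0 He].
  exists e => // h he h0; apply: He => //=; first by rewrite gt_eqF.
  by apply: half_shift => //; exact: ltW.
move=> H; apply: filterS2 H (nbhs_right_gt 0) => h Fh h0.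
by rewrite /diff_quot mulr_ge0 ?invr_ge0 ?subr_ge0// ltW.
Qed.

(** Where increments of both signs are allowed the left quotients give the opposite inequality. This
    covers interior points and, on the boundary, the tangential directions. *)
Lemma pder_min_eq0 i F x l : half x -> (\forall h \near (0:R)^', half (x + h *: e_ i)) ->
  is_pder i F x l -> (\forall y \near hnbhs x, F x <= F y) -> l = 0.
Proof.
move=> hx hn dF nF; apply/eqP; rewrite eq_le (pder_min_ge0 hx dF nF) andbT.
have c : diff_quot i F x @ (0:R)^'- --> l.
  by apply: cvg_trans (is_pder_dnbhs hn dF); apply: cvg_app => Q [d d0 Hd]; exists d => // h hd h0; apply: Hd => //=; rewrite lt_eqF.
apply: (cvgr_to_le c).
have : \forall h \near (0:R)^', F x <= F (x + h *: e_ i).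
  have := near_steps i nF; rewrite /steps /= /within /= => H.
  by apply: filterS2 hn H => h h1; apply.
move=> -[e e0 H]; exists e => // h he h0; rewrite /diff_quot mulr_le0_ge0//.
  by rewrite invr_le0 ltW.
by rewrite subr_ge0; apply: H => //=; rewrite lt_eqF.
Qed.

Lemma half_interior i x : 0 < x 0 ord0 \/ i != ord0 -> half x ->
  \forall h \near (0:R)^', half (x + h *: e_ i).
Proof.
move=> H hx; case: (eqVneq i ord0) H => [->|i0] H; last first.
  by apply: nearW => h; rewrite /half_space /= shiftE eq_sym (negbTE i0) mulr0n addr0.
case: H => // x0; near=> h; rewrite /half_space /= shiftE eqxx mulr1n.
have : `|h| < x 0 ord0 by near: h; exact: dnbhs0_lt.
by rewrite ltr_norml; lra.
Unshelve. all: by end_near. Qed.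

Lemma rel_open_local (V : set 'rV[R]_m.+1) :
  (forall x, V x -> half x /\ \forall y \near hnbhs x, V y) -> rel_open V.
Proof.
move=> H; exists (interior [set y | half y -> V y]); first exact: open_interior.
apply/seteqP; split=> [x Vx|x [/nbhs_singleton/= Vx hx]]; last exact: Vx.
by have [hx nV] := H x Vx; split.
Qed.

End Minimum.

(** * C^1 functions on the manifold and changes of chart *)

Section Charts.
Context {R : realType} {m : nat} {M : ptopologicalType}.
Variables (A : set (chart R m M)).
Hypothesis HM : manifold_with_boundary A.
Implicit Types (c : chart R m M) (p q : M) (x y : 'rV[R]_m.+1) (a b : M -> R).
Local Notation half := (@half_space R m).

Lemma chartP c : A c -> is_chart c.
Proof. by move=> Ac; exact: (atlas_charts (manifold_atlas HM) Ac). Qed.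

Lemma cmapK c p : A c -> cdom c p -> cinv c (cmap c p) = p.
Proof. by move=> /chartP[_ _ K _ _] cp; apply: K; rewrite inE. Qed.

Lemma cimg_cmap c p : cdom c p -> cimg c (cmap c p).
Proof. by exists p. Qed.

Lemma cinv_dom c x : A c -> cimg c x -> cdom c (cinv c x).
Proof. by move=> Ac [p cp <-]; rewrite cmapK. Qed.

Lemma cinvK c x : A c -> cimg c x -> cmap c (cinv c x) = x.
Proof. by move=> Ac [p cp <-]; rewrite cmapK. Qed.

Lemma cimg_half c x : A c -> cimg c x -> half x.
Proof. by move=> /chartP[_ o _ _ _]; exact: rel_open_half. Qed.

Lemma cimg_near c x : A c -> cimg c x -> \forall y \near hnbhs x, cimg c y.
Proof. by move=> /chartP[_ o _ _ _]; exact: near_rel_open. Qed.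

Lemma cdom_near c p : A c -> cdom c p -> \forall q \near p, cdom c q.
Proof. by move=> /chartP[oc _ _ _ _] cp; exact: open_nbhs_nbhs. Qed.

Lemma cinv_cvg c x : A c -> cimg c x -> cinv c y @[y --> hnbhs x] --> cinv c x.
Proof.
move=> Ac cx; have [_ o _ _ /subspace_continuousP ci] := chartP Ac.
move=> P /(ci x cx) H; have := near_rel_open o cx.
rewrite /nbhs /= /hnbhs /within /= in H * => H'.
apply: (@filterS2 _ (nbhs x) _ _ _ _ _ H H') => y h1 h2 hy; exact: h1 (h2 hy).
Qed.

Lemma cmap_cvg c p : A c -> cdom c p -> cmap c q @[q --> p] --> hnbhs (cmap c p).
Proof.
move=> Ac cp; have [oc _ _ /subspace_continuousP cm _] := chartP Ac.
move=> P HP; have /(cm p cp) H := HP.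
rewrite /= /within /= in H; have H' := cdom_near Ac cp.
apply: (@filterS2 _ (nbhs p) _ _ _ _ _ H H') => q h1 cq; apply: (h1 cq).
exact: (cimg_half Ac (cimg_cmap cq)).
Qed.

Lemma near_cinv (P : set M) c p : A c -> cdom c p -> (\forall q \near p, P q) ->
  \forall y \near hnbhs (cmap c p), P (cinv c y).
Proof. by move=> Ac cp nP; have := cinv_cvg Ac (cimg_cmap cp); rewrite cmapK//; apply. Qed.

Lemma near_cmap (P : set M) c p : A c -> cdom c p ->
  (\forall y \near hnbhs (cmap c p), P (cinv c y)) -> \forall q \near p, P q.
Proof.
move=> Ac cp nP; have := cmap_cvg Ac cp nP; rewrite /= => H.
by apply: (@filterS2 _ (nbhs p) _ _ _ _ _ H (cdom_near Ac cp)) => q /= + cq; rewrite cmapK.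
Qed.

Definition overlap c c' : set 'rV[R]_m.+1 := cmap c @` (cdom c `&` cdom c').

Lemma overlap_open c c' : A c -> A c' -> rel_open (overlap c c').
Proof.
move=> Ac Ac'; apply: rel_open_local => _ [p [cp c'p] <-].
split; first exact: (cimg_half Ac (cimg_cmap cp)).
apply: filterS2 (cimg_near Ac (cimg_cmap cp)) (near_cinv Ac cp (cdom_near Ac' c'p)).
by move=> y cy c'y; exists (cinv c y); [split => //; exact: cinv_dom|exact: cinvK].
Qed.

Lemma transition_C1 c c' p j : A c -> A c' -> cdom c p -> cdom c' p ->
  C1at (fun x => transition c c' x 0 j) (cmap c p).
Proof.
move=> Ac Ac' cp c'p.
have sm := atlas_compatible (manifold_atlas HM) Ac Ac' j.
by apply: (smooth_C1at (overlap_open Ac Ac') sm); exists p.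
Qed.

Definition C1fun_at a p := forall c, A c -> cdom c p -> C1at (a \o cinv c) (cmap c p).
Definition C1fun a := forall p, C1fun_at a p.

(** One chart suffices: in any other chart the function is composed with a transition map, to which
    the C^1 chain rule applies. *)
Lemma C1fun_at_near a c p : A c -> cdom c p ->
  (\forall q \near p, C1at (a \o cinv c) (cmap c q)) -> C1fun_at a p.
Proof.
move=> Ac cp nC c' Ac' c'p.
(* [C1at_chain] wants a map into the half-space everywhere; the default value 0 lies in it. *)
pose Phi y := if y \in overlap c' c then transition c' c y else 0.
have oV := overlap_open Ac' Ac.
have Vp : overlap c' c (cmap c' p) by exists p.
have hx := cimg_half Ac' (cimg_cmap c'p).
have PhiE y : overlap c' c y -> Phi y = cmap c (cinv c' y).
  by move=> Vy; rewrite /Phi mem_set.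
have C : C1at ((a \o cinv c) \o Phi) (cmap c' p).
  apply: C1at_chain => //.
  - move=> y; rewrite /Phi; case: ifP => [/set_mem[q [c'q cq] <-]|_].
      by rewrite /transition /= (cmapK Ac' c'q); exact: (cimg_half Ac (cimg_cmap cq)).
    by rewrite /half_space /= mxE.
  - apply: filterS (near_rel_open oV Vp) => y Vy j.
    have [q [c'q cq] qy] := Vy.
    apply: (@C1at_congr _ _ (fun z => transition c' c z 0 j)); first exact: (rel_open_half oV Vy).
      by apply: filterS (near_rel_open oV Vy) => z Vz; rewrite /Phi mem_set.
    by rewrite -qy; exact: transition_C1.
  - rewrite (PhiE _ Vp) cmapK//.
    apply: filterS2 (near_cinv Ac cp nC) (cimg_near Ac (cimg_cmap cp)) => y + cy.
    by rewrite cinvK.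
apply: (C1at_congr hx _ C); apply: filterS (near_rel_open oV Vp) => y Vy /=.
have [q [c'q cq] qy] := Vy.
by rewrite PhiE// -qy (cmapK Ac' c'q) cmapK.
Qed.

Lemma C1fun_near a c p : C1fun a -> A c -> cdom c p ->
  \forall y \near hnbhs (cmap c p), C1at (a \o cinv c) y.
Proof.
move=> Ca Ac cp; apply: filterS (cimg_near Ac (cimg_cmap cp)) => y cy.
by have := Ca (cinv c y) c Ac (cinv_dom Ac cy); rewrite cinvK.
Qed.

Lemma C1fun_C1at a c x : C1fun a -> A c -> cimg c x -> C1at (a \o cinv c) x.
Proof. by move=> Ca Ac cx; have := Ca (cinv c x) c Ac (cinv_dom Ac cx); rewrite cinvK. Qed.

Lemma chart_at p : exists2 c, A c & cdom c p.
Proof. exact: (atlas_covers (manifold_atlas HM)). Qed.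

Lemma C1fun_cont a : C1fun a -> continuous a.
Proof.
move=> Ca p; have [c Ac cp] := chart_at p.
have [ca _] := Ca p c Ac cp.
have := cvg_comp _ _ (cmap_cvg Ac cp) ca; rewrite /= cmapK// => H.
apply: cvg_trans H; apply: near_eq_cvg; apply: filterS (cdom_near Ac cp) => q cq /=.
by rewrite cmapK.
Qed.

Lemma C1fun_at_cst a (r : R) p : (\forall q \near p, a q = r) -> C1fun_at a p.
Proof.
move=> n c Ac cp; have hx := cimg_half Ac (cimg_cmap cp).
apply: (C1at_congr hx _ (C1at_cst r hx)).
by apply: filterS (near_cinv Ac cp n) => y /= ->.
Qed.

Lemma C1funM a b : C1fun a -> C1fun b -> C1fun (fun p => a p * b p).
Proof.
move=> Ca Cb p c Ac cp; apply: C1atM; first exact: (cimg_half Ac (cimg_cmap cp)).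
  exact: (C1fun_near Ca Ac cp).
exact: (C1fun_near Cb Ac cp).
Qed.

Lemma C1fun_sum (I : Type) (r : seq I) (F : I -> M -> R) : (forall i, C1fun (F i)) ->
  C1fun (fun p => \sum_(i <- r) F i p).
Proof.
move=> CF p c Ac cp; apply: (@C1at_sum _ _ _ r (fun i => F i \o cinv c)).
  exact: (cimg_half Ac (cimg_cmap cp)).
by move=> i; exact: (C1fun_near (CF i) Ac cp).
Qed.

Lemma C1fun_inv a : C1fun a -> (forall p, a p != 0) -> C1fun (fun p => (a p)^-1).
Proof.
move=> Ca a0 p c Ac cp; apply: (@C1at_inv _ _ (a \o cinv c)).
- exact: (cimg_half Ac (cimg_cmap cp)).
- exact: (C1fun_near Ca Ac cp).
- exact: a0.
Qed.

Lemma smooth_C1g a : smooth_function A a -> C1fun a.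
Proof.
move=> sa p c Ac cp; have [_ o _ _ _] := chartP Ac.
exact: (smooth_C1at o (sa c Ac) (cimg_cmap cp)).
Qed.

Lemma chart_const F c p : A c -> cdom c p ->
  (forall y, cimg c y -> hcont F y /\ forall i, is_pder i F y 0) ->
  \forall y \near hnbhs (cmap c p), F y = F (cmap c p).
Proof.
move=> Ac cp H; have /hnbhsP[e e0 He] := cimg_near Ac (cimg_cmap cp).
have hx := cimg_half Ac (cimg_cmap cp).
apply/hnbhsP; exists e => // y hy yx.
have [|z zb /eqP] := path_MVT hx hy (F := F).
  move=> z bz; have cz : cimg c z.
    apply: He; first exact: (between_half hx hy bz).
    by move=> k; apply: le_lt_trans (yx k); exact: between_dist.
  by have [h1 h2] := H z cz; split => // i; exact: is_pder_cvg (h2 i).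
rewrite big1 ?subr_eq0 => [/eqP//|j _].
have bz := zb j; have hz := between_half hx hy bz.
have cz : cimg c (z j).
  by apply: He => // k; apply: le_lt_trans (yx k); exact: between_dist.
by have [_ h] := H _ cz; rewrite (is_pder_val hz (h j)) mulr0.
Qed.

End Charts.

(** * Boundary points in charts and the inner product of gradients *)

Section Bracket.
Context {R : realType} {m : nat} {M : ptopologicalType}.
Variables (A : set (chart R m M)) (g : chart R m M -> 'rV[R]_m.+1 -> 'M[R]_m.+1).
Hypothesis HM : manifold_with_boundary A.
Hypothesis Hg : riemannian_metric A g.
Implicit Types (c : chart R m M) (p q : M) (x y : 'rV[R]_m.+1) (a b : M -> R).
Local Notation half := (@half_space R m).

Lemma metric_det_gt0 c x : A c -> cimg c x -> 0 < \det (g c x).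
Proof.
by move=> Ac cx; apply: posdef_det; [exact: (metric_sym Hg)|exact: (metric_pos Hg)].
Qed.

(** The transformation law expresses the positive determinant of one metric matrix as a product
    containing that of the jacobian. *)
Lemma transition_unit c c' p : A c -> A c' -> cdom c p -> cdom c' p ->
  jacobian_mx (transition c c') (cmap c p) \in unitmx.
Proof.
move=> Ac Ac' cp c'p; rewrite unitmxE unitfE; apply: contraTneq isT => J0.
have := metric_det_gt0 Ac (cimg_cmap cp); rewrite (metric_change Hg Ac Ac' cp c'p).
by rewrite !det_mulmx J0 !mul0r ltxx.
Qed.

(* If x_0 were positive in c, the 0-th component of the transition map to a
   boundary chart would have an interior minimum, and its jacobian a zero column. *)
Lemma bdry_coord c p : A c -> cdom c p -> bdry A p -> cmap c p 0 ord0 = 0.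
Proof.
move=> Ac cp [c' [Ac' c'p x0]]; apply/eqP.
have hx : half (cmap c p) := cimg_half HM Ac (cimg_cmap cp).
rewrite eq_le [X in _ && X]hx andbT leNgt; apply/negP => xp.
have := transition_unit Ac Ac' cp c'p; rewrite unitmxE unitfE => /negP; apply.
have J0 i : jacobian_mx (transition c c') (cmap c p) i ord0 = 0.
  rewrite mxE; have d := C1at_is_pder (i := i) (transition_C1 HM ord0 Ac Ac' cp c'p).
  apply: (pder_min_eq0 hx (half_interior (or_introl xp) hx) d).
  have Vp : overlap c c' (cmap c p) by exists p.
  apply: filterS (near_rel_open (overlap_open HM Ac Ac') Vp) => _ [q [cq c'q] <-].
  rewrite /transition /= (cmapK HM Ac cp) (cmapK HM Ac cq) x0.
  exact: (cimg_half HM Ac' (cimg_cmap c'q)).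
by apply/eqP; rewrite (expand_det_col _ ord0) big1// => i _; rewrite J0 mul0r.
Qed.

(** The inner product of grad a and grad b, computed in the chart [c]. *)
Definition cbracket c a b x := \sum_i \sum_j
  metric_inv (g c) x i j * pder i (a \o cinv c) x * pder j (b \o cinv c) x.

Definition grd c a x : 'cV[R]_m.+1 := \col_i pder i (a \o cinv c) x.

Lemma cbracketE c a b x : cbracket c a b x = ((grd c a x)^T *m metric_inv (g c) x *m grd c b x) 0 0.
Proof.
rewrite mxE /cbracket exchange_big; apply: eq_bigr => j _; rewrite mxE mulr_suml.
by apply: eq_bigr => i _; rewrite !mxE; ring.
Qed.

Lemma grd_change c c' p a : C1fun A a -> A c -> A c' -> cdom c p -> cdom c' p ->
  grd c a (cmap c p) = jacobian_mx (transition c c') (cmap c p) *m grd c' a (cmap c' p).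
Proof.
move=> Ca Ac Ac' cp c'p; apply/colP => i; rewrite [LHS]mxE [RHS]mxE.
have hx : half (cmap c p) := cimg_half HM Ac (cimg_cmap cp).
have Vp : overlap c c' (cmap c p) by exists p.
have nV := near_rel_open (overlap_open HM Ac Ac') Vp.
have tp : transition c c' (cmap c p) = cmap c' p by rewrite /transition /= (cmapK HM).
have d : is_pder i ((a \o cinv c') \o transition c c') (cmap c p)
    (\sum_j pder i (fun y => transition c c' y 0 j) (cmap c p) *
        pder j (a \o cinv c') (transition c c' (cmap c p))).
  apply: is_pder_chain.
  - by rewrite tp; exact: (cimg_half HM Ac' (cimg_cmap c'p)).
  - apply: filterS nV => _ [q [cq c'q] <-]; rewrite /transition /= (cmapK HM Ac cq).
    exact: (cimg_half HM Ac' (cimg_cmap c'q)).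
  - by move=> j; exact: C1at_is_pder (transition_C1 HM j Ac Ac' cp c'p).
  - rewrite tp; apply: filterS (C1fun_near HM Ca Ac' c'p) => y [h1 h2].
    by split => // k; have [] := h2 k.
  - by rewrite tp => k; have [_ /(_ k)[]] := Ca p c' Ac' c'p.
have nE : {near hnbhs (cmap c p), a \o cinv c =1 (a \o cinv c') \o transition c c'}.
  apply: filterS nV => _ [q [cq c'q] <-] /=.
  by rewrite /transition /= (cmapK HM Ac cq) (cmapK HM Ac' c'q).
have [-> _] := pder_congr i hx nE.
rewrite (is_pder_val hx d) tp; apply: eq_bigr => j _; by rewrite !mxE.
Qed.

(** Gradients transform by J and the inverse metric by the inverses of J^T and J, so the jacobians
    cancel. *)
Lemma cbracket_indep c c' p a b : C1fun A a -> C1fun A b -> A c -> A c' -> cdom c p -> cdom c' p ->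
  cbracket c a b (cmap c p) = cbracket c' a b (cmap c' p).
Proof.
move=> Ca Cb Ac Ac' cp c'p; rewrite !cbracketE (grd_change Ca Ac Ac' cp c'p) (grd_change Cb Ac Ac' cp c'p).
have uJ := transition_unit Ac Ac' cp c'p.
have uG : g c' (cmap c' p) \in unitmx.
  by rewrite unitmxE unitfE gt_eqF// metric_det_gt0//; exact: cimg_cmap.
set J := jacobian_mx _ _ in uJ *; set G' := g c' _ in uG *.
have uJt : J^T \in unitmx by rewrite unitmx_tr.
have E : metric_inv (g c) (cmap c p) = invmx J^T *m metric_inv (g c') (cmap c' p) *m invmx J.
  rewrite /metric_inv (metric_change Hg Ac Ac' cp c'p) -/J -/G'.
  have uU : J *m G' *m J^T \in unitmx by rewrite !unitmx_mul uJ uG.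
  have K : (J *m G' *m J^T) *m (invmx J^T *m invmx G' *m invmx J) = 1%:M.
    by rewrite -!mulmxA (mulKVmx uJt) (mulKVmx uG) mulmxV.
  by rewrite -[LHS]mulmx1 -K mulKmx.
apply: (congr1 (fun X : 'M[R]_(1, 1) => X 0 0)).
rewrite E trmx_mul -!mulmxA (mulmxA J^T) (mulmxV uJt) mul1mx.
by rewrite (mulmxA (invmx J)) (mulVmx uJ) mul1mx.
Qed.

End Bracket.

(** * Integrals against a measure given by a density in coordinates *)

Section Transfer.
Import HBNNSimple.
Context d d' (X : measurableType d) (Y : measurableType d') (R : realType).
Variables (mu : {measure set X -> \bar R}) (nu : {measure set Y -> \bar R}).
Variables (D : set X) (th : Y -> X) (w : Y -> R).
Hypothesis mth : measurable_fun setT th.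
Hypothesis mw : measurable_fun setT w.
Hypothesis w0 : forall y, 0 <= w y.
Hypothesis muE : forall B, measurable B -> B `<=` D ->
  mu B = (\int[nu]_(y in th @^-1` B) (w y)%:E)%E.
Local Open Scope ereal_scope.

(** [muE] is the case of indicators; simple functions and monotone convergence do the rest. *)
Lemma ge0_transfer (h : X -> \bar R) : measurable_fun setT h -> (forall x, 0 <= h x) ->
  (forall x, ~ D x -> h x = 0) -> \int[mu]_x h x = \int[nu]_y (h (th y) * (w y)%:E).
Proof.
move=> mh h0 hD.
pose f_ := nnsfun_approx measurableT mh.
have f_cvg (x : X) : (fun n : nat => (f_ n x)%:E) @ \oo --> h x by exact: cvg_nnsfun_approx.
have mfth n : measurable_fun setT (fun y => (f_ n (th y))%:E).
  by apply/measurable_EFinP; apply: (measurableT_comp _ mth).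
have mwE : measurable_fun setT (fun y => (w y)%:E) by exact/measurable_EFinP.
have -> : \int[mu]_x h x = limn (fun n => \int[mu]_x (f_ n x)%:E).
  rewrite -monotone_convergence//.
  - by apply: eq_integral => x _; apply/esym/cvg_lim => //; exact: f_cvg.
  - by move=> n; exact/measurable_EFinP.
  - by move=> n x _; rewrite lee_fin.
  - by move=> x _ a b ab; rewrite lee_fin; exact/lefP/nd_nnsfun_approx.
have -> : \int[nu]_y (h (th y) * (w y)%:E) =
    limn (fun n => \int[nu]_y ((f_ n (th y))%:E * (w y)%:E)).
  rewrite -monotone_convergence//.
  - apply: eq_integral => y _; apply/esym/cvg_lim => //.
    by apply: cvgeZr => //; exact: f_cvg.
  - by move=> n; exact: emeasurable_funM.
  - by move=> n y _; rewrite mule_ge0// lee_fin.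
  - move=> y _ a b ab; rewrite lee_wpmul2r ?lee_fin//; exact/lefP/nd_nnsfun_approx.
suff E n : \int[mu]_x (f_ n x)%:E = \int[nu]_y ((f_ n (th y))%:E * (w y)%:E).
  by congr (limn _); apply/funext.
(* The approximations lie below [h] and vanish outside [D]; so their nonzero level sets are
   contained in [D], where [muE] applies. *)
have fD (x : X) : ~ D x -> f_ n x = 0%R.
  move=> Dx; apply/eqP; rewrite eq_le fun_ge0 andbT.
  have : (f_ n x)%:E <= h x.
    rewrite -(cvg_lim _ (f_cvg x))//; apply: lime_ge; first by apply/cvg_ex; exists (h x).
    near=> k; rewrite lee_fin; have nk : (n <= k)%N by near: k; exact: nbhs_infty_ge.
    exact/lefP/nd_nnsfun_approx.
  by rewrite (hD _ Dx) lee_fin.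
have mp r : measurable (th @^-1` (f_ n @^-1` [set r])).
  by rewrite -[X in measurable X]setTI; exact: mth.
have Eth y : ((f_ n (th y))%:E * (w y)%:E) =
    \sum_(r \in range (f_ n)) ((r * \1_(f_ n @^-1` [set r]) (th y))%:E * (w y)%:E).
  rewrite -ge0_mule_fsuml => [|r]; last exact: nnfun_muleindic_ge0.
  by rewrite fsumEFin// -fimfunE.
under [RHS]eq_integral do rewrite Eth.
rewrite ge0_integral_fsum//; last 2 first.
- move=> r; apply: emeasurable_funM => //; apply/measurable_EFinP.
  by apply: measurable_funM => //; exact: (measurableT_comp _ mth).
- by move=> r y _; apply: mule_ge0; [exact: nnfun_muleindic_ge0|rewrite lee_fin].
under [LHS]eq_integral do rewrite fimfunE -fsumEFin//.
rewrite ge0_integral_fsum//; last 2 first.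
- by move=> r; apply/measurable_EFinP; exact: measurable_funM.
- by move=> r x _; exact: nnfun_muleindic_ge0.
apply: eq_fsbigr => r _.
have [->|r0] := eqVneq r 0%R.
  rewrite !integral0_eq// => x _; rewrite mul0r ?mul0e//.
under eq_integral do rewrite EFinM.
rewrite integralZl_indic_nnsfun// integral_indic// setIT.
rewrite muE//; last first.
  by move=> x /= fx; apply: contrapT => /fD; rewrite fx; exact/eqP.
rewrite integral_mkcond.
case: (ltP r 0%R) => rlt; last first.
  rewrite -ge0_integralZl//.
  - apply: eq_integral => y _; rewrite EFinM -muleA; congr (_ * _).
    rewrite patchE indicE.
    have -> : (th y \in f_ n @^-1` [set r]) = (y \in th @^-1` (f_ n @^-1` [set r])).
      by apply/idP/idP; rewrite !inE.
    by case: ifP => _; rewrite ?mul1e ?mul0e.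
  - by apply/(measurable_restrict _ _ _).1 => //; rewrite setTI; exact: measurable_funTS.
  - by move=> y _; rewrite patchE; case: ifP; rewrite ?lee_fin.
have e0 : f_ n @^-1` [set r] = set0 by exact: preimage_nnfun0.
rewrite e0 preimage_set0 !integral0_eq ?mule0// => y _.
  by rewrite indicE in_set0 mulr0 mul0e.
by rewrite patchE in_set0.
Unshelve. all: by end_near. Qed.

Lemma transfer (h : X -> R) : measurable_fun setT h -> (forall x, ~ D x -> h x = 0%R) ->
  \int[mu]_x (h x)%:E = \int[nu]_y (h (th y) * w y)%:E.
Proof.
move=> mh hD; have mhE : measurable_fun setT (EFin \o h) by exact/measurable_EFinP.
rewrite integralE [RHS]integralE; congr (_ - _).
- rewrite ge0_transfer//; last 2 first.
  + exact: measurable_funepos.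
  + by move=> x /hD h0; rewrite unlock /= h0 maxxx.
  apply: eq_integral => y _; rewrite unlock -!EFin_max -EFinM; congr EFin.
  by rewrite maxr_pMl ?mul0r.
- rewrite ge0_transfer//; last 2 first.
  + exact: measurable_funeneg.
  + by move=> x /hD h0; rewrite unlock /= h0 oppr0 maxxx.
  apply: eq_integral => y _; rewrite unlock -!EFinN -!EFin_max -EFinM; congr EFin.
  by rewrite maxr_pMl// mul0r mulNr.
Qed.

Lemma transfer_integrable (h : X -> R) : measurable_fun setT h -> (forall x, ~ D x -> h x = 0%R) ->
  nu.-integrable setT (fun y => (h (th y) * w y)%:E) -> mu.-integrable setT (EFin \o h).
Proof.
move=> mh hD /integrableP[_ fin]; apply/integrableP; split; first exact/measurable_EFinP.
rewrite ge0_transfer//.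
- move: fin; congr (_ < _); apply: eq_integral => y _ /=.
  by rewrite normrM (ger0_norm (w0 y)) EFinM.
- by apply: measurableT_comp => //; exact/measurable_EFinP.
- by move=> x /hD h0 /=; rewrite h0 normr0.
Qed.

End Transfer.

(** * The volume and boundary measures in a chart *)

Section ChartMeasure.
Context {R : realType} {m : nat} {M : ptopologicalType}.
Variables (A : set (chart R m M)) (g : chart R m M -> 'rV[R]_m.+1 -> 'M[R]_m.+1).
Hypothesis HM : manifold_with_boundary A.
Hypothesis Hg : riemannian_metric A g.
Local Notation half := (@half_space R m).
Local Notation bR n := (borelT 'rV[R]_n).
Variables (c : chart R m M) (Ac : A c).
Implicit Types (x y : 'rV[R]_m.+1) (F : 'rV[R]_m.+1 -> R).

Definition ccont F := forall x, cimg c x -> hcont F x.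

Lemma hcont_prod (I : Type) (r : seq I) (F : I -> 'rV[R]_m.+1 -> R) x :
  (forall k, hcont (F k) x) -> hcont (fun y => \prod_(k <- r) F k y) x.
Proof.
move=> cF; elim: r => [|k r IH].
  by under eq_fun do rewrite big_nil; exact: hcont_cst.
by under eq_fun do rewrite big_cons; exact: (hcontM (cF k) IH).
Qed.

Lemma hcont_det n (B : 'rV[R]_m.+1 -> 'M[R]_n) x : (forall i j, hcont (fun y => B y i j) x) ->
  hcont (fun y => \det (B y)) x.
Proof.
move=> cB; apply: hcont_sum => s; apply: hcontM; first exact: hcont_cst.
by apply: hcont_prod => k; exact: cB.
Qed.

Lemma metric_ccont i j : ccont (fun y => g c y i j).
Proof.
move=> x cx; have [_ o _ _ _] := chartP HM Ac.
by have [] := smooth_C1at o (metric_smooth Hg Ac i j) cx.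
Qed.

Lemma sqrt_ccont F : ccont F -> ccont (fun y => Num.sqrt (F y)).
Proof. by move=> cF x cx; exact: (hcont_comp (cF x cx) (@sqrt_continuous R _)). Qed.

Lemma cimg_meas : measurable (cimg c : set (bR m.+1)).
Proof.
have [_ [W oW ->] _ _ _] := chartP HM Ac.
by apply: measurableI; [exact: open_borel|apply: closed_borel; exact: half_closed].
Qed.

(* Junk value: the distinguished point of M outside the image of c. *)
Definition cpoint : bR m.+1 -> borelT M := fun y => if y \in cimg c then cinv c y else point.

Lemma cpoint_meas : measurable_fun setT cpoint.
Proof.
apply: measurable_to_borel => W oW; rewrite setTI.
have [_ _ _ _ ci] := chartP HM Ac.
have [B oB eB] := within_preimage ci oW.
have -> : cpoint @^-1` W = (cimg c `&` B) `|` (~` cimg c `&` [set y | W point]).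
  rewrite -eB; apply/seteqP; split => y /=.
    rewrite /cpoint; case: ifPn => [/set_mem cy Wy|]; first by left.
    by rewrite notin_setE => cy Wp; right.
  by case=> -[cy Wy]; rewrite /cpoint ?(mem_set cy)// memNset.
apply: measurableU; apply: measurableI; first exact: cimg_meas.
- exact: open_borel.
- by apply: measurableC; exact: cimg_meas.
- case: (pselect (W point)) => Wp.
    by rewrite (_ : [set _ | _] = setT)//; apply/seteqP; split.
  by rewrite (_ : [set _ | _] = set0)//; apply/seteqP; split.
Qed.

(** Extension by zero outside the chart image, where [cinv] carries no information. *)
Definition cut F : bR m.+1 -> R := fun y => if y \in cimg c then F y else 0.

Lemma cut_meas F : ccont F -> measurable_fun setT (cut F).
Proof.
move=> cF; have [_ o _ _ _] := chartP HM Ac.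
have H := within_measurable cimg_meas ((within_hcont F o).2 cF).
have -> : cut F = F \_ (cimg c) by apply/funext => y; rewrite patchE.
by apply: (measurable_restrict _ _ _).1 => //; [exact: cimg_meas|rewrite setTI].
Qed.

Lemma cut_ge0 F : (forall y, 0 <= F y) -> forall y, 0 <= cut F y.
Proof. by move=> F0 y; rewrite /cut; case: ifP. Qed.

Lemma cut_image F (B : set M) x : B `<=` cdom c ->
  ((\1_(cmap c @` B) x * F x)%:E = ((fun y => (cut F y)%:E) \_ (cpoint @^-1` B)) x)%E.
Proof.
move=> Bc; rewrite patchE indicE.
case: (boolP (x \in cmap c @` B)) => [/set_mem[p Bp <-]|].
  have cp := Bc _ Bp; have cx : cimg c (cmap c p) by exact: cimg_cmap.
  rewrite mem_set; last by rewrite /= /cpoint (mem_set cx) (cmapK HM).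
  by rewrite mul1r /cut (mem_set cx).
rewrite notin_setE => nB; rewrite mul0r; case: ifPn => // /set_mem /=.
rewrite /cpoint /cut; case: ifPn => // /set_mem cx Bx; exfalso; apply: nB.
by exists (cinv c x) => //; exact: (cinvK HM).
Qed.

Lemma cpoint_preimage_meas (B : set (borelT M)) : measurable B -> measurable (cpoint @^-1` B).
Proof. by move=> mB; rewrite -[X in measurable X]setTI; exact: cpoint_meas. Qed.

Lemma volume_chart (mu : {measure set (@borel M) -> \bar R}) (B : set (borelT M)) :
  is_volume A g mu -> measurable B -> B `<=` cdom c ->
  mu B = (\int[lam m.+1]_(y in cpoint @^-1` B) (cut (fun z => Num.sqrt (\det (g c z))) y)%:E)%E.
Proof.
move=> vol mB Bc; rewrite (vol c B Ac mB Bc) [RHS]integral_mkcond.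
set F := fun z => Num.sqrt _.
have mp : measurable_fun setT ((fun y => (cut F y)%:E) \_ (cpoint @^-1` B)).
  apply: (measurable_restrict _ _ _).1 => //; first exact: cpoint_preimage_meas.
  rewrite setTI; apply: measurable_funTS; apply/measurable_EFinP; apply: cut_meas.
  by apply: sqrt_ccont => x cx; apply: hcont_det => i j; exact: metric_ccont.
rewrite -lebesgue_intE//; last first.
  by move=> y; rewrite patchE; case: ifP => // _; rewrite lee_fin cut_ge0// => z; exact: sqrtr_ge0.
by congr lebesgue_int; apply/funext => x; exact: (@cut_image F B x Bc).
Qed.

Lemma joinv0 (v : 'rV[R]_m) : row_mx (0 : 'rV[R]_1) v = joinv (0, v) :> 'rV[R]_m.+1.
Proof. by rewrite /joinv /= raddf0. Qed.

Definition bpoint : bR m -> borelT M := fun v => cpoint (joinv (0, v)).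
Definition bweight : bR m -> R := fun v =>
  cut (fun z => Num.sqrt (\det (row' ord0 (col' ord0 (g c z))))) (joinv (0, v)).

Lemma bpoint_meas : measurable_fun setT bpoint.
Proof. exact: (measurableT_comp cpoint_meas (@slice_measurable R m 0)). Qed.

Lemma bweight_meas : measurable_fun setT bweight.
Proof.
have H : ccont (fun z => Num.sqrt (\det (row' ord0 (col' ord0 (g c z))))).
  apply: sqrt_ccont => x cx; apply: hcont_det => i j.
  by under eq_fun do rewrite !mxE; exact: metric_ccont.
exact: (measurableT_comp (cut_meas H) (@slice_measurable R m 0)).
Qed.

Lemma bweight_ge0 v : 0 <= bweight v.
Proof. by apply: cut_ge0 => z; exact: sqrtr_ge0. Qed.

Lemma boundary_chart (sigma : {measure set (@borel M) -> \bar R}) (B : set (borelT M)) :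
  is_boundary_volume A g sigma -> measurable B -> B `<=` cdom c ->
  sigma B = (\int[lam m]_(v in bpoint @^-1` B) (bweight v)%:E)%E.
Proof.
move=> vol mB Bc; rewrite (vol c B Ac mB Bc) [RHS]integral_mkcond.
have mp : measurable_fun setT ((fun v : bR m => (bweight v)%:E) \_ (bpoint @^-1` B)).
  apply: (measurable_restrict _ _ _).1 => //.
    by rewrite -[X in measurable X]setTI; exact: bpoint_meas.
  by rewrite setTI; apply: measurable_funTS; apply/measurable_EFinP; exact: bweight_meas.
rewrite -lebesgue_intE//; last first.
  by move=> y; rewrite patchE; case: ifP => // _; rewrite lee_fin bweight_ge0.
congr lebesgue_int; apply/funext => v.
rewrite (joinv0 v); apply: (etrans (@cut_image (fun z => Num.sqrt (\det (row' ord0 (col' ord0 (g c z))))) B (joinv (0, v)) Bc)).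
by rewrite !patchE.
Qed.

End ChartMeasure.

(** * Cut-off functions and partitions of unity *)

Section Bump.
Context {R : realType} {m : nat}.
Local Notation half := (@half_space R m).
Implicit Types (x y : 'rV[R]_m.+1) (F : 'rV[R]_m.+1 -> R).

(* A C^1 cut-off is enough: the weights are differentiated only once. *)
Definition sqpos (t : R) : R := Num.max 0 t ^+ 2.

(** A quadratic remainder, uniform in [t], which gives differentiability at the junction point 0
    like anywhere else. *)
Lemma sqpos_quot (t h : R) :
  `|sqpos (h + t) - sqpos t - h * (2 * Num.max 0 t)| <= h ^+ 2.
Proof.
rewrite /sqpos ger0_norm; last first.
  by case: (leP 0 t) => t0; case: (leP 0 (h + t)) => ht; nra.
by case: (leP 0 t) => t0; case: (leP 0 (h + t)) => ht; nra.
Qed.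

Lemma is_derive_sqpos (t : R) : is_derive t 1 sqpos (2 * Num.max 0 t).
Proof.
have cl : (fun h : R => h^-1 *: ((sqpos \o shift t) (h *: 1) - sqpos t)) @ (0:R)^'
    --> 2 * Num.max 0 t.
  apply/cvgrPdist_le => e e0; near=> h.
  have h0 : h != 0 by near: h; exact: nbhs_dnbhs_neq.
  rewrite /= [h *: 1]mulr1 -normrN opprB [_ *: _]/(_ * _).
  have -> : h^-1 * (sqpos (h + t) - sqpos t) - 2 * Num.max 0 t =
      h^-1 * (sqpos (h + t) - sqpos t - h * (2 * Num.max 0 t)) by field.
  rewrite normrM normfV ler_pdivrMl ?normr_gt0//.
  apply: le_trans (sqpos_quot t h) _; rewrite -real_normK ?num_real// expr2.
  by apply: ler_wpM2l => //; near: h; apply: dnbhs0_le.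
by split; [apply/cvg_ex; exists (2 * Num.max 0 t)|exact: cvg_lim cl].
Unshelve. all: by end_near. Qed.

Lemma sqpos_cont : continuous (fun t : R => 2 * Num.max 0 t).
Proof.
move=> t; apply: cvgM; first exact: cvg_cst.
by apply: (continuous_max (f := fun=> 0) (g := id)); [exact: cvg_cst|exact: cvg_id].
Qed.

Lemma C1at_prod (I : Type) (r : seq I) (F : I -> 'rV[R]_m.+1 -> R) x : half x ->
  (forall a, \forall y \near hnbhs x, C1at (F a) y) -> C1at (fun y => \prod_(a <- r) F a y) x.
Proof.
move=> hx nF.
suff: \forall y \near hnbhs x, half y -> C1at (fun y => \prod_(a <- r) F a y) y.
  by move=> H; exact: (near_hnbhs_self hx H hx).
elim: r => [|a r IH].
  by apply: nearW => y hy; under eq_fun do rewrite big_nil; exact: C1at_cst.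
apply: filterS2 (near_hnbhs_near (nF a)) (near_hnbhs_near IH) => y n1 n2 hy.
under eq_fun do rewrite big_cons; apply: C1atM => //.
by apply: filterS2 (near_half y) n2 => z hz H; exact: H.
Qed.

Lemma C1at_coord k x : half x -> C1at (fun y => y 0 k) x.
Proof.
move=> hx; apply: (@C1at_build _ _ _ _ (fun i _ => (k == i)%:R)) => //.
- by apply: nearW => y _ i; exact: is_pder_coord.
- exact: hcont_coord.
- by move=> i; exact: hcont_cst.
Qed.

Definition cell (x0 : 'rV[R]_m.+1) (e : R) : set 'rV[R]_m.+1 :=
  [set y | half y /\ forall k, `|y 0 k - x0 0 k| <= e].

Lemma cell_compact x0 e : compact (cell x0 e).
Proof.
pose K : set 'rV[R]_m.+1 :=
  [set x : 'rV[R]_m.+1 | forall j, `[(x0 0 j - e)%R, (x0 0 j + e)%R]%classic (x ord0 j)] `&` half.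
have -> : cell x0 e = K.
  apply/seteqP; split => x [h1 h2]; split => // k.
    by have := h2 k; rewrite /= in_itv /= ler_norml; lra.
  by have := h1 k; rewrite /= in_itv /= ler_norml; lra.
apply: compact_closedI; last exact: half_closed.
by apply: (@rV_compact _ _ (fun j => `[(x0 0 j - e)%R, (x0 0 j + e)%R]%classic)) => j; exact: segment_compact.
Qed.

Lemma cell_bounded x0 e : exists L : R, forall x, cell x0 e x -> forall k, `|x 0 k| <= L.
Proof.
exists (\sum_k `|x0 0 k| + e) => x [_ xe] k; have xk := xe k.
have -> : x 0 k = x0 0 k + (x 0 k - x0 0 k) by ring.
have : `|x0 0 k| <= \sum_k `|x0 0 k| by rewrite (bigD1 k)//= lerDl sumr_ge0.
have := ler_normD (x0 0 k) (x 0 k - x0 0 k); lra.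
Qed.

Definition bumpx (x0 : 'rV[R]_m.+1) (e : R) y : R :=
  \prod_k sqpos (1 - ((y 0 k - x0 0 k) / e) ^+ 2).

Lemma bumpx_C1 x0 e x : half x -> C1at (bumpx x0 e) x.
Proof.
move=> hx; apply: (@C1at_prod _ _ (fun k y => sqpos (1 - ((y 0 k - x0 0 k) / e) ^+ 2))) => // k.
apply: filterS (near_half x) => y hy.
have C z : half z -> C1at (fun y => y 0 k - x0 0 k) z.
  move=> hz; apply: C1atD => //; apply: filterS (near_half z) => z' hz'; first exact: C1at_coord.
  exact: C1at_cst.
have C' z : half z -> C1at (fun y => (y 0 k - x0 0 k) / e) z.
  move=> hz; apply: C1atM => //; apply: filterS (near_half z) => z' hz'; first exact: C.
  exact: C1at_cst.
apply: (@C1at_comp _ _ (fun y => 1 - ((y 0 k - x0 0 k) / e) ^+ 2) sqpos (fun t => 2 * Num.max 0 t)) => //.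
- apply: filterS (near_half y) => z hz.
  have -> : (fun y : 'rV[R]_m.+1 => 1 - ((y 0 k - x0 0 k) / e) ^+ 2) =
      (fun y => 1 + (-1) * (((y 0 k - x0 0 k) / e) * ((y 0 k - x0 0 k) / e))).
    by apply/funext => w; ring.
  apply: C1atD => //; apply: filterS (near_half z) => z1 h1; first exact: C1at_cst.
  apply: C1atM => //; apply: filterS (near_half z1) => z2 h2; first exact: C1at_cst.
  by apply: C1atM => //; apply: filterS (near_half z2) => z3 h3; exact: C'.
- exact: is_derive_sqpos.
- exact: sqpos_cont.
Qed.

Lemma bumpx_ge0 x0 e y : 0 <= bumpx x0 e y.
Proof. by apply: prodr_ge0 => k _; rewrite sqr_ge0. Qed.

Lemma bumpx_center x0 e : bumpx x0 e x0 = 1.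
Proof.
rewrite /bumpx big1// => k _.
by rewrite subrr mul0r expr0n /= subr0 /sqpos max_r ?ler01// expr1n.
Qed.

Lemma bumpx_cell x0 e y : 0 < e -> half y -> bumpx x0 e y != 0 -> cell x0 e y.
Proof.
move=> e0 hy b0; split => // k; rewrite leNgt; apply: contra b0 => ek.
rewrite /bumpx (bigD1 k)//= /sqpos max_l ?expr0n ?mul0r//=.
rewrite subr_le0 -real_normK ?num_real// normrM normfV (gtr0_norm e0).
by apply: exprn_ege1; rewrite ler_pdivlMr// mul1r ltW.
Qed.

End Bump.

Section PartitionOfUnity.
Context {R : realType} {m : nat} {M : ptopologicalType}.
Variables (A : set (chart R m M)).
Hypothesis HM : manifold_with_boundary A.
Implicit Types (c : chart R m M) (p q : M) (x y : 'rV[R]_m.+1) (a b : M -> R).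
Local Notation half := (@half_space R m).

(** The compact set [K] takes the place of the closure of the support. The explicit coordinate bound
    is the form in which [bsupp] and [half_divergence] use compactness. *)
Definition supported c (b : M -> R) := exists2 K : set 'rV[R]_m.+1,
  [/\ compact K, K `<=` cimg c & exists L : R, forall x, K x -> forall k, `|x 0 k| <= L] &
  forall q, b q != 0 -> cdom c q /\ K (cmap c q).

Lemma supportedM c a b : supported c b -> supported c (fun q => a q * b q).
Proof.
move=> [K HK Kb]; exists K => // q; rewrite mulf_eq0 negb_or => /andP[_]; exact: Kb.
Qed.

Lemma bump_exists p : exists b : M -> R,
  [/\ C1fun A b, forall q, 0 <= b q, 0 < b p & exists2 c, A c & supported c b].
Proof.
have [c Ac cp] := chart_at HM p; set x0 := cmap c p.
have /hnbhsP[d d0 Hd] := cimg_near HM Ac (cimg_cmap cp).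
pose e := d / 2; have e0 : 0 < e by rewrite divr_gt0.
have Kc : cell x0 e `<=` cimg c.
  move=> y [hy ye]; apply: Hd => // k; apply: le_lt_trans (ye k) _.
  by rewrite /e ltr_pdivrMr// ltr_pMr// ltr1n.
pose b q := if q \in cdom c then bumpx x0 e (cmap c q) else 0.
have bK q : b q != 0 -> cdom c q /\ cell x0 e (cmap c q).
  rewrite /b; case: ifPn => [/set_mem cq bq|_]; last by rewrite eqxx.
  split => //; apply: bumpx_cell => //.
  exact: (cimg_half HM Ac (cimg_cmap cq)).
(* Closed because compact in a Hausdorff space; hence [b], extended by zero, vanishes near every
   point outside the chart domain. *)
have cK : closed (cinv c @` cell x0 e).
  apply: (compact_closed (manifold_hausdorff HM)).
  apply: continuous_compact; last exact: cell_compact.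
  have [_ _ _ _ ci] := chartP HM Ac.
  exact: (continuous_subspaceW Kc ci).
exists b; split.
- move=> q; case: (pselect (cdom c q)) => cq.
    apply: (C1fun_at_near HM Ac cq); apply: filterS (cdom_near HM Ac cq) => r cr.
    have hr := cimg_half HM Ac (cimg_cmap cr).
    apply: (C1at_congr hr _ (bumpx_C1 x0 e hr)).
    apply: filterS (cimg_near HM Ac (cimg_cmap cr)) => y cy /=.
    by rewrite /b mem_set ?(cinvK HM Ac cy)//; exact: (cinv_dom HM).
  apply: (C1fun_at_cst HM (r := 0)).
  have nq : (~` (cinv c @` cell x0 e)) q.
    by move=> [y /Kc cy yq]; apply: cq; rewrite -yq; exact: (cinv_dom HM).
  apply: filterS (open_nbhs_nbhs (conj (closed_openC cK) nq)) => r nr.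
  apply/eqP; apply: contrapT => /negP /bK [cr Kr]; apply: nr.
  by exists (cmap c r) => //; exact: (cmapK HM).
- by move=> q; rewrite /b; case: ifP => // _; exact: bumpx_ge0.
- by rewrite /b mem_set// bumpx_center.
- exists c => //; exists (cell x0 e) => //; split => //; first exact: cell_compact.
  exact: cell_bounded.
Qed.

(** Compactness leaves finitely many bumps whose sum is positive everywhere; dividing by the sum
    keeps the supports. *)
Lemma partition_of_unity : compact [set: M] -> exists (s : seq M) (psi : M -> M -> R),
  [/\ forall p, C1fun A (psi p), forall p q, 0 <= psi p q,
      forall q, \sum_(p <- s) psi p q = 1 &
      forall p, exists2 c, A c & supported c (psi p)].
Proof.
move=> cM; have [b Hb] := choice bump_exists.
have oU p : open (b p @^-1` [set t | 0 < t]).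
  have [Cb _ _ _] := Hb p; have /continuousP := C1fun_cont HM Cb.
  by apply; exact: open_gt.
have cov : [set: M] `<=` \bigcup_(p in [set: M]) (b p @^-1` [set t | 0 < t]).
  by move=> p _; exists p => //; have [_ _] := Hb p.
rewrite compact_cover in cM; have [s _ sM] := cM _ _ _ (fun p _ => oU p) cov.
pose t : seq M := finmap.enum_fset s.
have b0 p q : 0 <= b p q by have [_ + _ _] := Hb p.
have B0 q : 0 < \sum_(p <- t) b p q.
  have [p sp bp] := sM q I; have pt : p \in t by exact: sp.
  by rewrite (big_rem p pt)/= ltr_wpDr// sumr_ge0.
have CB : C1fun A (fun q => (\sum_(p <- t) b p q)^-1).
  apply: C1fun_inv => [//||q]; last by rewrite gt_eqF.
  by apply: C1fun_sum => // p; have [] := Hb p.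
exists t, (fun p q => (\sum_(r <- t) b r q)^-1 * b p q); split.
- by move=> p; apply: C1funM => //; have [] := Hb p.
- by move=> p q; rewrite mulr_ge0// invr_ge0 ltW.
- by move=> q; rewrite -mulr_sumr mulVf// gt_eqF.
- by move=> p; have [_ _ _ [c Ac sc]] := Hb p; exists c => //; exact: supportedM.
Qed.

End PartitionOfUnity.

(** * Integration of functions supported in one chart *)

Section SupportedFunctions.
Context {R : realType} {m : nat} {M : ptopologicalType}.
Variables (A : set (chart R m M)) (g : chart R m M -> 'rV[R]_m.+1 -> 'M[R]_m.+1).
Hypothesis HM : manifold_with_boundary A.
Hypothesis Hg : riemannian_metric A g.
Implicit Types (c : chart R m M) (p q : M) (x y : 'rV[R]_m.+1) (a b phi psi : M -> R).
Implicit Types F : 'rV[R]_m.+1 -> R.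
Local Notation half := (@half_space R m).
Local Notation bR n := (borelT 'rV[R]_n).

Lemma rV_hausdorff : hausdorff_space 'rV[R]_m.+1.
Proof. exact: norm_hausdorff. Qed.

Lemma near_notin (K : set 'rV[R]_m.+1) x : compact K -> ~ K x -> \forall y \near hnbhs x, ~ K y.
Proof.
move=> cK Kx; have oK : open (~` K) by apply: closed_openC; apply: (compact_closed rV_hausdorff).
rewrite /hnbhs near_withinE.
by apply: filterS (open_nbhs_nbhs (conj oK Kx)) => y Ky _.
Qed.

Lemma supported_near c (K : set 'rV[R]_m.+1) psi p : A c -> compact K -> K `<=` cimg c ->
  (forall q, psi q != 0 -> cdom c q /\ K (cmap c q)) ->
  ~ (cdom c p /\ K (cmap c p)) -> \forall q \near p, psi q = 0.
Proof.
move=> Ac cK Kc Kpsi np.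
have cl : closed (cinv c @` K).
  apply: (compact_closed (manifold_hausdorff HM)); apply: continuous_compact => //.
  by have [_ _ _ _ ci] := chartP HM Ac; exact: (continuous_subspaceW Kc ci).
have nq : (~` (cinv c @` K)) p.
  move=> [y Ky yp]; apply: np; rewrite -yp; split; first exact: (cinv_dom HM Ac (Kc _ Ky)).
  by rewrite (cinvK HM Ac (Kc _ Ky)).
apply: filterS (open_nbhs_nbhs (conj (closed_openC cl) nq)) => q nr.
apply/eqP; apply: contrapT => /negP /Kpsi[cq Kq]; apply: nr.
by exists (cmap c q) => //; exact: (cmapK HM).
Qed.

Section InChart.
Variables (c : chart R m M) (Ac : A c).

Lemma cut_in F x : cimg c x -> cut c F x = F x.
Proof. by move=> cx; rewrite /cut mem_set. Qed.

Lemma cut_near F x : cimg c x -> {near hnbhs x, F =1 cut c F}.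
Proof. by move=> cx; apply: filterS (cimg_near HM Ac cx) => y cy; rewrite cut_in. Qed.

Variables (K : set 'rV[R]_m.+1) (L : R) (F : 'rV[R]_m.+1 -> R).
Hypothesis cK : compact K.
Hypothesis Kc : K `<=` cimg c.
Hypothesis KL : forall x, K x -> forall k, `|x 0 k| <= L.
Hypothesis FK : forall x, cimg c x -> F x != 0 -> K x.

Lemma cut_out x : ~ K x -> cut c F x = 0.
Proof.
rewrite /cut; case: ifPn => // /set_mem cx Kx; apply/eqP; apply: contrapT => /negP.
by move=> /(FK cx).
Qed.

Lemma cut_far x : (exists k, L < `|x 0 k|) -> cut c F x = 0.
Proof. by move=> [k Lk]; apply: cut_out => /KL/(_ k); rewrite leNgt Lk. Qed.

Lemma cut_near_out x : ~ K x -> {near hnbhs x, (fun=> 0) =1 cut c F}.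
Proof. by move=> Kx; apply: filterS (near_notin cK Kx) => y Ky; rewrite cut_out. Qed.

Lemma cut_hcont x : half x -> ccont c F -> hcont (cut c F) x.
Proof.
move=> hx cF; case: (pselect (K x)) => Kx.
  by apply: (hcont_congr hx (cut_near F (Kc Kx))); exact: cF (Kc Kx).
by apply: (hcont_congr hx (cut_near_out Kx)); exact: hcont_cst.
Qed.

Lemma cut_C1 x : half x -> (forall y, cimg c y -> C1at F y) -> C1at (cut c F) x.
Proof.
move=> hx cF; case: (pselect (K x)) => Kx.
  by apply: (C1at_congr hx (cut_near F (Kc Kx))); exact: cF (Kc Kx).
exact: (C1at_congr hx (cut_near_out Kx) (C1at_cst 0 hx)).
Qed.

Lemma cut_pder_in i x : cimg c x -> pder i (cut c F) x = pder i F x.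
Proof.
by move=> cx; have [-> _] := pder_congr i (cimg_half HM Ac cx) (cut_near F cx).
Qed.

Lemma cut_pder_out i x : half x -> ~ K x -> pder i (cut c F) x = 0.
Proof.
move=> hx Kx; have [<- _] := pder_congr i hx (cut_near_out Kx).
exact: is_pder_val (is_pder_cst _ _ _).
Qed.

Lemma cut_integrable : ccont c F -> (lam m.+1).-integrable setT (EFin \o cut c F).
Proof.
move=> cF; have [||C C0 HC] := @hcont_bounded _ _ (cut c F) L.
- by move=> x hx; exact: cut_hcont.
- by move=> x _; exact: cut_far.
apply: (@bsupp_integrable _ _ _ C L).
- exact: (cut_meas HM Ac cF).
- move=> x; case: (pselect (half x)) => hx; first exact: HC.
  rewrite cut_out ?normr0// => Kx; apply: hx; exact: (cimg_half HM Ac (Kc Kx)).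
- exact: cut_far.
Qed.

End InChart.

Definition vol c x := Num.sqrt (\det (g c x)).

Lemma vol_ccont c : A c -> ccont c (vol c).
Proof.
by move=> Ac; apply: sqrt_ccont => x cx; apply: hcont_det => i j; exact: (metric_ccont HM Hg Ac).
Qed.

Lemma ccont_continuous phi : (forall c, A c -> ccont c (phi \o cinv c)) -> continuous phi.
Proof.
move=> cphi p; have [c Ac cp] := chart_at HM p.
have := cvg_comp _ _ (cmap_cvg HM Ac cp) (cphi c Ac _ (cimg_cmap cp)); rewrite /= (cmapK HM Ac cp) => H.
apply: cvg_trans H; apply: near_eq_cvg; apply: filterS (cdom_near HM Ac cp) => q cq /=.
by rewrite (cmapK HM Ac cq).
Qed.

Lemma continuous_ccont phi c : continuous phi -> A c -> ccont c (phi \o cinv c).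
Proof. by move=> cphi Ac x cx; exact: (cvg_comp _ _ (cinv_cvg HM Ac cx) (cphi _)). Qed.

Lemma continuous_meas phi : continuous phi -> measurable_fun setT (phi : borelT M -> R).
Proof.
move=> cphi; apply: measurable_to_R => W oW; rewrite setTI; apply: open_borel.
by have /continuousP := cphi; exact.
Qed.

Variables (mu : {measure set (@borel M) -> \bar R}).
Hypothesis vol_mu : is_volume A g mu.

Lemma chart_integral phi c : A c -> continuous phi -> (forall q, ~ cdom c q -> phi q = 0) ->
  (\int[mu]_(q in (setT : set (borelT M))) (phi q)%:E =
   \int[lam m.+1]_x (cut c (fun y => phi (cinv c y) * vol c y) x)%:E)%E.
Proof.
move=> Ac cphi phi0.
rewrite (@transfer _ _ (borelT M) (bR m.+1) R mu (lam m.+1) (cdom c) (cpoint c) (cut c (vol c))).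
- by apply: eq_integral => y _; rewrite /cpoint /cut; case: ifP => //; rewrite mulr0.
- exact: (cpoint_meas HM Ac).
- exact: (cut_meas HM Ac (vol_ccont Ac)).
- by apply: cut_ge0 => y; exact: sqrtr_ge0.
- by move=> B; exact: (volume_chart HM Hg Ac vol_mu).
- exact: continuous_meas.
- exact: phi0.
Qed.

Lemma chart_integrable phi c : A c -> continuous phi -> supported c phi ->
  mu.-integrable (setT : set (borelT M)) (EFin \o phi).
Proof.
move=> Ac cphi [K [cK Kc [L KL]] phiK].
apply: (@transfer_integrable _ _ (borelT M) (bR m.+1) R mu (lam m.+1) (cdom c) (cpoint c) (cut c (vol c))).
- exact: (cpoint_meas HM Ac).
- exact: (cut_meas HM Ac (vol_ccont Ac)).
- by apply: cut_ge0 => y; exact: sqrtr_ge0.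
- by move=> B; exact: (volume_chart HM Hg Ac vol_mu).
- exact: continuous_meas.
- move=> q cq; apply/eqP; apply: contrapT => /negP /phiK[].
  by move=> /cq.
have FK x : cimg c x -> phi (cinv c x) * vol c x != 0 -> K x.
  move=> cx; rewrite mulf_eq0 negb_or => /andP[/phiK[_]]; by rewrite (cinvK HM Ac cx).
have := cut_integrable Ac cK Kc KL FK.
have -> : (fun y => (phi (cpoint c y) * cut c (vol c) y)%:E) =
    EFin \o cut c (fun x => phi (cinv c x) * vol c x).
  by apply/funext => y /=; rewrite /cpoint /cut; case: ifP => // _; rewrite mulr0.
apply => x cx; apply: hcontM; first exact: (continuous_ccont cphi Ac cx).
exact: (vol_ccont Ac cx).
Qed.

Lemma chart_boundary_integral (sigma : {measure set (@borel M) -> \bar R}) psi c : A c ->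
  is_boundary_volume A g sigma -> continuous psi -> (forall q, ~ cdom c q -> psi q = 0) ->
  (\int[sigma]_(q in (setT : set (borelT M))) (psi q)%:E =
   \int[lam m]_v (cut c (fun y => psi (cinv c y) *
      Num.sqrt (\det (row' ord0 (col' ord0 (g c y))))) (joinv (0%R, v)))%:E)%E.
Proof.
move=> Ac vol_s cpsi psi0.
rewrite (@transfer _ _ (borelT M) (bR m) R sigma (lam m) (cdom c) (bpoint c) (bweight g c)).
- apply: eq_integral => v _; rewrite /bpoint /bweight /cpoint /cut.
  by case: ifP => //; rewrite mulr0.
- exact: (bpoint_meas HM Ac).
- exact: (bweight_meas HM Hg Ac).
- exact: bweight_ge0.
- by move=> B; exact: (boundary_chart HM Hg Ac vol_s).
- exact: continuous_meas.
- exact: psi0.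
Qed.

End SupportedFunctions.

(** * The static perfect fluid *)

Section Fluid.
Context {R : realType} {m : nat} {M : ptopologicalType}.
Variables (A : set (chart R m M)) (g : chart R m M -> 'rV[R]_m.+1 -> 'M[R]_m.+1).
Variables (f rho : M -> R) (scal : R).
Hypothesis sp : static_perfect_fluid A g f rho.
Hypothesis cs : constant_scalar_curv A g scal.
Implicit Types (c : chart R m M) (p q : M) (x y : 'rV[R]_m.+1) (a b phi psi : M -> R).
Local Notation half := (@half_space R m).
Local Notation HM := (spf_manifold sp).
Local Notation Hg := (spf_metric sp).
Local Notation n := (m.+1%:R : R).
Local Notation qc := (scal / m%:R).
Local Notation u c := (f \o cinv c).

Lemma m_gt0 : (0 < m)%N.
Proof. by have := spf_dim sp; case: m. Qed.

Lemma f_bdry p : f p = 0 <-> bdry A p.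
Proof.
have e := spf_f_zero sp; split => [fp|bp].
  by rewrite -e.
by have : (f @^-1` [set 0]) p by rewrite e.
Qed.

Lemma f_ge0 p : 0 <= f p.
Proof.
case: (pselect (bdry A p)) => bp; first by rewrite (f_bdry p).2.
exact: ltW (spf_f_pos sp bp).
Qed.

Lemma f_C1 : C1fun A f. Proof. exact: (smooth_C1g HM (spf_f_smooth sp)). Qed.

Definition cdomain c (Ac : A c) : ropen R m := ROpen (chart_image (chartP HM Ac)).

Lemma f_static c x : A c -> cimg c x ->
  u c x *: trace_free (g c) x (ricci (g c) x) = trace_free (g c) x (hessian (g c) (u c) x).
Proof.
move=> Ac cx; have := spf_ricci sp Ac (cinv_dom HM Ac cx).
by rewrite (cinvK HM Ac cx).
Qed.

(* Lap f + q f, in the chart-free form given by the second fluid equation. *)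
Definition lapq p := ((n - 2) / (2 * (n - 1)) * scal + n / (n - 1) * rho p) * f p + qc * f p.

Lemma lapqE c x : A c -> cimg c x -> laplacian (g c) (u c) x + qc * u c x = lapq (cinv c x).
Proof.
move=> Ac cx; have := spf_laplacian sp Ac (cinv_dom HM Ac cx).
by rewrite /= (cinvK HM Ac cx) (cs Ac cx) => ->.
Qed.

Lemma C1funD a b : C1fun A a -> C1fun A b -> C1fun A (fun p => a p + b p).
Proof.
move=> Ca Cb p c Ac cp; apply: C1atD; first exact: (cimg_half HM Ac (cimg_cmap cp)).
  exact: (C1fun_near HM Ca Ac cp).
exact: (C1fun_near HM Cb Ac cp).
Qed.

Lemma C1fun_cst (r : R) : C1fun A (fun=> r).
Proof. by move=> p; apply: (C1fun_at_cst HM (r := r)); exact: nearW. Qed.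

(** The second fluid equation makes the Laplacian a smooth multiple of [f], so its regularity on the
    manifold follows from that of [f] and [rho]. *)
Lemma lapq_C1 : C1fun A lapq.
Proof.
have Cr := smooth_C1g HM (spf_rho_smooth sp).
by apply: C1funD; apply: C1funM; do ?[exact: f_C1|exact: C1fun_cst|exact: HM|
  apply: C1funD|apply: C1funM].
Qed.

Lemma f_chart_smooth c : A c -> smooth_on (cimg c) (u c).
Proof. exact: (spf_f_smooth sp). Qed.

Lemma lapq_locally_const p : \forall q \near p, lapq q = lapq p.
Proof.
have [c Ac cp] := chart_at HM p.
have H : \forall y \near hnbhs (cmap c p), (lapq \o cinv c) y = (lapq \o cinv c) (cmap c p).
  apply: (chart_const HM Ac cp) => y cy; split.
    by have [] := C1fun_C1at HM lapq_C1 Ac cy.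
  move=> i; have := @static_laplacian_const R m (cdomain Ac) (g c)
    (metric_smooth Hg Ac) (fun x => metric_sym Hg Ac) (fun x => metric_pos Hg Ac)
    (u c) (f_chart_smooth Ac) scal (fun x => f_static Ac) (fun x => @cs c x Ac) m_gt0 y i cy.
  apply: is_pder_congr; first exact: lapqE.
  by apply: filterS (cimg_near HM Ac cy) => z cz; exact: lapqE.
apply: (near_cmap HM Ac cp); apply: filterS H => y /=.
by rewrite (cmapK HM Ac cp).
Qed.

Lemma lapq_bdry p : bdry A p -> lapq p = 0.
Proof. by move=> /f_bdry fp; rewrite /lapq fp !mulr0 addr0. Qed.

Lemma f_near_min c p : A c -> cdom c p -> bdry A p ->
  \forall y \near hnbhs (cmap c p), u c (cmap c p) <= u c y.
Proof.
move=> Ac cp /f_bdry fp; apply: nearW => y /=; rewrite (cmapK HM Ac cp) fp; exact: f_ge0.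
Qed.

Lemma f_bdry_pder c p i : A c -> cdom c p -> bdry A p -> i != ord0 ->
  pder i (u c) (cmap c p) = 0.
Proof.
move=> Ac cp bp i0; have hx := cimg_half HM Ac (cimg_cmap cp).
apply: (pder_min_eq0 hx (half_interior (or_intror i0) hx) _ (f_near_min Ac cp bp)).
exact: C1at_is_pder (f_C1 Ac cp).
Qed.

Lemma f_bdry_normal c p : A c -> cdom c p -> bdry A p -> 0 <= pder ord0 (u c) (cmap c p).
Proof.
move=> Ac cp bp; have hx := cimg_half HM Ac (cimg_cmap cp).
apply: (pder_min_ge0 hx _ (f_near_min Ac cp bp)).
exact: C1at_is_pder (f_C1 Ac cp).
Qed.

(** Where [f] vanishes the first fluid equation kills the trace-free part of the Hessian and the
    second one its trace. *)
Lemma f_bdry_hessian c x : A c -> cimg c x -> bdry A (cinv c x) -> hessian (g c) (u c) x = 0.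
Proof.
move=> Ac cx /f_bdry fx; have := f_static Ac cx; rewrite /= fx scale0r /trace_free.
have := spf_laplacian sp Ac (cinv_dom HM Ac cx).
rewrite /= (cinvK HM Ac cx) fx mulr0 /laplacian => ->.
by rewrite mul0r scale0r subr0.
Qed.

Lemma chart_exists p : exists c, A c /\ cdom c p.
Proof. by have [c Ac cp] := chart_at HM p; exists c. Qed.

(* The value of the bracket does not depend on the chart selected at p. *)
Definition chart_sel p := sval (cid (chart_exists p)).

Lemma chart_selP p : A (chart_sel p) /\ cdom (chart_sel p) p.
Proof. exact: (svalP (cid (chart_exists p))). Qed.

Definition bracket a b p := cbracket g (chart_sel p) a b (cmap (chart_sel p) p).

Lemma bracketE c a b x : C1fun A a -> C1fun A b -> A c -> cimg c x ->
  bracket a b (cinv c x) = cbracket g c a b x.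
Proof.
move=> Ca Cb Ac cx; have [As ds] := chart_selP (cinv c x).
rewrite /bracket (cbracket_indep HM Hg Ca Cb As Ac ds (cinv_dom HM Ac cx)).
by rewrite (cinvK HM Ac cx).
Qed.

Lemma metric_inv_ccont c i j : A c -> ccont c (fun x => metric_inv (g c) x i j).
Proof.
move=> Ac x cx; have oV := chart_image (chartP HM Ac).
have sm := @metric_inv_smooth R m (cdomain Ac) (g c)
    (metric_smooth Hg Ac) (fun x => metric_sym Hg Ac) (fun x => metric_pos Hg Ac) i j.
by have [] := smooth_C1at oV sm cx.
Qed.

Lemma bracket_ccont c a b : C1fun A a -> C1fun A b -> A c -> ccont c (bracket a b \o cinv c).
Proof.
move=> Ca Cb Ac x cx; have hx := cimg_half HM Ac cx.
have H : hcont (cbracket g c a b) x.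
  apply: hcont_sum => i; apply: hcont_sum => j; apply: hcontM; first apply: hcontM.
  - exact: metric_inv_ccont.
  - by have [_ /(_ i)[]] := C1fun_C1at HM Ca Ac cx.
  - by have [_ /(_ j)[]] := C1fun_C1at HM Cb Ac cx.
apply: (hcont_congr hx _ H); apply: filterS (cimg_near HM Ac cx) => y cy /=.
by rewrite bracketE.
Qed.

Definition gradsq p := bracket f f p.

Lemma gradsqE c x : A c -> cimg c x -> gradsq (cinv c x) = grad2 (g c) (u c) x.
Proof. by move=> Ac cx; rewrite /gradsq (bracketE f_C1 f_C1 Ac cx). Qed.

Lemma gradsq_smooth : smooth_function A gradsq.
Proof.
move=> c Ac; have oV := chart_image (chartP HM Ac).
have sm := @grad2_smooth R m (cdomain Ac) (g c)
    (metric_smooth Hg Ac) (fun x => metric_sym Hg Ac) (fun x => metric_pos Hg Ac)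
    (u c) (f_chart_smooth Ac).
by apply: (smooth_congr oV _ sm) => x /set_mem cx; rewrite /= gradsqE.
Qed.

Lemma gradsq_C1 : C1fun A gradsq. Proof. exact: (smooth_C1g HM gradsq_smooth). Qed.

Lemma grad2_pder c x i : A c -> cimg c x -> bdry A (cinv c x) ->
  pder i (grad2 (g c) (u c)) x = 0.
Proof.
move=> Ac cx bx; have hx := cimg_half HM Ac cx.
rewrite (is_pder_val hx (@ev_D_norm R m (cdomain Ac) (g c)
    (metric_smooth Hg Ac) (fun x => metric_sym Hg Ac) (fun x => metric_pos Hg Ac)
    (u c) (f_chart_smooth Ac) x i cx)).
rewrite big1 ?mulr0// => k _; rewrite big1// => j _.
by rewrite f_bdry_hessian// !mxE !mul0r.
Qed.

(** The staircase between two boundary points of a chart stays in the hyperplane x_0 = 0. The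
    partial derivatives of |grad f|^2 vanish there with the Hessian. *)
Lemma gradsq_locally_const p : bdry A p -> \forall q \near p, bdry A q -> gradsq q = gradsq p.
Proof.
move=> bp; have [c Ac cp] := chart_at HM p.
have /hnbhsP[e e0 He] := cimg_near HM Ac (cimg_cmap cp).
have hx := cimg_half HM Ac (cimg_cmap cp); set x := cmap c p in hx He *.
have x0 : x 0 ord0 = 0 := bdry_coord HM Hg Ac cp bp.
apply: (near_cmap HM Ac cp); apply/hnbhsP; exists e => // y hy yx by_.
have cy : cimg c y by exact: He.
have y0 : y 0 ord0 = 0.
  by have := bdry_coord HM Hg Ac (cinv_dom HM Ac cy) by_; rewrite (cinvK HM Ac cy).
have bc z : between x y z -> cimg c z.
  move=> bz; apply: He; first exact: (between_half hx hy bz).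
  by move=> k; apply: le_lt_trans (yx k); exact: between_dist.
have gC z : cimg c z -> C1at (grad2 (g c) (u c)) z.
  move=> cz; have hz := cimg_half HM Ac cz.
  apply: (C1at_congr hz _ (C1fun_C1at HM gradsq_C1 Ac cz)).
  by apply: filterS (cimg_near HM Ac cz) => w cw /=; rewrite gradsqE.
have [|z zb E] := path_MVT hx hy (F := grad2 (g c) (u c)).
  by move=> z /bc/gC[h1 h2]; split => // i; have [] := h2 i.
rewrite gradsqE// -(cmapK HM Ac cp) gradsqE//; last exact: cimg_cmap.
apply/eqP; rewrite -subr_eq0 E; apply/eqP; rewrite big1// => j _.
have cz := bc _ (zb j).
rewrite grad2_pder ?mulr0//; exists c; split => //; first exact: (cinv_dom HM Ac cz).
rewrite (cinvK HM Ac cz); have [s _ ->] := zb j ord0.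
by rewrite x0 y0 subr0 mulr0 addr0.
Qed.

Lemma gradsq_const : connected (bdry A) -> exists k2 : R, forall p, bdry A p -> gradsq p = k2.
Proof.
move=> cb; have [p0 bp0] := spf_bdry sp; exists (gradsq p0).
pose B := bdry A `&` [set p | gradsq p = gradsq p0].
suff -> : bdry A = B by move=> p [].
apply/esym/cb; first by exists p0.
- pose U := interior [set q | bdry A q -> gradsq q = gradsq p0].
  exists U; first exact: open_interior.
  apply/seteqP; split=> q [bq Hq]; split => //.
    by have := gradsq_locally_const bq; apply: filterS => r h br; rewrite h.
  exact: (nbhs_singleton Hq).
- exists (gradsq @^-1` [set gradsq p0]); last by [].
  have /continuous_closedP := C1fun_cont HM gradsq_C1; apply; exact: closed_eq.
Qed.

End Fluid.

(** * The divergence inequality for one weight of the partition *)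

Section ChartInequality.
Context {R : realType} {m : nat} {M : ptopologicalType}.
Variables (A : set (chart R m M)) (g : chart R m M -> 'rV[R]_m.+1 -> 'M[R]_m.+1).
Variables (f rho : M -> R) (scal : R) (mu sigma : {measure set (@borel M) -> \bar R}).
Hypothesis sp : static_perfect_fluid A g f rho.
Hypothesis cs : constant_scalar_curv A g scal.
Hypothesis vol_mu : is_volume A g mu.
Hypothesis vol_sigma : is_boundary_volume A g sigma.
Variable k2 : R.
Hypothesis gradsq_bdry : forall p, bdry A p -> gradsq sp p = k2.
Implicit Types (c : chart R m M) (p q : M) (x y : 'rV[R]_m.+1) (a b phi psi : M -> R).
Local Notation half := (@half_space R m).
Local Notation HM := (spf_manifold sp).
Local Notation Hg := (spf_metric sp).
Local Notation n := (m.+1%:R : R).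
Local Notation qc := (scal / m%:R).
Local Notation u c := (f \o cinv c).
Local Notation c3 := (3 * k2).
Local Notation bracket := (bracket sp).
Local Notation gradsq := (gradsq sp).

(** The lower bound for div X provided by [div_wflux]. *)
Definition bulk p := (n + 2) * qc ^+ 2 / (2 * n) * f p ^+ 3 - c3 * qc * f p.

(** The derivative of [psi] along X, that is d psi(X), written without reference to a chart. *)
Definition flow psi p := f p * (2^-1 * bracket psi gradsq p)
  - (gradsq p + qc / 2 * (f p * f p) - c3) * bracket psi f p.

Lemma flow_chart psi c x : C1fun A psi -> A c -> cimg c x ->
  vol g c x * flow psi (cinv c x) =
  \sum_j pder j (psi \o cinv c) x * wflux (g c) (u c) scal c3 j x.
Proof.
move=> Cpsi Ac cx; have hx := cimg_half HM Ac cx.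
rewrite /flow (bracketE sp Cpsi (gradsq_C1 sp) Ac cx) (bracketE sp Cpsi (f_C1 sp) Ac cx) (gradsqE sp Ac cx).
have dG j : pder j (gradsq \o cinv c) x = pder j (grad2 (g c) (u c)) x.
  have nE : {near hnbhs x, gradsq \o cinv c =1 grad2 (g c) (u c)}.
    by apply: filterS (cimg_near HM Ac cx) => y cy /=; exact: gradsqE.
  by have [] := pder_congr j hx nE.
rewrite /cbracket /wflux /vol.
under [X in f _ * (_ * X)]eq_bigr => i _ do under eq_bigr => j _ do rewrite dG.
rewrite !mulr_sumr -sumrB mulr_sumr; apply: eq_bigr => i _.
rewrite !mulr_sumr -sumrB !mulr_sumr; apply: eq_bigr => j _.
by rewrite /flux /=; ring.
Qed.

(** On the boundary df is a multiple of dx_0 and X = 2 k^2 grad f. By Cramer's rule the entry (0,0)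
    of the inverse metric is det' / det, with det' that of the induced metric; this turns sqrt (det)
    into the boundary density and one factor into k. *)
Lemma wflux_bdry c x : A c -> cimg c x -> bdry A (cinv c x) ->
  wflux (g c) (u c) scal c3 ord0 x =
  2 * (k2 * Num.sqrt k2) * Num.sqrt (\det (row' ord0 (col' ord0 (g c x)))).
Proof.
move=> Ac cx bx; have cp := cinv_dom HM Ac cx; have xE := cinvK HM Ac cx.
have f0 := (f_bdry sp _).2 bx.
have g2 : grad2 (g c) (u c) x = k2 by rewrite -(gradsqE sp Ac cx) gradsq_bdry.
have u0 j : j != ord0 -> pder j (u c) x = 0.
  by move=> j0; rewrite -xE; exact: (f_bdry_pder sp Ac cp bx j0).
have up : 0 <= pder ord0 (u c) x by rewrite -xE; exact: (f_bdry_normal sp Ac cp bx).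
set H := metric_inv (g c) x ord0 ord0; set u1 := pder ord0 (u c) x in up *.
have k2E : k2 = H * u1 * u1.
  rewrite -g2 /grad2 (bigD1 ord0)//= (bigD1 ord0)//= [X in _ + X + _]big1 => [|j j0]; last first.
    by rewrite (u0 j j0) mulr0.
  rewrite addr0 [X in _ + X]big1 ?addr0// => i i0.
  by rewrite big1// => j _; rewrite (u0 i i0) mulr0 mul0r.
have d0 := metric_det_gt0 Hg Ac cx; set d := \det (g c x) in d0.
have HE : H = d^-1 * \det (row' ord0 (col' ord0 (g c x))).
  rewrite /H /metric_inv /invmx unitmxE unitfE gt_eqF//= !mxE /cofactor expr0 mul1r -/d.
  by congr (_ * \det _); apply/matrixP => i j; rewrite !mxE.
set d' := \det (row' _ _) in HE *.
have H0 : 0 < H.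
  apply: posdef_diag => v v0; apply: posdef_inv => //; first exact: (metric_sym Hg Ac).
  exact: (metric_pos Hg Ac).
have d'0 : 0 < d' by move: H0; rewrite HE pmulr_rgt0 ?invr_gt0.
have -> : wflux (g c) (u c) scal c3 ord0 x = Num.sqrt d * (H * (2 * k2 * u1)).
  rewrite /wflux; congr (_ * _); rewrite (bigD1 ord0)//= big1 ?addr0 => [|j j0]; last first.
    by rewrite /flux (u0 j j0) /= f0 !mul0r !mulr0 subr0 mulr0.
  by rewrite /flux g2 /= f0 -/u1 -/H; ring.
have sd0 : 0 < Num.sqrt d by rewrite sqrtr_gt0.
have sd : d = Num.sqrt d * Num.sqrt d by rewrite -expr2 sqr_sqrtr// ltW.
have sd' : Num.sqrt d * H = Num.sqrt d' * Num.sqrt H.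
  have -> : d' = d * H by rewrite HE mulrA divff ?mul1r// gt_eqF.
  rewrite (sqrtrM _ (ltW d0)) -mulrA; congr (_ * _).
  by rewrite -expr2 sqr_sqrtr// ltW.
have -> : Num.sqrt k2 = Num.sqrt H * u1.
  by rewrite k2E -mulrA -expr2 (sqrtrM _ (ltW H0)) sqrtr_sqr ger0_norm.
transitivity (Num.sqrt d * H * (2 * k2 * u1)); first by ring.
by rewrite sd'; ring.
Qed.

Variables (c : chart R m M) (psi : M -> R).
Hypotheses (Ac : A c) (Cpsi : C1fun A psi) (psi0 : forall p, 0 <= psi p).
Hypothesis spsi : supported c psi.
Hypothesis psi_lap : forall p, psi p != 0 -> @lapq R m M f rho scal p = 0.

(** A lower bound for div (psi X): the product rule, with div X replaced by its estimate. *)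
Definition density p := psi p * bulk p + flow psi p.

Lemma density_cont : continuous density.
Proof.
apply: (ccont_continuous HM) => c' Ac'.
have cf : ccont c' (f \o cinv c') by move=> x cx; have [] := C1fun_C1at HM (f_C1 sp) Ac' cx.
have cp : ccont c' (psi \o cinv c') by move=> x cx; have [] := C1fun_C1at HM Cpsi Ac' cx.
have cG : ccont c' (gradsq \o cinv c') by move=> x cx; have [] := C1fun_C1at HM (gradsq_C1 sp) Ac' cx.
have c1 : ccont c' (bracket psi gradsq \o cinv c') := bracket_ccont Cpsi (gradsq_C1 sp) Ac'.
have c2 : ccont c' (bracket psi f \o cinv c') := bracket_ccont Cpsi (f_C1 sp) Ac'.
move=> x cx; have F := hcont_cst; apply: hcontD.
  apply: hcontM; first exact: cp.
  apply: hcontB; last by apply: hcontM; [exact: hcont_cst|exact: cf].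
  apply: hcontM; first exact: hcont_cst.
  have -> : (fun y => f (cinv c' y) ^+ 3) = (fun y => f (cinv c' y) * (f (cinv c' y) * f (cinv c' y))).
    by apply/funext => y; rewrite exprS expr2.
  by apply: hcontM; [exact: cf|apply: hcontM; exact: cf].
apply: hcontB.
  by apply: hcontM; [exact: cf|apply: hcontM; [exact: hcont_cst|exact: c1]].
apply: hcontM; last exact: c2.
apply: hcontB; last exact: hcont_cst.
apply: hcontD; first exact: cG.
by apply: hcontM; [exact: hcont_cst|apply: hcontM; exact: cf].
Qed.

(** Vanishing of [psi] near [p] is required, since [flow] contains its derivatives. *)
Lemma near0_density p : (\forall q \near p, psi q = 0) -> density p = 0.
Proof.
move=> n0; rewrite /density (nbhs_singleton n0) mul0r add0r /flow.
have b0 a : bracket psi a p = 0.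
  rewrite /bracket /cbracket; have [As ds] := chart_selP sp p.
  have hx := cimg_half HM As (cimg_cmap ds).
  rewrite big1// => i _; rewrite big1// => j _.
  have nE : {near hnbhs (cmap (chart_sel sp p) p), psi \o cinv (chart_sel sp p) =1 (fun=> 0)}.
    exact: (near_cinv HM As ds n0).
  have [-> _] := pder_congr i hx nE.
  by rewrite (is_pder_val hx (is_pder_cst _ _ _)) mulr0 mul0r.
by rewrite !b0 !mulr0 subr0.
Qed.

Lemma supported_density : supported c density.
Proof.
have [K [cK Kc KL] Kpsi] := spsi; exists K => // q; apply: contra_neqP => nq.
exact: (near0_density (supported_near HM Ac cK Kc Kpsi nq)).
Qed.

Lemma supported_out phi q : supported c phi -> ~ cdom c q -> phi q = 0.
Proof.
by move=> [K _ Kphi] cq; apply/eqP; apply: contrapT => /negP /Kphi[].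
Qed.

Lemma density_integrable : mu.-integrable (setT : set (borelT M)) (EFin \o density).
Proof. exact: (chart_integrable HM Hg vol_mu Ac density_cont supported_density). Qed.

Lemma chart_divergence :
  (\int[mu]_(q in (setT : set (borelT M))) (density q)%:E <=
   - \int[sigma]_(q in (setT : set (borelT M))) (2 * (k2 * Num.sqrt k2) * psi q)%:E)%E.
Proof.
have [K [cK Kc [L KL]] Kpsi] := spsi.
have cpsi := C1fun_cont HM Cpsi.
have cpsi2 : continuous (fun q => 2 * (k2 * Num.sqrt k2) * psi q).
  by move=> q; apply: cvgM; [exact: cvg_cst|exact: cpsi].
rewrite (chart_integral HM Hg vol_mu Ac density_cont); last by move=> q; exact: supported_out supported_density.
rewrite (chart_boundary_integral HM Hg Ac vol_sigma cpsi2); last first.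
  by move=> q cq; rewrite (supported_out spsi cq) mulr0.
(* The vector density sqrt (det g) psi X in coordinates, extended by zero to the half-space. *)
pose F j := cut c (fun x => psi (cinv c x) * wflux (g c) (u c) scal c3 j x).
have KE x : cimg c x -> psi (cinv c x) != 0 -> K x.
  by move=> cx /Kpsi[_]; rewrite (cinvK HM Ac cx).
have FK j x : cimg c x -> psi (cinv c x) * wflux (g c) (u c) scal c3 j x != 0 -> K x.
  by move=> cx; rewrite mulf_eq0 negb_or => /andP[/(KE _ cx)].
have wYC j x : cimg c x -> C1at (wflux (g c) (u c) scal c3 j) x.
  move=> cx; have oV := chart_image (chartP HM Ac).
  exact: (smooth_C1at oV (@wflux_smooth R m (cdomain sp Ac) (g c)
    (metric_smooth Hg Ac) (fun x => metric_sym Hg Ac) (fun x => metric_pos Hg Ac)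
    (u c) (f_chart_smooth sp Ac) scal c3 j) cx).
have psiC x : cimg c x -> C1at (psi \o cinv c) x by exact: (C1fun_C1at HM Cpsi Ac).
have FC j x : half x -> C1at (F j) x.
  move=> hx; apply: (cut_C1 HM Ac cK Kc (FK j) hx) => y cy.
  apply: C1atM; first exact: (cimg_half HM Ac cy).
    by apply: filterS (cimg_near HM Ac cy) => z cz; exact: psiC.
  by apply: filterS (cimg_near HM Ac cy) => z cz; exact: wYC.
have F0 j x : (exists k, L < `|x 0 k|) -> F j x = 0 by exact: (cut_far KL (FK j)).
have supD x : cimg c x -> density (cinv c x) * vol g c x != 0 -> K x.
  move=> cx; rewrite mulf_eq0 negb_or => /andP[+ _]; apply: contra_neqP => nK.
  apply: near0_density; apply: (supported_near HM Ac cK Kc Kpsi) => -[_].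
  by rewrite (cinvK HM Ac cx).
have := @half_divergence R m F L FC F0 (cut c (fun y => density (cinv c y) * vol g c y)).
have -> : (\int[lam m]_v (F ord0 (joinv (0%R, v)))%:E =
   \int[lam m]_v (cut c (fun y => 2 * (k2 * Num.sqrt k2) * psi (cinv c y) *
      Num.sqrt (\det (row' ord0 (col' ord0 (g c y))))) (joinv (0%R, v)))%:E)%E.
  apply: eq_integral => v _; congr EFin; rewrite /F /cut; case: ifPn => // /set_mem cv.
  have bv : bdry A (cinv c (joinv (0, v))).
    exists c; split => //; first exact: (cinv_dom HM Ac cv).
    by rewrite (cinvK HM Ac cv) joinvE unlift_none.
  by rewrite wflux_bdry//; ring.
apply.
  apply: (cut_integrable HM Ac cK Kc KL supD) => x cx.
  by apply: hcontM; [exact: (continuous_ccont HM density_cont Ac cx)|exact: (vol_ccont HM Hg Ac cx)].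
move=> x; case: ifPn => [/set_mem hx|]; last first.
  rewrite notin_setE => hx; rewrite /cut; case: ifPn => // /set_mem cx.
  by exfalso; apply: hx; exact: (cimg_half HM Ac cx).
case: (pselect (cimg c x)) => cx; last first.
  have nK : ~ K x by move=> /Kc.
  rewrite (cut_out supD nK) big1// => j _; exact: (cut_pder_out cK (FK j) _ hx nK).
rewrite cut_in//.
have dF j : pder j (F j) x = pder j (psi \o cinv c) x * wflux (g c) (u c) scal c3 j x +
    psi (cinv c x) * pder j (wflux (g c) (u c) scal c3 j) x.
  rewrite (cut_pder_in HM Ac _ _ cx).
  exact: (is_pder_val hx (is_pderM (C1at_is_pder (psiC x cx)) (C1at_is_pder (wYC j x cx)))).
rewrite (eq_bigr _ (fun j _ => dF j)) big_split /= -mulr_sumr -(flow_chart Cpsi Ac cx).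
rewrite /density mulrDl [X in X <= _]addrC [flow _ _ * _]mulrC lerD2l -mulrA.
(* Only where [psi] is nonzero is Lap f = - q f known, and only there is the estimate of div X
   used. *)
case: (eqVneq (psi (cinv c x)) 0) => [->|p0]; first by rewrite !mul0r.
apply: ler_wpM2l; first exact: psi0.
have Lx : laplacian (g c) (u c) x = - qc * u c x.
  by apply/eqP; rewrite mulNr -addr_eq0 (lapqE sp cs Ac cx) psi_lap.
rewrite mulrC.
exact: (@div_wflux R m (cdomain sp Ac) (g c)
    (metric_smooth Hg Ac) (fun x => metric_sym Hg Ac) (fun x => metric_pos Hg Ac)
    (u c) (f_chart_smooth sp Ac) scal (fun x => f_static sp Ac) (fun x => @cs c x Ac)
    (m_gt0 sp) c3 x cx Lx (f_ge0 sp _)).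
Qed.

End ChartInequality.

(** * Strict positivity of integrals of continuous functions *)

Section PositiveIntegral.
Context {R : realType} {m : nat} {M : ptopologicalType}.
Variables (A : set (chart R m M)) (g : chart R m M -> 'rV[R]_m.+1 -> 'M[R]_m.+1).
Hypothesis HM : manifold_with_boundary A.
Hypothesis Hg : riemannian_metric A g.
Variables (mu : {measure set (@borel M) -> \bar R}).
Hypothesis vol_mu : is_volume A g mu.
Local Notation bR n := (borelT 'rV[R]_n).

(** In a chart at [p] the integrand times the volume density exceeds a positive constant on a
    nondegenerate box. *)
Lemma integral_pos (phi : M -> R) (p : M) : continuous phi -> (forall q, 0 <= phi q) ->
  0 < phi p -> (0 < \int[mu]_(q in (setT : set (borelT M))) (phi q)%:E)%E.
Proof.
move=> cphi phi0 phip; have [c Ac cp] := chart_at HM p.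
have cx := cimg_cmap cp; set x := cmap c p in cx.
pose F (y : 'rV[R]_m.+1) : R := phi (cinv c y) * vol g c y.
have volx : 0 < vol g c x by rewrite sqrtr_gt0; exact: (metric_det_gt0 Hg Ac cx).
have cF : hcont F x.
  apply: hcontM; first exact: (continuous_ccont HM cphi Ac cx).
  exact: (vol_ccont HM Hg Ac cx).
have Fx : 0 < F x by rewrite /F (cmapK HM Ac cp) mulr_gt0.
pose d := F x / 2; have d0 : 0 < d by rewrite divr_gt0.
have nF : \forall y \near hnbhs x, d < F y.
  by apply: (cvgr_gt _ cF); rewrite /d ltr_pdivrMr// ltr_pMr// ltr1n.
have /hnbhsP[e e0 He] : \forall y \near hnbhs x, cimg c y /\ d < F y.
  by apply: filterS2 (cimg_near HM Ac cx) nF.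
(* The box extends from [x] in the positive directions only, so it stays in the half-space when [p]
   is a boundary point. *)
pose b : 'rV[R]_m.+1 := \row_k (x 0 k + e / 2).
have Bsub y : cbox x b y -> cimg c y /\ d < F y.
  move=> yb; apply: He.
    by have /andP[+ _] := yb ord0; apply: le_trans; exact: (cimg_half HM Ac cx).
  move=> k; have := yb k; rewrite mxE => /andP[h1 h2].
  rewrite ger0_norm ?subr_ge0//.
  have eh : e / 2 < e by rewrite ltr_pdivrMr// ltr_pMr// ltr1n.
  by rewrite ltrBlDl; apply: le_lt_trans h2 _; rewrite ltrD2l.
have mB : measurable (cbox x b) by exact: cbox_measurable.
have oc : measurable (cdom c : set (borelT M)).
  by apply: open_borel; exact: (chart_open (chartP HM Ac)).
have mphi := continuous_meas cphi.
have mh : measurable_fun setT (fun q : borelT M => (phi q * \1_(cdom c) q)%:E).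
  by apply/measurable_EFinP; apply: measurable_funM.
have h0 q : (0 <= (phi q * \1_(cdom c) q)%:E)%E by rewrite lee_fin mulr_ge0.
apply: (@lt_le_trans _ _ (\int[mu]_(q in (setT : set (borelT M))) (phi q * \1_(cdom c) q)%:E)%E); last first.
  apply: ge0_le_integral => //; first exact/measurable_EFinP.
  move=> q _; rewrite lee_fin indicE; case: (_ \in _); rewrite ?mulr1// mulr0; exact: phi0.
rewrite (@ge0_transfer _ _ (borelT M) (bR m.+1) R mu (lam m.+1) (cdom c) (cpoint c) (cut c (vol g c)))//; last 5 first.
- exact: (cpoint_meas HM Ac).
- exact: (cut_meas HM Ac (vol_ccont HM Hg Ac)).
- by apply: cut_ge0 => y; exact: sqrtr_ge0.
- by move=> B; exact: (volume_chart HM Hg Ac vol_mu).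
- by move=> q cq; rewrite indicE memNset// mulr0.
apply: (@lt_le_trans _ _ (\int[lam m.+1]_y (d%:E * (\1_(cbox x b) y)%:E))%E).
  rewrite ge0_integralZl//; last 2 first.
  - exact/measurable_EFinP.
  - by rewrite lee_fin ltW.
  have -> : (\int[lam m.+1]_y (\1_(cbox x b) y)%:E = (\prod_j (b 0 j - x 0 j)%R)%:E)%E.
    rewrite integral_indic// setIT; apply: lam_cbox => j.
    by rewrite mxE lerDl divr_ge0// ltW.
  rewrite -EFinM lte_fin mulr_gt0// prodr_gt0// => j _.
  by rewrite mxE addrC addKr divr_gt0.
apply: ge0_le_integral => //.
- by move=> y _; rewrite -EFinM lee_fin mulr_ge0// ltW.
- by apply: emeasurable_funM => //; exact/measurable_EFinP.
- apply: emeasurable_funM; last by apply/measurable_EFinP; exact: (cut_meas HM Ac (vol_ccont HM Hg Ac)).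
  by apply: (measurableT_comp mh); exact: (cpoint_meas HM Ac).
move=> y _; rewrite -!EFinM lee_fin [X in d * X]indicE.
case: (boolP (y \in cbox x b)) => [/set_mem/Bsub[cy Fy]|_]; last first.
  by rewrite mulr0; apply: mulr_ge0; [exact: mulr_ge0|apply: cut_ge0 => z; exact: sqrtr_ge0].
rewrite mulr1 /cpoint /cut (mem_set cy) indicE mem_set ?mulr1 ?ltW//.
exact: (cinv_dom HM Ac cy).
Qed.

End PositiveIntegral.

(** * The global inequality and its strictness *)

Section Global.
Context {R : realType} {m : nat} {M : ptopologicalType}.
Variables (A : set (chart R m M)) (g : chart R m M -> 'rV[R]_m.+1 -> 'M[R]_m.+1).
Variables (f rho : M -> R) (scal : R) (mu sigma : {measure set (@borel M) -> \bar R}).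
Hypothesis sp : static_perfect_fluid A g f rho.
Hypothesis compactM : compact [set: M].
Hypothesis cs : constant_scalar_curv A g scal.
Hypothesis scal_gt0 : 0 < scal.
Hypothesis vol_mu : is_volume A g mu.
Hypothesis vol_sigma : is_boundary_volume A g sigma.
Variable k2 : R.
Hypothesis gradsq_bdry : forall p, bdry A p -> gradsq sp p = k2.
Implicit Types (c : chart R m M) (p q : M) (x y : 'rV[R]_m.+1) (a b phi psi : M -> R).
Local Notation HM := (spf_manifold sp).
Local Notation Hg := (spf_metric sp).
Local Notation n := (m.+1%:R : R).
Local Notation qc := (scal / m%:R).
Local Notation bM := (setT : set (borelT M)).
Local Notation bulkM := (@bulk R m M f scal k2).
Local Notation lapq := (@lapq R m M f rho scal).

(* M is not assumed connected; M0 is the union of the components that meet the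
   boundary and of those where Lap f + q f happens to vanish. *)
Definition M0 : set (borelT M) := [set p | lapq p = 0].

Lemma M0_near p : \forall q \near p, (\1_M0 q : R) = \1_M0 p.
Proof.
apply: filterS (lapq_locally_const sp cs p) => q e.
by rewrite !indicE; congr (_%:R); congr nat_of_bool; apply/idP/idP; rewrite !inE /M0 /= e.
Qed.

Lemma M0_C1 : C1fun A (\1_M0 : M -> R).
Proof. by move=> p; exact: (C1fun_at_cst HM (M0_near p)). Qed.

Lemma M0_meas : measurable M0.
Proof.
apply: closed_borel; have /continuous_closedP := C1fun_cont HM (lapq_C1 scal sp).
by move=> /(_ [set 0]); apply; exact: closed_eq.
Qed.

Lemma bdry_M0 : bdry A `<=` M0.
Proof. by move=> p; exact: (lapq_bdry scal sp). Qed.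

Lemma bdry_meas : measurable (bdry A : set (borelT M)).
Proof.
rewrite -(spf_f_zero sp); apply: closed_borel.
by have /continuous_closedP := C1fun_cont HM (f_C1 sp); apply; exact: closed_eq.
Qed.

Lemma k2_ge0 : 0 <= k2.
Proof.
have [p bp] := spf_bdry sp; rewrite -(gradsq_bdry bp) /gradsq /bracket.
have [As ds] := chart_selP sp p; rewrite cbracketE.
set v := grd _ _ _; have [v0|v0] := eqVneq v^T 0.
  by rewrite v0 !mul0mx mxE.
have Gs := metric_sym Hg As (cimg_cmap ds); have Gp := metric_pos Hg As (cimg_cmap ds).
by have := posdef_inv Gs Gp v0; rewrite trmxK => /ltW.
Qed.

(** The weights add up to a locally constant function, so their differentials add up to zero. *)
Lemma flow_sum (s : seq M) (Psi : M -> M -> R) q : (forall p, C1fun A (Psi p)) ->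
  (forall r, \sum_(p <- s) Psi p r = \1_M0 r) -> \sum_(p <- s) flow scal sp k2 (Psi p) q = 0.
Proof.
move=> CP PE.
have bE a : \sum_(p <- s) bracket sp (Psi p) a q = 0.
  have [As ds] := chart_selP sp q; set c := chart_sel sp q in As ds.
  have hx := cimg_half HM As (cimg_cmap ds).
  have dE i : \sum_(p <- s) pder i (Psi p \o cinv c) (cmap c q) = 0.
    have d := is_pder_sum (r := s) (P := xpredT) (F := fun p => Psi p \o cinv c)
       (l := fun p => pder i (Psi p \o cinv c) (cmap c q))
       (fun p => C1at_is_pder (CP p q c As ds)).
    rewrite -(is_pder_val hx d).
    have nE : {near hnbhs (cmap c q), (fun y => \sum_(p <- s) (Psi p \o cinv c) y) =1
         (fun=> \1_M0 q)}.
      by apply: filterS (near_cinv HM As ds (M0_near q)) => y <- /=; rewrite PE.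
    have [-> _] := pder_congr i hx nE.
    exact: (is_pder_val hx (is_pder_cst _ _ _)).
  rewrite /bracket /cbracket -/c exchange_big big1//= => i _; rewrite exchange_big big1//= => j _.
  by rewrite -mulr_suml -mulr_sumr dE mulr0 mul0r.
rewrite /flow sumrB -!mulr_sumr !bE; ring.
Qed.

Lemma global_divergence :
  [/\ mu.-integrable bM (fun p => (\1_M0 p * bulkM p)%:E),
      mu.-integrable bM (fun p => (\1_M0 p)%:E) &
  ((2 * (k2 * Num.sqrt k2))%:E * sigma M0 <=
    \int[mu]_(p in bM) (- (\1_M0 p * bulkM p))%:E)%E].
Proof.
have [s [psi [Cpsi psi0 psi1 spsi]]] := partition_of_unity HM compactM.
(* The locally constant factor keeps the weights C^1 and confines them to the set where Lap f = - q
   f. *)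
pose Psi p q := \1_M0 q * psi p q.
have CP p : C1fun A (Psi p) by exact: (C1funM HM M0_C1 (Cpsi p)).
have P0 p q : 0 <= Psi p q by rewrite mulr_ge0.
have PE q : \sum_(p <- s) Psi p q = \1_M0 q by rewrite -mulr_sumr psi1 mulr1.
have PS p : exists2 c, A c & supported c (Psi p).
  by have [c Ac sc] := spsi p; exists c => //; exact: supportedM.
have PL p q : Psi p q != 0 -> lapq q = 0.
  rewrite mulf_eq0 negb_or indicE => /andP[+ _]; case: (boolP (q \in M0)) => [/set_mem//|].
  by rewrite eqxx.
pose De p := density scal sp k2 (Psi p).
have DE q : \sum_(p <- s) De p q = \1_M0 q * bulkM q.
  by rewrite /De /density big_split /= (flow_sum q CP PE) addr0 -mulr_suml PE.
have iD p : mu.-integrable bM (EFin \o De p).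
  have [c Ac sc] := PS p.
  exact: (density_integrable scal sp vol_mu k2 Ac (CP p) sc).
have iP p : mu.-integrable bM (EFin \o Psi p).
  have [c Ac sc] := PS p.
  exact: (chart_integrable HM Hg vol_mu Ac (C1fun_cont HM (CP p)) sc).
have iND p : mu.-integrable bM (fun q => (- De p q)%:E).
  by have := integrableN (iD p); apply: eq_integrable => // q _.
split.
- have -> : (fun q => (\1_M0 q * bulkM q)%:E) = (fun q => \sum_(p <- s) (EFin \o De p) q)%E.
    by apply/funext => q; rewrite -DE sumEFin.
  by apply: integrable_sum => // p _; exact: iD.
- have -> : (fun q => (\1_M0 q)%:E) = (fun q => \sum_(p <- s) (EFin \o Psi p) q)%E.
    by apply/funext => q; rewrite -PE sumEFin.
  by apply: integrable_sum => // p _; exact: iP.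
have -> : (\int[mu]_(q in bM) (- (\1_M0 q * bulkM q))%:E =
    \sum_(p <- s) \int[mu]_(q in bM) (- De p q)%:E)%E.
  rewrite -(integral_sum _ iND)//; apply: eq_integral => q _.
  by rewrite sumEFin -DE sumrN.
have K0 : 0 <= 2 * (k2 * Num.sqrt k2).
  by rewrite !mulr_ge0// ?sqrtr_ge0//; exact: k2_ge0.
set K := 2 * _ in K0 *.
have mP p : measurable_fun bM (Psi p : borelT M -> R).
  by apply: continuous_meas; exact: (C1fun_cont HM (CP p)).
have -> : (K%:E * sigma M0 = \sum_(p <- s) \int[sigma]_(q in bM) (K * Psi p q)%:E)%E.
  rewrite -ge0_integral_sum//; last 2 first.
  - by move=> p; apply/measurable_EFinP; apply: measurable_funM.
  - by move=> p q _; rewrite lee_fin mulr_ge0.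
  under eq_integral do rewrite sumEFin -mulr_sumr PE EFinM.
  rewrite ge0_integralZl//; first by rewrite integral_indic ?setIT//; exact: M0_meas.
  by apply/measurable_EFinP; exact: measurable_indic M0_meas.
apply: lee_sum => p _; have [c Ac sc] := PS p.
have := chart_divergence cs vol_mu vol_sigma gradsq_bdry Ac (CP p) (P0 p) sc (PL p).
rewrite leeNr; congr (_ <= _)%E.
rewrite -integralN ?integrable_add_def//.
exact: (iD p).
Qed.

(* When t = 0 the point has to be taken off the boundary. *)
Lemma excess_point (t E : R) : 0 <= t -> 0 < E ->
  exists p, M0 p /\ 0 < E * (f p - t) ^+ 2 * (f p + 2 * t).
Proof.
move=> t0 E0; have [p bp] := spf_bdry sp.
have [t_pos|] := ltP 0 t.
  exists p; split; first exact: bdry_M0.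
  by rewrite ((f_bdry sp p).2 bp) sub0r sqrrN add0r !mulr_gt0// exprn_gt0.
move=> t_le; have {t_le t0} -> : t = 0 by apply/eqP; rewrite eq_le t_le.
have [c Ac cp] := chart_at HM p; set x := cmap c p.
have nM0 : \forall q \near p, M0 q.
  apply: filterS (lapq_locally_const sp cs p) => q e; rewrite /M0 /= e; exact: (lapq_bdry scal sp).
have /hnbhsP[e e0 He] : \forall y \near hnbhs x, cimg c y /\ M0 (cinv c y).
  by apply: filterS2 (cimg_near HM Ac (cimg_cmap cp)) (near_cinv HM Ac cp nM0).
pose y : 'rV[R]_m.+1 := x + (e / 2) *: delta_mx 0 ord0.
have hx := cimg_half HM Ac (cimg_cmap cp).
have e2 : 0 < e / 2 by rewrite divr_gt0.
have [cy My] : cimg c y /\ M0 (cinv c y).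
  apply: He; first by apply: half_shift => //; exact: ltW.
  move=> k; rewrite shiftE addrC addKr; case: (k == ord0); rewrite ?mulr0n ?normr0// mulr1n.
  by rewrite ger0_norm ?ltW// ltr_pdivrMr// ltr_pMr// ltr1n.
exists (cinv c y); split => //.
have fy : 0 < f (cinv c y).
  apply: (spf_f_pos sp) => by_.
  have := bdry_coord HM Hg Ac (cinv_dom HM Ac cy) by_; rewrite (cinvK HM Ac cy) shiftE eqxx mulr1n.
  rewrite (bdry_coord HM Hg Ac cp bp) add0r => e20; by rewrite e20 ltxx in e2.
by rewrite subr0 mulr0 addr0 !mulr_gt0// exprn_gt0.
Qed.

(** [I] is the integral over [M0] of the excess E (f-t)^2 (f+2t). It is kept as an explicit gap: it
    gives strictness and later excludes k = 0. *)
Lemma volume_gap (t : R) : 0 <= t ->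
  (n + 2) * qc ^+ 2 / (2 * n) * t ^+ 2 = k2 * qc ->
  exists mu0 I : R, [/\ mu M0 = mu0%:E, 0 < I &
    ((2 * (k2 * Num.sqrt k2))%:E * sigma M0 <= (2 * k2 * qc * t * mu0 - I)%:E)%E].
Proof.
move=> t0 tE; have [ib iM dv] := global_divergence.
have m0 : 0 < m%:R :> R by rewrite ltr0n (m_gt0 sp).
have q0 : 0 < qc by rewrite divr_gt0.
set E := (n + 2) * qc ^+ 2 / (2 * n) in tE.
have E0 : 0 < E.
  have n0 : 0 < n by rewrite ltr0n.
  have n2 : 0 < n + 2 by rewrite addr_gt0.
  by rewrite /E; apply: divr_gt0; apply: mulr_gt0 => //; exact: exprn_gt0.
pose ex p := E * (f p - t) ^+ 2 * (f p + 2 * t).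
have ex0 p : 0 <= ex p.
  rewrite /ex; apply: mulr_ge0; first by rewrite mulr_ge0 ?sqr_ge0// ltW.
  by apply: addr_ge0; [exact: (f_ge0 sp)|rewrite mulr_ge0].
(* By the choice of [t] the cubic [bulk] has its minimum over f >= 0 at t, with value -2 E t^3 = -2
   k2 q t. *)
have bulkE p : bulkM p = ex p - 2 * k2 * qc * t.
  rewrite /bulk /ex -/E.
  have -> : 2 * k2 * qc * t = 2 * (E * t ^+ 2) * t by rewrite tE; ring.
  by rewrite -[3 * k2 * qc]mulrA -tE; ring.
pose C := 2 * k2 * qc * t.
have muM : (\int[mu]_(p in bM) (\1_M0 p)%:E)%E = mu M0.
  by rewrite integral_indic ?setIT//; exact: M0_meas.
have fM : mu M0 \is a fin_num by rewrite -muM; exact: integrable_fin_num iM.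
have iCM : mu.-integrable bM (fun p => (C * \1_M0 p)%:E).
  by have := integrableZl measurableT C iM; apply: eq_integrable.
have iex : mu.-integrable bM (fun p => (\1_M0 p * ex p)%:E).
  have := integrableD measurableT ib iCM; apply: eq_integrable => // p _ /=.
  by rewrite -EFinD bulkE -/C; congr EFin; ring.
have fex : (\int[mu]_(p in bM) (\1_M0 p * ex p)%:E)%E \is a fin_num by exact: integrable_fin_num iex.
exists (fine (mu M0)), (fine (\int[mu]_(p in bM) (\1_M0 p * ex p)%:E)%E); split.
- by rewrite fineK.
- have [p [Mp exp]] := excess_point t0 E0.
  rewrite -lte_fin fineK//; apply: (integral_pos HM Hg vol_mu (p := p)).
  + move=> q; apply: cvgM; first exact: (C1fun_cont HM M0_C1).
    have cf : f r @[r --> q] --> f q by exact: (C1fun_cont HM (f_C1 sp)).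
    apply: cvgM; last by apply: cvgD => //; exact: cvg_cst.
    apply: cvgM; first exact: cvg_cst.
    have -> : (fun r => (f r - t) ^+ 2) = (fun r => (f r - t) * (f r - t)) by apply/funext => r; rewrite expr2.
    by rewrite expr2; apply: cvgM; apply: cvgB => //; exact: cvg_cst.
  + by move=> q; rewrite mulr_ge0.
  + by rewrite indicE mem_set// mul1r.
apply: (le_trans dv); rewrite EFinB EFinM !fineK// -muM.
rewrite -(integralZl _ iM)// -integralB//.
rewrite le_eqVlt; apply/orP; left; apply/eqP; apply: eq_integral => p _.
by rewrite -EFinM -EFinB bulkE -/C; congr EFin; ring.
Qed.

End Global.

Lemma strict_volume_bound (R : realType) (m : nat) (M : ptopologicalType)
    (A : set (chart R m M)) (g : chart R m M -> 'rV[R]_m.+1 -> 'M[R]_m.+1)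
    (f rho : M -> R) (scal : R) (mu sigma : {measure set (@borel M) -> \bar R}) :
  static_perfect_fluid A g f rho -> compact [set: M] -> connected (bdry A) ->
  constant_scalar_curv A g scal -> 0 < scal ->
  is_volume A g mu -> is_boundary_volume A g sigma ->
  ((Num.sqrt (((m.+1%:R - 1) * (m.+1%:R + 2)) / (2 * m.+1%:R * scal)))%:E
    * sigma (bdry A) < mu [set: M])%E.
Proof.
move=> sp cM cb cs S0 vmu vsig; set n : R := m.+1%:R; have [k2 Hk] := gradsq_const sp cb.
have k0 := k2_ge0 Hk.
have m0 : 0 < m%:R :> R by rewrite ltr0n (m_gt0 sp).
have nE : n = m%:R + 1 by rewrite /n -natr1.
set q := scal / m%:R; have q0 : 0 < q by rewrite divr_gt0.
have n0 : 0 < n by rewrite nE addr_gt0.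
have n2 : 0 < n + 2 by rewrite addr_gt0.
(* The condition E t^2 = k^2 q has the solution t = k tau. *)
pose tau := Num.sqrt (2 * n / ((n + 2) * q)).
have tau2 : tau ^+ 2 = 2 * n / ((n + 2) * q).
  by rewrite sqr_sqrtr// divr_ge0// mulr_ge0// ltW.
have tau0 : 0 < tau by rewrite sqrtr_gt0 divr_gt0// mulr_gt0.
pose k := Num.sqrt k2; have kk : k2 = k ^+ 2 by rewrite sqr_sqrtr.
have kge : 0 <= k by exact: sqrtr_ge0.
have [|mu0 [J [muE J0 le]]] := volume_gap (g := g) cM cs S0 vmu vsig Hk (t := k * tau) (mulr_ge0 kge (ltW tau0)).
  rewrite -/n -/q [(k * tau) ^+ 2]exprMn -kk tau2; field.
  by rewrite !gt_eqF.
(* The divergence inequality bounds the boundary measure of [M0], a set that contains the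
   boundary. *)
have sle : (sigma (bdry A) <= sigma (@M0 R m M f rho scal))%E.
  apply: le_measure; rewrite ?inE; [exact: (bdry_meas sp)|exact: (M0_meas scal sp)|exact: (bdry_M0 scal sp)].
have mule : (mu (@M0 R m M f rho scal) <= mu [set: M])%E.
  by apply: le_measure; rewrite ?inE //; exact: (M0_meas scal sp).
apply: lt_le_trans mule; rewrite muE.
(* For k = 0 one has t = 0 and the inequality reads 0 <= -J with J > 0, so no boundary point lemma
   is called for. *)
have kpos : 0 < k.
  rewrite lt_neqAle kge andbT eq_sym; apply/eqP => kz.
  by move: le; rewrite kk kz expr0n /= !(mul0r, mulr0) mul0e sub0r lee_fin oppr_ge0 leNgt J0.
have c0 : 0 < 2 * (k2 * k) by rewrite kk !mulr_gt0// exprn_gt0.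
set K := Num.sqrt _; have K0 : 0 <= K by exact: sqrtr_ge0.
(* Dividing 2 k^3 sigma < 2 k^2 q (k tau) mu0 by 2 k^3 leaves the factor q tau, whose inverse is the
   constant of the theorem. *)
have KE : K * (q * tau) = 1.
  have p0 : 0 < q * tau by rewrite mulr_gt0.
  rewrite -[q * tau](ger0_norm (ltW p0)) -sqrtr_sqr -sqrtrM; last first.
    by rewrite divr_ge0 ?mulr_ge0 ?ltW// nE addrK.
  rewrite exprMn tau2 (_ : _ * _ = 1) ?sqrtr1// /q nE; field.
  by rewrite -nE !gt_eqF.
apply: (@le_lt_trans _ _ (K%:E * sigma (@M0 R m M f rho scal))%E); first exact: lee_wpmul2l.
(* Finiteness of the boundary measure comes from the inequality itself, whose right side is real and
   whose coefficient [c0] is positive. *)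
have sfin : sigma (@M0 R m M f rho scal) \is a fin_num.
  rewrite ge0_fin_numE//; rewrite ltNge leye_eq; apply/negP => /eqP soo.
  by move: le; rewrite soo gt0_muley ?lte_fin// leye_eq.
move: le; rewrite -(fineK sfin) -!EFinM lee_fin lte_fin => le.
set s := fine _ in le *.
have e1 : 2 * (k2 * k) * (s - q * tau * mu0) < 0.
  have -> : 2 * (k2 * k) * (s - q * tau * mu0) =
     2 * (k2 * k) * s - 2 * k2 * q * (k * tau) * mu0 by ring.
  by move: le; rewrite -/q -/k; lra.
have e2 : s < q * tau * mu0 by move: e1; rewrite pmulr_rlt0// subr_lt0.
have Kp : 0 < K by rewrite lt_neqAle K0 andbT; apply: contra_eq_neq KE => <-; rewrite mul0r eq_sym oner_eq0.
have : K * s < K * (q * tau * mu0) by rewrite ltr_pM2l.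
by rewrite mulrA KE mul1r.
Qed.

Theorem corollary1 (R : realType) (m : nat) (M : ptopologicalType)
    (A Or : set (chart R m M))
    (g : chart R m M -> 'rV[R]_m.+1 -> 'M[R]_m.+1)
    (f rho : M -> R) (scal : R)
    (mu sigma : {measure set (@borel M) -> \bar R}) :
  static_perfect_fluid A g f rho ->
  compact [set: M] ->
  oriented_by A Or ->
  connected (bdry A) ->
  constant_scalar_curv A g scal -> 0 < scal ->
  is_volume A g mu ->
  is_boundary_volume A g sigma ->
  let n : R := m.+1%:R in
  let K : R := Num.sqrt (((n - 1) * (n + 2)) / (2 * n * scal)) in
  ((K%:E * sigma (bdry A))%E <= mu [set: M])%E /\
  (mu [set: M] = (K%:E * sigma (bdry A))%E ->
   isometric_to_hemisphere A g (Num.sqrt (n * (n - 1) / scal))).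
Proof.
move=> sp cM _ cb cs S0 vmu vsig n K.
have := strict_volume_bound sp cM cb cs S0 vmu vsig; rewrite -/n -/K => lt.
by split=> [|e]; [exact: ltW|move: lt; rewrite e ltxx].
Qed.
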